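(* Let $D=d+1\ge 2$ and let $\{P(k_1,\mathbf k)\}_{(k_1,\mathbf k)\in\mathbb R^D}$ be a family of rank-$m$ orthogonal projections on a Hilbert space $\mathcal H$ which is of class $C^1$ (at least), $\mathbb Z^D$-periodic, and time-reversal symmetric with respect to an antiunitary $\theta$ with $\theta^2=\pm\mathbf 1$. Assume that the restriction $\{P(0,\mathbf k)\}_{\mathbf k\in\mathbb R^d}$ admits a smooth, $\mathbb Z^d$-periodic, time-reversal symmetric Bloch frame $\{\xi_a(0,\mathbf k)\}_{a=1}^m$. Let $T_{\mathbf k}(k_1,0)$ be the parallel transport unitary along the segment from $(0,\mathbf k)$ to $(k_1,\mathbf k)$, and define $[\alpha(\mathbf k)]_{ab}:=\langle\xi_a(0,\mathbf k),T_{\mathbf k}(1,0)\xi_b(0,\mathbf k)\rangle$. Then $\alpha$ is a family of matching matrices (with $\varepsilon=\mathbf 1$ if $\theta^2=\mathbf 1$ and $\varepsilon=J$ if $\theta^2=-\mathbf 1$), and $\alpha$ is equivariantly null-homotopic if and only if there exists a Bloch frame for $\{P(k_1,\mathbf k)\}_{(k_1,\mathbf k)\in\mathbb R^D}$ which is continuous, $\mathbb Z^D$-periodic and time-reversal symmetric.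
   Context: A family of projections is time-reversal symmetric w.r.t. an antiunitary $\theta:\mathcal H\to\mathcal H$ if $\theta P(\mathbf q)\theta^{-1}=P(-\mathbf q)$ for all $\mathbf q\in\mathbb R^D$; bosonic if $\theta^2=\mathbf 1$, fermionic if $\theta^2=-\mathbf 1$ (then $m$ is even). A Bloch frame is a collection of maps $\xi_1,\dots,\xi_m:\mathbb R^D\to\mathcal H$ such that $\{\xi_a(\mathbf q)\}$ is an orthonormal basis of $\mathrm{Ran}\,P(\mathbf q)$ for every $\mathbf q$; it is continuous/periodic if each $\xi_a$ is continuous/$\mathbb Z^D$-periodic; it is time-reversal symmetric if $\xi_b(-\mathbf q)=\sum_{a}[\theta\xi_a(\mathbf q)]\varepsilon_{ab}$ for all $b$ and $\mathbf q$, where $\varepsilon=\mathbf 1$ in the bosonic case and $\varepsilon=J=\begin{pmatrix}0&\mathbf 1\\-\mathbf 1&0\end{pmatrix}$ in the fermionic case (same definition for frames of the $d$-dimensional restriction). The parallel transport $T_{\mathbf k}(k_1,0)$ is the unitary solving $\partial_{k_1}T_{\mathbf k}(k_1,0)=[\partial_{k_1}P(k_1,\mathbf k),P(k_1,\mathbf k)]\,T_{\mathbf k}(k_1,0)$, $T_{\mathbf k}(0,0)=\mathbf 1$; it maps $\mathrm{Ran}\,P(0,\mathbf k)$ onto $\mathrm{Ran}\,P(k_1,\mathbf k)$. A family of matching matrices is a continuous, $\mathbb Z^d$-periodic map $\alpha:\mathbb R^d\to U(m)$ with $\varepsilon\alpha(\mathbf k)=\alpha(-\mathbf k)^t\varepsilon$.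 It is equivariantly null-homotopic if there is a map $(t,\mathbf k)\mapsto\alpha_t(\mathbf k)$, continuous in $t\in[0,1]$, each $\alpha_t$ a family of matching matrices, $\alpha_0=\alpha$, $\alpha_1\equiv\mathbf 1$. *)

(* Defs.v *)
From Stdlib Require Import Reals ZArith Lra.
Open Scope R_scope.

Record Cx := mkCx { cre : R; cim : R }.
Definition C0 : Cx := mkCx 0 0.
Definition C1 : Cx := mkCx 1 0.
Definition RtoC (r : R) : Cx := mkCx r 0.
Definition Cadd (a b : Cx) : Cx := mkCx (cre a + cre b) (cim a + cim b).
Definition Copp (a : Cx) : Cx := mkCx (- cre a) (- cim a).
Definition Csub (a b : Cx) : Cx := Cadd a (Copp b).
Definition Cmul (a b : Cx) : Cx :=
  mkCx (cre a * cre b - cim a * cim b) (cre a * cim b + cim a * cre b).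
Definition Cconj (a : Cx) : Cx := mkCx (cre a) (- cim a).
Definition Cnorm (a : Cx) : R := sqrt (cre a ^ 2 + cim a ^ 2).
Fixpoint Csum (n : nat) (f : nat -> Cx) : Cx :=
  match n with O => C0 | S n' => Cadd (Csum n' f) (f n') end.

Record HilbertSpace := {
  hcar :> Type;
  hadd : hcar -> hcar -> hcar;
  hzero : hcar;
  hopp : hcar -> hcar;
  hscal : Cx -> hcar -> hcar;
  hinner : hcar -> hcar -> Cx;
  hadd_assoc : forall x y z, hadd x (hadd y z) = hadd (hadd x y) z;
  hadd_comm : forall x y, hadd x y = hadd y x;
  hadd_0 : forall x, hadd hzero x = x;
  hadd_opp : forall x, hadd (hopp x) x = hzero;
  hscal_1 : forall x, hscal C1 x = x;
  hscal_assoc : forall a b x, hscal a (hscal b x) = hscal (Cmul a b) x;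
  hscal_distr_l : forall a x y, hscal a (hadd x y) = hadd (hscal a x) (hscal a y);
  hscal_distr_r : forall a b x, hscal (Cadd a b) x = hadd (hscal a x) (hscal b x);
  hinner_add : forall x y z, hinner x (hadd y z) = Cadd (hinner x y) (hinner x z);
  hinner_scal : forall a x y, hinner x (hscal a y) = Cmul a (hinner x y);
  hinner_conj : forall x y, hinner y x = Cconj (hinner x y);
  hinner_pos : forall x, 0 <= cre (hinner x x);
  hinner_def : forall x, hinner x x = C0 -> x = hzero;
  hcomplete : forall u : nat -> hcar,
    (forall eps, 0 < eps -> exists N, forall n p, (N <= n)%nat -> (N <= p)%nat ->
       sqrt (cre (hinner (hadd (u n) (hopp (u p))) (hadd (u n) (hopp (u p))))) < eps) ->
    exists l, forall eps, 0 < eps -> exists N, forall n, (N <= n)%nat ->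
       sqrt (cre (hinner (hadd (u n) (hopp l)) (hadd (u n) (hopp l)))) < eps
}.
Arguments hadd {_}. Arguments hzero {_}. Arguments hopp {_}.
Arguments hscal {_}. Arguments hinner {_}.

Definition Idx (d : nat) := {i : nat | (i < d)%nat}.
Definition Rvec (d : nat) := Idx d -> R.
Definition vneg {d} (k : Rvec d) : Rvec d := fun i => - k i.
Definition vshift {d} (k : Rvec d) (n : Idx d -> Z) : Rvec d :=
  fun i => k i + IZR (n i).
Definition vupd {d} (k : Rvec d) (i : Idx d) (s : R) : Rvec d :=
  fun j => if Nat.eq_dec (proj1_sig j) (proj1_sig i) then k j + s else k j.
Definition close {d} (k k' : Rvec d) (delta : R) : Prop :=
  forall i, Rabs (k' i - k i) < delta.

(* ---------- complex m x m matrices (entries with indices < m matter) ---------- *)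
Definition Mat := nat -> nat -> Cx.
Definition Imat : Mat := fun a c => if Nat.eq_dec a c then C1 else C0.
(* J = [[0, 1], [-1, 0]] in blocks of size m/2 *)
Definition Jmat (m : nat) : Mat := fun a c =>
  let n := Nat.div m 2 in
  if andb (Nat.ltb a n) (Nat.eqb c (a + n)) then C1
  else if andb (andb (Nat.leb n a) (Nat.ltb a m)) (Nat.eqb a (c + n)) then Copp C1
  else C0.
(* epsilon = 1 (bosonic, b = false) or J (fermionic, b = true) *)
Definition epsm (b : bool) (m : nat) : Mat := if b then Jmat m else Imat.
Definition mmul (m : nat) (A B : Mat) : Mat := fun i j => Csum m (fun k => Cmul (A i k) (B k j)).
Definition mtr (A : Mat) : Mat := fun i j => A j i.
Definition madj (A : Mat) : Mat := fun i j => Cconj (A j i).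
Definition is_unitary (m : nat) (A : Mat) : Prop :=
  forall i j, (i < m)%nat -> (j < m)%nat ->
    mmul m (madj A) A i j = Imat i j /\ mmul m A (madj A) i j = Imat i j.

Definition matching (b : bool) (m : nat) {d} (alpha : Rvec d -> Mat) : Prop :=
  (forall k eps, 0 < eps -> exists delta, 0 < delta /\ forall k', close k k' delta ->
      forall i j, (i < m)%nat -> (j < m)%nat -> Cnorm (Csub (alpha k' i j) (alpha k i j)) < eps)
  /\ (forall k n i j, (i < m)%nat -> (j < m)%nat -> alpha (vshift k n) i j = alpha k i j)
  /\ (forall k, is_unitary m (alpha k))
  /\ (forall k i j, (i < m)%nat -> (j < m)%nat ->
        mmul m (epsm b m) (alpha k) i j = mmul m (mtr (alpha (vneg k))) (epsm b m) i j).

Definition equiv_null_homotopic (b : bool) (m : nat) {d} (alpha : Rvec d -> Mat) : Prop :=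
  exists A : R -> Rvec d -> Mat,
    (forall k i j, (i < m)%nat -> (j < m)%nat -> A 0 k i j = alpha k i j)
    /\ (forall k i j, (i < m)%nat -> (j < m)%nat -> A 1 k i j = Imat i j)
    /\ (forall t, 0 <= t <= 1 -> matching b m (A t))
    /\ (forall t k eps, 0 <= t <= 1 -> 0 < eps -> exists delta, 0 < delta /\
          forall t' k', 0 <= t' <= 1 -> Rabs (t' - t) < delta -> close k k' delta ->
          forall i j, (i < m)%nat -> (j < m)%nat ->
            Cnorm (Csub (A t' k' i j) (A t k i j)) < eps).

Section Hilb.
Context {H : HilbertSpace}.

Definition hsub (x y : H) : H := hadd x (hopp y).
Definition hnorm (x : H) : R := sqrt (cre (hinner x x)).
Fixpoint hsum (n : nat) (f : nat -> H) : H :=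
  match n with O => hzero | S n' => hadd (hsum n' f) (f n') end.

Definition Op := H -> H.
Definition opsub (A B : Op) : Op := fun x => hsub (A x) (B x).
Definition opcomp (A B : Op) : Op := fun x => A (B x).
Definition comm (A B : Op) : Op := opsub (opcomp A B) (opcomp B A).

Definition is_linear (A : Op) : Prop :=
  (forall x y, A (hadd x y) = hadd (A x) (A y)) /\ (forall a x, A (hscal a x) = hscal a (A x)).
Definition is_orth_proj (P : Op) : Prop :=
  is_linear P /\ (forall x, P (P x) = P x) /\ (forall x y, hinner (P x) y = hinner x (P y)).

Definition is_onb_ran (P : Op) (m : nat) (xi : nat -> H) : Prop :=
  (forall a c, (a < m)%nat -> (c < m)%nat ->
      hinner (xi a) (xi c) = if Nat.eq_dec a c then C1 else C0)
  /\ (forall a, (a < m)%nat -> P (xi a) = xi a)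
  /\ (forall x, P x = x -> x = hsum m (fun a => hscal (hinner (xi a) x) (xi a))).
Definition has_rank (P : Op) (m : nat) : Prop := exists xi, is_onb_ran P m xi.

Definition is_opderiv (F : R -> Op) (t : R) (G : Op) : Prop :=
  forall eps, 0 < eps -> exists delta, 0 < delta /\ forall h, h <> 0 -> Rabs h < delta ->
    forall x, hnorm (hsub (hsub (F (t + h) x) (F t x)) (hscal (RtoC h) (G x)))
              <= eps * Rabs h * hnorm x.

Definition op_cont2 {d} (F : R -> Rvec d -> Op) : Prop :=
  forall t k eps, 0 < eps -> exists delta, 0 < delta /\ forall t' k',
    Rabs (t' - t) < delta -> close k k' delta ->
    forall x, hnorm (hsub (F t' k' x) (F t k x)) <= eps * hnorm x.

Definition C1_family {d} (P : R -> Rvec d -> Op) : Prop :=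
  exists (G1 : R -> Rvec d -> Op) (G : Idx d -> R -> Rvec d -> Op),
    (forall t k, is_opderiv (fun s => P s k) t (G1 t k))
    /\ (forall i t k, is_opderiv (fun s => P t (vupd k i s)) 0 (G i t k))
    /\ op_cont2 P /\ op_cont2 G1 /\ (forall i, op_cont2 (G i)).

Definition vcont {d} (f : Rvec d -> H) : Prop :=
  forall k eps, 0 < eps -> exists delta, 0 < delta /\
    forall k', close k k' delta -> hnorm (hsub (f k') (f k)) < eps.
Definition is_vderiv {d} (f : Rvec d -> H) (i : Idx d) (k : Rvec d) (g : H) : Prop :=
  forall eps, 0 < eps -> exists delta, 0 < delta /\ forall h, h <> 0 -> Rabs h < delta ->
    hnorm (hsub (hsub (f (vupd k i h)) (f k)) (hscal (RtoC h) g)) <= eps * Rabs h.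
Fixpoint vCk {d} (n : nat) (f : Rvec d -> H) : Prop :=
  vcont f /\
  match n with
  | O => True
  | S n' => forall i, exists g : Rvec d -> H, (forall k, is_vderiv f i k (g k)) /\ vCk n' g
  end.
Definition vsmooth {d} (f : Rvec d -> H) : Prop := forall n, vCk n f.

Definition is_antiunitary (th : Op) : Prop :=
  (forall x y, th (hadd x y) = hadd (th x) (th y))
  /\ (forall a x, th (hscal a x) = hscal (Cconj a) (th x))
  /\ (forall x y, hinner (th x) (th y) = Cconj (hinner x y))
  /\ (forall y, exists x, th x = y).
Definition theta_sq (th : Op) (b : bool) : Prop :=
  forall x, th (th x) = if b then hopp x else x.

Definition trs_family {d} (th : Op) (P : R -> Rvec d -> Op) : Prop :=
  forall t k x, th (P t k x) = P (- t) (vneg k) (th x).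

Definition trs_image (th : Op) (b : bool) (m : nat) (v : nat -> H) (c : nat) : H :=
  hsum m (fun a => hscal (epsm b m a c) (th (v a))).

Definition restricted_frame {d} (P : R -> Rvec d -> Op) (th : Op) (b : bool) (m : nat)
  (xi : nat -> Rvec d -> H) : Prop :=
  (forall k, is_onb_ran (P 0 k) m (fun a => xi a k))
  /\ (forall a, (a < m)%nat -> vsmooth (xi a))
  /\ (forall a k n, (a < m)%nat -> xi a (vshift k n) = xi a k)
  /\ (forall c k, (c < m)%nat -> xi c (vneg k) = trs_image th b m (fun a => xi a k) c).

Definition full_frame {d} (P : R -> Rvec d -> Op) (th : Op) (b : bool) (m : nat)
  (Xi : nat -> R -> Rvec d -> H) : Prop :=
  (forall t k, is_onb_ran (P t k) m (fun a => Xi a t k))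
  /\ (forall a, (a < m)%nat -> forall t k eps, 0 < eps -> exists delta, 0 < delta /\
        forall t' k', Rabs (t' - t) < delta -> close k k' delta ->
          hnorm (hsub (Xi a t' k') (Xi a t k)) < eps)
  /\ (forall a t k (n1 : Z) n, (a < m)%nat -> Xi a (t + IZR n1) (vshift k n) = Xi a t k)
  /\ (forall c t k, (c < m)%nat ->
        Xi c (- t) (vneg k) = trs_image th b m (fun a => Xi a t k) c).

End Hilb.

(* Main.v *)
(** Write T_k(s) for the parallel transport and U(s,k) for the matrix of T_k(s) xi in a frame Xi
    of P(s,k).  Uniqueness for the skew equation solved by T gives T_k(s+1) = T_k(s) T_k(1) and
    theta T_k(s) = T_{-k}(-s) theta, so U(s+1,k) = U(s,k) alpha(k) and
    U(-s,-k) = eps^t conj(U(s,k)) eps.  A global frame yields the null-homotopy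
    U(-s,k)^* U(s,k), with s running from 1/2 to 0.

    Conversely a null-homotopy A_t can be lifted to unitaries V_t, equal to the identity where
    A_t is, with eps A_t(k) = V_t(-k)^t eps V_t(k): over a short time step A_t changes to A_t X
    with X near 1 and X(-k)^t (eps A_t) = (eps A_t) X(k), a relation inherited by the square
    root of X, so V_t is multiplied by that square root.  At the end of the homotopy,
    s |-> V_{2s}(k)^* for s >= 0, and its time-reversed image for s <= 0, corrects the
    transported frame on [-1/2, 1/2] so that it glues periodically. *)
From Coquelicot Require Import Coquelicot.
From Stdlib Require Import Reals ZArith Lra Lia Setoid Morphisms.
From Stdlib Require Import FunctionalExtensionality ClassicalEpsilon ProofIrrelevance.
Require Import Defs.
Open Scope R_scope.

(** * Complex matrices *)

(** The square root is the fixed point of a contraction, unique within distance 1/2 of the identity.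
    Unitarity, periodicity and compatibility with [E] hold because the transformed root is again a
    root in that ball. The entrywise norm is not unitarily invariant, so increments are kept within
    the smaller radius [sqrad]. The number of steps of the lift must be the same for all k; this is
    where periodicity enters, through compactness of the unit cube.

    The transport is known only through its equation and initial value. Its generator is skew for
    the real inner product, so pairings of solutions are conserved; linearity, isometry and
    invariance of the ranges come from such conserved quantities, and continuity in k from an
    estimate of how fast a pairing of solutions of two nearby equations can drift. The real part of
    the inner product treats the antiunitary theta on the same footing as a unitary.

    The period cell is centred at 0 because reversal then maps it to itself and exchanges its two
    ends. *)

Lemma Cx_eq (a c : Cx) : cre a = cre c -> cim a = cim c -> a = c.
Proof. destruct a, c; simpl; intros -> ->; reflexivity. Qed.

Lemma Cx_ring : ring_theory C0 C1 Cadd Cmul Csub Copp eq.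
Proof. constructor; intros; apply Cx_eq; simpl; ring. Qed.
Add Ring CxRing : Cx_ring.

Lemma Cconj_add a c : Cconj (Cadd a c) = Cadd (Cconj a) (Cconj c).
Proof. apply Cx_eq; simpl; ring. Qed.
Lemma Cconj_mul a c : Cconj (Cmul a c) = Cmul (Cconj a) (Cconj c).
Proof. apply Cx_eq; simpl; ring. Qed.
Lemma Cconj_conj a : Cconj (Cconj a) = a.
Proof. apply Cx_eq; simpl; ring. Qed.

Lemma Csum_ext m f g : (forall i, (i < m)%nat -> f i = g i) -> Csum m f = Csum m g.
Proof. induction m; simpl; intros h; [reflexivity|]. rewrite IHm, h; auto. Qed.
Lemma Csum_add m f g : Csum m (fun i => Cadd (f i) (g i)) = Cadd (Csum m f) (Csum m g).
Proof. induction m; simpl; [ring|]. rewrite IHm. ring. Qed.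
Lemma Csum_mul_l m a f : Csum m (fun i => Cmul a (f i)) = Cmul a (Csum m f).
Proof. induction m; simpl; [ring|]. rewrite IHm. ring. Qed.
Lemma Csum_mul_r m a f : Csum m (fun i => Cmul (f i) a) = Cmul (Csum m f) a.
Proof. induction m; simpl; [ring|]. rewrite IHm. ring. Qed.
Lemma Csum_0 m : Csum m (fun _ => C0) = C0.
Proof. induction m; simpl; [reflexivity|]. rewrite IHm. ring. Qed.
Lemma Csum_swap m n f :
  Csum m (fun i => Csum n (fun j => f i j)) = Csum n (fun j => Csum m (fun i => f i j)).
Proof.
  induction m; simpl; [now rewrite Csum_0|]. rewrite IHm, <- Csum_add. reflexivity.
Qed.
Lemma Csum_conj m f : Cconj (Csum m f) = Csum m (fun i => Cconj (f i)).
Proof. induction m; simpl; [apply Cx_eq; simpl; ring|]. now rewrite Cconj_add, IHm. Qed.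
Lemma Csum_single m f i :
  (i < m)%nat -> (forall j, (j < m)%nat -> j <> i -> f j = C0) -> Csum m f = f i.
Proof.
  induction m; intros hi h; [lia|]. simpl.
  destruct (Nat.eq_dec i m) as [->|hne].
  - rewrite (Csum_ext m f (fun _ => C0)), Csum_0; [ring|]. intros j hj. apply h; lia.
  - rewrite IHm, (h m); [ring|lia|lia|lia|]. intros; apply h; lia.
Qed.

Definition meq (m : nat) (A B : Mat) : Prop :=
  forall i j, (i < m)%nat -> (j < m)%nat -> A i j = B i j.
Definition madd (A B : Mat) : Mat := fun i j => Cadd (A i j) (B i j).
Definition msub (A B : Mat) : Mat := fun i j => Csub (A i j) (B i j).
Definition mscal (a : Cx) (A : Mat) : Mat := fun i j => Cmul a (A i j).
Definition mconj (A : Mat) : Mat := fun i j => Cconj (A i j).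

#[export] Instance meq_equiv m : Equivalence (meq m).
Proof.
  split.
  - intros A i j _ _; reflexivity.
  - intros A B h i j hi hj; symmetry; auto.
  - intros A B C h1 h2 i j hi hj; rewrite h1; auto.
Qed.
#[export] Instance mmul_meq m : Proper (meq m ==> meq m ==> meq m) (mmul m).
Proof.
  intros A A' hA B B' hB i j hi hj. unfold mmul. apply Csum_ext; intros k hk.
  now rewrite hA, hB.
Qed.
#[export] Instance madd_meq m : Proper (meq m ==> meq m ==> meq m) madd.
Proof. intros A A' hA B B' hB i j hi hj. unfold madd. now rewrite hA, hB. Qed.
#[export] Instance msub_meq m : Proper (meq m ==> meq m ==> meq m) msub.
Proof. intros A A' hA B B' hB i j hi hj. unfold msub. now rewrite hA, hB. Qed.
#[export] Instance mscal_meq m a : Proper (meq m ==> meq m) (mscal a).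
Proof. intros A A' hA i j hi hj. unfold mscal. now rewrite hA. Qed.
#[export] Instance mconj_meq m : Proper (meq m ==> meq m) mconj.
Proof. intros A A' hA i j hi hj. unfold mconj. now rewrite hA. Qed.
#[export] Instance mtr_meq m : Proper (meq m ==> meq m) mtr.
Proof. intros A A' hA i j hi hj. unfold mtr. now rewrite hA. Qed.
#[export] Instance madj_meq m : Proper (meq m ==> meq m) madj.
Proof. intros A A' hA i j hi hj. unfold madj. now rewrite hA. Qed.

Lemma mmul_assoc m A B C : meq m (mmul m (mmul m A B) C) (mmul m A (mmul m B C)).
Proof.
  intros i j _ _. unfold mmul.
  rewrite (Csum_ext m _ (fun k => Csum m (fun l => Cmul (Cmul (A i l) (B l k)) (C k j))))
    by (intros; now rewrite Csum_mul_r).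
  rewrite Csum_swap. apply Csum_ext; intros l _.
  rewrite <- Csum_mul_l. apply Csum_ext; intros; ring.
Qed.
Lemma mmul_1_l m A : meq m (mmul m Imat A) A.
Proof.
  intros i j hi hj. unfold mmul, Imat. rewrite (Csum_single m _ i hi).
  - destruct (Nat.eq_dec i i); [ring|congruence].
  - intros k hk hne. destruct (Nat.eq_dec i k); [congruence|ring].
Qed.
Lemma mmul_1_r m A : meq m (mmul m A Imat) A.
Proof.
  intros i j hi hj. unfold mmul, Imat. rewrite (Csum_single m _ j hj).
  - destruct (Nat.eq_dec j j); [ring|congruence].
  - intros k hk hne. destruct (Nat.eq_dec k j); [congruence|ring].
Qed.
Lemma mmul_scal_l m a A B : meq m (mmul m (mscal a A) B) (mscal a (mmul m A B)).
Proof.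
  intros i j _ _. unfold mmul, mscal. rewrite <- Csum_mul_l. apply Csum_ext; intros; ring.
Qed.
Lemma mmul_scal_r m a A B : meq m (mmul m A (mscal a B)) (mscal a (mmul m A B)).
Proof.
  intros i j _ _. unfold mmul, mscal. rewrite <- Csum_mul_l. apply Csum_ext; intros; ring.
Qed.
Lemma mmul_add_l m A B C : meq m (mmul m (madd A B) C) (madd (mmul m A C) (mmul m B C)).
Proof.
  intros i j _ _. unfold mmul, madd. rewrite <- Csum_add. apply Csum_ext; intros; ring.
Qed.
Lemma mmul_add_r m A B C : meq m (mmul m C (madd A B)) (madd (mmul m C A) (mmul m C B)).
Proof.
  intros i j _ _. unfold mmul, madd. rewrite <- Csum_add. apply Csum_ext; intros; ring.
Qed.
Lemma msub_scal m A B : meq m (msub A B) (madd A (mscal (Copp C1) B)).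
Proof. intros i j _ _. unfold msub, madd, mscal. ring. Qed.
Lemma mmul_sub_l m A B C : meq m (mmul m (msub A B) C) (msub (mmul m A C) (mmul m B C)).
Proof. now rewrite !msub_scal, mmul_add_l, mmul_scal_l. Qed.
Lemma mmul_sub_r m A B C : meq m (mmul m C (msub A B)) (msub (mmul m C A) (mmul m C B)).
Proof. now rewrite !msub_scal, mmul_add_r, mmul_scal_r. Qed.

Lemma mtr_mul m A B : meq m (mtr (mmul m A B)) (mmul m (mtr B) (mtr A)).
Proof. intros i j _ _. unfold mtr, mmul. apply Csum_ext; intros; ring. Qed.
Lemma mconj_mul m A B : meq m (mconj (mmul m A B)) (mmul m (mconj A) (mconj B)).
Proof.
  intros i j _ _. unfold mconj, mmul. rewrite Csum_conj.
  apply Csum_ext; intros; apply Cconj_mul.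
Qed.
Lemma madj_mul m A B : meq m (madj (mmul m A B)) (mmul m (madj B) (madj A)).
Proof.
  intros i j _ _. unfold madj, mmul. rewrite Csum_conj.
  apply Csum_ext; intros; rewrite Cconj_mul; ring.
Qed.
Lemma mtr_1 m : meq m (mtr Imat) Imat.
Proof.
  intros i j _ _. unfold mtr, Imat.
  destruct (Nat.eq_dec i j), (Nat.eq_dec j i); congruence.
Qed.
Lemma mconj_1 m : meq m (mconj Imat) Imat.
Proof.
  intros i j _ _. unfold mconj, Imat.
  destruct (Nat.eq_dec i j); apply Cx_eq; simpl; ring.
Qed.
Lemma madj_1 m : meq m (madj Imat) Imat.
Proof. change (meq m (mconj (mtr Imat)) Imat). now rewrite mtr_1, mconj_1. Qed.
Lemma mtr_tr A : mtr (mtr A) = A.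
Proof. reflexivity. Qed.
Lemma madj_adj m A : meq m (madj (madj A)) A.
Proof. intros i j _ _. apply Cconj_conj. Qed.
Lemma mconj_tr A : mconj (mtr A) = madj A.
Proof. reflexivity. Qed.
Lemma mconj_adj m A : meq m (mconj (madj A)) (mtr A).
Proof. intros i j _ _. apply Cconj_conj. Qed.
Lemma mtr_adj m A : meq m (mtr (madj A)) (mconj A).
Proof. reflexivity. Qed.
Lemma madj_conj m A : meq m (madj (mconj A)) (mtr A).
Proof. intros i j _ _. apply Cconj_conj. Qed.

Lemma unitary_iff m A :
  is_unitary m A <-> meq m (mmul m (madj A) A) Imat /\ meq m (mmul m A (madj A)) Imat.
Proof.
  split; [intros h; split; intros i j hi hj; now apply h|].
  intros [h1 h2] i j hi hj; split; auto.
Qed.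
#[export] Instance unitary_meq m : Proper (meq m ==> iff) (is_unitary m).
Proof. intros A B h. now rewrite !unitary_iff, h. Qed.

Lemma mmul_cancel m A B C : meq m (mmul m A B) Imat -> meq m (mmul m A (mmul m B C)) C.
Proof. intros h. now rewrite <- mmul_assoc, h, mmul_1_l. Qed.

Lemma unitary_1 m : is_unitary m Imat.
Proof. apply unitary_iff. now rewrite madj_1, mmul_1_l. Qed.
Lemma unitary_adj m A : is_unitary m A -> is_unitary m (madj A).
Proof. rewrite !unitary_iff. intros [h1 h2]. now rewrite madj_adj. Qed.
Lemma unitary_mul m A B : is_unitary m A -> is_unitary m B -> is_unitary m (mmul m A B).
Proof.
  rewrite !unitary_iff. intros [h1 h2] [h3 h4].
  now rewrite madj_mul, !mmul_assoc, (mmul_cancel m (madj A) A), (mmul_cancel m B (madj B)).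
Qed.
Lemma unitary_conj m A : is_unitary m A -> is_unitary m (mconj A).
Proof.
  rewrite !unitary_iff. intros [h1 h2]. change (madj (mconj A)) with (mconj (madj A)).
  now rewrite <- !mconj_mul, h1, h2, mconj_1.
Qed.
Lemma unitary_tr m A : is_unitary m A -> is_unitary m (mtr A).
Proof. intros h. rewrite <- (madj_conj m A). now apply unitary_adj, unitary_conj. Qed.

(** * Square roots of unitary matrices near the identity *)

Fixpoint rsum (n : nat) (f : nat -> R) : R :=
  match n with O => 0 | S n' => rsum n' f + f n' end.

Lemma rsum_le m f g : (forall i, (i < m)%nat -> f i <= g i) -> rsum m f <= rsum m g.
Proof.
  induction m; simpl; intros h; [lra|]. apply Rplus_le_compat; [apply IHm|]; auto.
Qed.
Lemma rsum_ext m f g : (forall i, (i < m)%nat -> f i = g i) -> rsum m f = rsum m g.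
Proof. induction m; simpl; intros h; [reflexivity|]. rewrite IHm, h; auto. Qed.
Lemma rsum_add m f g : rsum m (fun i => f i + g i) = rsum m f + rsum m g.
Proof. induction m; simpl; [ring|]. rewrite IHm. ring. Qed.
Lemma rsum_mul_l m a f : rsum m (fun i => a * f i) = a * rsum m f.
Proof. induction m; simpl; [ring|]. rewrite IHm. ring. Qed.
Lemma rsum_const m a : rsum m (fun _ => a) = INR m * a.
Proof. induction m; [simpl; ring|]. rewrite S_INR. cbn [rsum]. rewrite IHm. ring. Qed.
Lemma rsum_ge0 m f : (forall i, (i < m)%nat -> 0 <= f i) -> 0 <= rsum m f.
Proof.
  intros h. replace 0 with (rsum m (fun _ => 0)) by (rewrite rsum_const; ring).
  now apply rsum_le.
Qed.
Lemma rsum_swap m n f :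
  rsum m (fun i => rsum n (fun j => f i j)) = rsum n (fun j => rsum m (fun i => f i j)).
Proof.
  induction m; simpl; [rewrite rsum_const; ring|]. now rewrite IHm, <- rsum_add.
Qed.
Lemma rsum_term m f i : (forall j, (j < m)%nat -> 0 <= f j) -> (i < m)%nat -> f i <= rsum m f.
Proof.
  induction m; intros h hi; [lia|]. simpl.
  assert (0 <= rsum m f) by (apply rsum_ge0; auto).
  destruct (Nat.eq_dec i m) as [->|]; [lra|].
  assert (f i <= rsum m f) by (apply IHm; [auto|lia]).
  assert (0 <= f m) by auto. lra.
Qed.

(* The l1 absolute value is submultiplicative and avoids square roots. *)
Definition cabs (z : Cx) : R := Rabs (cre z) + Rabs (cim z).

Lemma cabs_ge0 z : 0 <= cabs z.
Proof. unfold cabs. pose proof (Rabs_pos (cre z)); pose proof (Rabs_pos (cim z)); lra. Qed.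
Lemma cabs_add y z : cabs (Cadd y z) <= cabs y + cabs z.
Proof.
  unfold cabs; simpl. pose proof (Rabs_triang (cre y) (cre z)).
  pose proof (Rabs_triang (cim y) (cim z)). lra.
Qed.
Lemma cabs_mul y z : cabs (Cmul y z) <= cabs y * cabs z.
Proof.
  unfold cabs; simpl.
  pose proof (Rabs_triang (cre y * cre z) (- (cim y * cim z))).
  pose proof (Rabs_triang (cre y * cim z) (cim y * cre z)).
  rewrite Rabs_Ropp in H. rewrite !Rabs_mult in *. unfold Rminus. lra.
Qed.
Lemma cabs_opp z : cabs (Copp z) = cabs z.
Proof. unfold cabs; simpl. now rewrite !Rabs_Ropp. Qed.
Lemma cabs_conj z : cabs (Cconj z) = cabs z.
Proof. unfold cabs; simpl. now rewrite !Rabs_Ropp. Qed.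
Lemma cabs_0 : cabs C0 = 0.
Proof. unfold cabs; simpl. rewrite Rabs_R0. ring. Qed.
Lemma cabs_eq0 z : cabs z <= 0 -> z = C0.
Proof.
  unfold cabs. intros h. pose proof (Rabs_pos (cre z)); pose proof (Rabs_pos (cim z)).
  apply Cx_eq; simpl; apply Rabs_eq_0; lra.
Qed.
Lemma cabs_sum m f : cabs (Csum m f) <= rsum m (fun i => cabs (f i)).
Proof.
  induction m; simpl; [rewrite cabs_0; lra|].
  eapply Rle_trans; [apply cabs_add|]. lra.
Qed.

Definition mnorm (m : nat) (A : Mat) : R := rsum m (fun i => rsum m (fun j => cabs (A i j))).

#[export] Instance mnorm_meq m : Proper (meq m ==> eq) (mnorm m).
Proof.
  intros A B h. unfold mnorm. apply rsum_ext; intros i hi. apply rsum_ext; intros j hj.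
  now rewrite h.
Qed.
Lemma mnorm_ge0 m A : 0 <= mnorm m A.
Proof. apply rsum_ge0; intros; apply rsum_ge0; intros; apply cabs_ge0. Qed.
Lemma mnorm_entry m A i j : (i < m)%nat -> (j < m)%nat -> cabs (A i j) <= mnorm m A.
Proof.
  intros hi hj. eapply Rle_trans.
  - apply (rsum_term m (fun j => cabs (A i j)) j); auto. intros; apply cabs_ge0.
  - apply (rsum_term m (fun i => rsum m (fun j => cabs (A i j))) i); auto.
    intros; apply rsum_ge0; intros; apply cabs_ge0.
Qed.
Lemma mnorm_le_entries m A e :
  (forall i j, (i < m)%nat -> (j < m)%nat -> cabs (A i j) <= e) ->
  mnorm m A <= INR m * (INR m * e).
Proof.
  intros h. unfold mnorm. rewrite <- (rsum_const m (INR m * e)). apply rsum_le; intros i hi.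
  rewrite <- rsum_const. apply rsum_le; auto.
Qed.
Lemma mnorm_eq0 m A B : mnorm m (msub A B) <= 0 -> meq m A B.
Proof.
  intros h i j hi hj. pose proof (mnorm_entry m (msub A B) i j hi hj) as h1.
  assert (h2 : Csub (A i j) (B i j) = C0) by (apply cabs_eq0; eapply Rle_trans; [exact h1|exact h]).
  replace (A i j) with (Cadd (Csub (A i j) (B i j)) (B i j)) by ring. rewrite h2. ring.
Qed.
Lemma mnorm_add m A B : mnorm m (madd A B) <= mnorm m A + mnorm m B.
Proof.
  unfold mnorm. rewrite <- rsum_add. apply rsum_le; intros i _.
  rewrite <- rsum_add. apply rsum_le; intros j _. apply cabs_add.
Qed.
Lemma mnorm_scal m a A : mnorm m (mscal a A) <= cabs a * mnorm m A.
Proof.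
  unfold mnorm. rewrite <- rsum_mul_l. apply rsum_le; intros i _.
  rewrite <- rsum_mul_l. apply rsum_le; intros j _. apply cabs_mul.
Qed.
Lemma mnorm_sub m A B : mnorm m (msub A B) <= mnorm m A + mnorm m B.
Proof.
  rewrite msub_scal. eapply Rle_trans; [apply mnorm_add|].
  pose proof (mnorm_scal m (Copp C1) B) as h.
  replace (cabs (Copp C1)) with 1 in h
    by (rewrite cabs_opp; unfold cabs; simpl; rewrite Rabs_R0, Rabs_R1; ring).
  lra.
Qed.
Lemma mnorm_tr m A : mnorm m (mtr A) = mnorm m A.
Proof. unfold mnorm. now rewrite rsum_swap. Qed.
Lemma mnorm_adj m A : mnorm m (madj A) = mnorm m A.
Proof.
  rewrite <- mnorm_tr. unfold mnorm. apply rsum_ext; intros; apply rsum_ext; intros.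
  apply cabs_conj.
Qed.
Lemma mnorm_sub_sym m A B : mnorm m (msub A B) = mnorm m (msub B A).
Proof.
  unfold mnorm. apply rsum_ext; intros; apply rsum_ext; intros. unfold msub.
  rewrite <- cabs_opp. f_equal. ring.
Qed.
Lemma mnorm_mul m A B : mnorm m (mmul m A B) <= mnorm m A * mnorm m B.
Proof.
  apply Rle_trans with
    (rsum m (fun i => rsum m (fun j => rsum m (fun k => cabs (A i k) * cabs (B k j))))).
  { apply rsum_le; intros i _; apply rsum_le; intros j _. unfold mmul.
    eapply Rle_trans; [apply cabs_sum|]. apply rsum_le; intros; apply cabs_mul. }
  unfold mnorm at 1. rewrite Rmult_comm, <- rsum_mul_l. apply rsum_le; intros i _.
  rewrite rsum_swap, <- rsum_mul_l. apply rsum_le; intros k hk.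
  rewrite rsum_mul_l, Rmult_comm. apply Rmult_le_compat_r; [apply cabs_ge0|].
  apply (rsum_term m (fun k => rsum m (fun j => cabs (B k j))) k); auto.
  intros; apply rsum_ge0; intros; apply cabs_ge0.
Qed.
Lemma mnorm_tri m A B C : mnorm m (msub A C) <= mnorm m (msub A B) + mnorm m (msub B C).
Proof.
  eapply Rle_trans; [|apply mnorm_add]. right. apply mnorm_meq. intros i j _ _.
  unfold madd, msub. ring.
Qed.

(** Real and imaginary parts of an entry of a unitary lie in [-1, 1], so each of the m^2 entries
    contributes at most 2 to [mnorm]. *)
Definition ubound (m : nat) : R := INR m * (INR m * 2).
Lemma ubound_ge0 m : 0 <= ubound m.
Proof. unfold ubound. pose proof (pos_INR m). nra. Qed.

Lemma Csum_cre m f : cre (Csum m f) = rsum m (fun i => cre (f i)).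
Proof. induction m; simpl; [reflexivity|]. now rewrite IHm. Qed.

Lemma unitary_norm m U : is_unitary m U -> mnorm m U <= ubound m.
Proof.
  intros h. apply mnorm_le_entries. intros i j hi hj.
  destruct (h j j hj hj) as [h1 _]. apply (f_equal cre) in h1.
  unfold mmul in h1. rewrite Csum_cre in h1. unfold madj, Imat in h1.
  destruct (Nat.eq_dec j j) as [_|]; [|congruence]. simpl in h1.
  (* Diagonal entry j of U* U = 1 says that column j has squared length 1; the double minus is the
     conjugation left unsimplified. *)
  assert (h2 : cre (U i j) * cre (U i j) - - cim (U i j) * cim (U i j) <= 1).
  { rewrite <- h1. apply (rsum_term m (fun k => cre (U k j) * cre (U k j) - - cim (U k j) * cim (U k j)) i); auto.
    intros; nra. }
  unfold cabs. assert (Rabs (cre (U i j)) <= 1) by (apply Rabs_le; nra).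
  assert (Rabs (cim (U i j)) <= 1) by (apply Rabs_le; nra). lra.
Qed.

(* With X = 1 - Z and W = 1 - Y, the equation W^2 = X reads Y = (Z + Y^2)/2, a contraction. *)
Definition sqstep (m : nat) (Z Y : Mat) : Mat := mscal (RtoC (/ 2)) (madd Z (mmul m Y Y)).

#[export] Instance sqstep_meq m : Proper (meq m ==> meq m ==> meq m) (sqstep m).
Proof. intros Z Z' hZ Y Y' hY. unfold sqstep. now rewrite hZ, hY. Qed.

Lemma cabs_half : cabs (RtoC (/ 2)) = / 2.
Proof. unfold cabs; simpl. rewrite Rabs_R0, Rabs_pos_eq; lra. Qed.

(** Without commutation, Y^2 - Y'^2 = Y (Y - Y') + (Y - Y') Y'. On the ball of radius 1/2 this makes
    the step a contraction of ratio 1/2; letting Z vary as well also controls how the fixed point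
    depends on Z. *)
Lemma sqstep_lip m Z Y Z' Y' :
  mnorm m (msub (sqstep m Z Y) (sqstep m Z' Y')) <=
  / 2 * (mnorm m (msub Z Z') + (mnorm m Y + mnorm m Y') * mnorm m (msub Y Y')).
Proof.
  assert (h : meq m (msub (sqstep m Z Y) (sqstep m Z' Y'))
    (mscal (RtoC (/ 2)) (madd (msub Z Z')
       (madd (mmul m Y (msub Y Y')) (mmul m (msub Y Y') Y'))))).
  { rewrite mmul_sub_l, mmul_sub_r. intros i j _ _. unfold sqstep, mscal, madd, msub. ring. }
  rewrite h. eapply Rle_trans; [apply mnorm_scal|]. rewrite cabs_half.
  apply Rmult_le_compat_l; [lra|]. eapply Rle_trans; [apply mnorm_add|].
  apply Rplus_le_compat_l. eapply Rle_trans; [apply mnorm_add|].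
  pose proof (mnorm_mul m Y (msub Y Y')). pose proof (mnorm_mul m (msub Y Y') Y'). lra.
Qed.

(** (r + r^2)/2 <= r. The radius r is left free so that the fixed point is bounded by the norm of Z
    and not merely by 1/2. *)
Lemma sqstep_norm m Z Y r :
  r <= / 2 -> mnorm m Z <= r -> mnorm m Y <= r -> mnorm m (sqstep m Z Y) <= r.
Proof.
  intros hr hZ hY. unfold sqstep. eapply Rle_trans; [apply mnorm_scal|]. rewrite cabs_half.
  pose proof (mnorm_add m Z (mmul m Y Y)). pose proof (mnorm_mul m Y Y).
  pose proof (mnorm_ge0 m Y). nra.
Qed.

(** Half of the distance of Y and Y' is absorbed on the left. The estimate yields uniqueness (Z =
    Z') and Lipschitz dependence at once. *)
Lemma sqfix_lip m Z Y Z' Y' :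
  mnorm m Y <= / 2 -> mnorm m Y' <= / 2 ->
  meq m (sqstep m Z Y) Y -> meq m (sqstep m Z' Y') Y' ->
  mnorm m (msub Y Y') <= mnorm m (msub Z Z').
Proof.
  intros h1 h2 e1 e2. pose proof (sqstep_lip m Z Y Z' Y') as h. rewrite e1, e2 in h.
  pose proof (mnorm_ge0 m (msub Y Y')). nra.
Qed.

Fixpoint sqiter (m : nat) (Z : Mat) (n : nat) : Mat :=
  match n with O => fun _ _ => C0 | S n' => sqstep m Z (sqiter m Z n') end.

Lemma mnorm_0 m : mnorm m (fun _ _ => C0) = 0.
Proof.
  apply Rle_antisym; [|apply mnorm_ge0].
  eapply Rle_trans; [apply (mnorm_le_entries m _ 0)|nra].
  intros; rewrite cabs_0; lra.
Qed.

Lemma sqiter_norm m Z n r :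
  r <= / 2 -> mnorm m Z <= r -> mnorm m (sqiter m Z n) <= r.
Proof.
  intros hr hZ. induction n; simpl.
  - rewrite mnorm_0. pose proof (mnorm_ge0 m Z). lra.
  - now apply sqstep_norm.
Qed.

Lemma sqiter_cauchy m Z n p :
  mnorm m Z <= / 2 -> mnorm m (msub (sqiter m Z (n + p)) (sqiter m Z n)) <= (/ 2) ^ n.
Proof.
  intros hZ. induction n; simpl.
  - eapply Rle_trans; [apply mnorm_sub|]. rewrite mnorm_0.
    pose proof (sqiter_norm m Z p (/2) (Rle_refl _) hZ). lra.
  - pose proof (sqstep_lip m Z (sqiter m Z (n + p)) Z (sqiter m Z n)) as h.
    assert (e : mnorm m (msub Z Z) = 0).
    { rewrite <- (mnorm_0 m). apply mnorm_meq. intros i j _ _. unfold msub. ring. }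
    rewrite e in h.
    pose proof (sqiter_norm m Z (n + p) (/2) (Rle_refl _) hZ).
    pose proof (sqiter_norm m Z n (/2) (Rle_refl _) hZ).
    pose proof (mnorm_ge0 m (msub (sqiter m Z (n + p)) (sqiter m Z n))). nra.
Qed.

(** Keeping the geometric rate in the limit allows limits taken entry by entry to be reassembled
    into one [mnorm] estimate. *)
Lemma cauchy_geom_limit (u : nat -> R) :
  (forall n p, Rabs (u (n + p)%nat - u n) <= (/ 2) ^ n) ->
  exists l, forall n, Rabs (u n - l) <= (/ 2) ^ n.
Proof.
  intros h.
  assert (hc : Cauchy_crit u).
  { intros eps he.
    destruct (pow_lt_1_zero (/ 2) ltac:(rewrite Rabs_pos_eq; lra) (eps / 2) ltac:(lra)) as [N hN].
    exists N. intros n p hn hp. unfold Rdist.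
    pose proof (h N (n - N)%nat) as h1. pose proof (h N (p - N)%nat) as h2.
    replace (N + (n - N))%nat with n in h1 by lia. replace (N + (p - N))%nat with p in h2 by lia.
    specialize (hN N (Nat.le_refl _)). rewrite Rabs_pos_eq in hN by (apply pow_le; lra).
    replace (u n - u p) with ((u n - u N) - (u p - u N)) by ring.
    eapply Rle_lt_trans; [apply Rabs_triang|]. rewrite Rabs_Ropp. lra. }
  destruct (R_complete u hc) as [l hl]. exists l. intros n.
  apply Rnot_lt_le. intros hlt.
  destruct (hl (Rabs (u n - l) - (/ 2) ^ n) ltac:(lra)) as [N hN].
  specialize (hN (n + N)%nat ltac:(lia)). unfold Rdist in hN. specialize (h n N).
  replace (u n - l) with ((u (n + N)%nat - l) - (u (n + N)%nat - u n)) in hN by ring.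
  pose proof (Rabs_triang (u (n + N)%nat - l) (- (u (n + N)%nat - u n))) as ht.
  rewrite Rabs_Ropp in ht. unfold Rminus in *. lra.
Qed.

Lemma geom_le0 x K : (forall n, x <= K * (/ 2) ^ n) -> x <= 0.
Proof.
  intros h. apply Rnot_lt_le. intros hx.
  assert (0 < K) by (specialize (h O); simpl in h; lra).
  destruct (pow_lt_1_zero (/ 2) ltac:(rewrite Rabs_pos_eq; lra) (x / K)
    ltac:(now apply Rdiv_lt_0_compat)) as [N hN].
  specialize (hN N (Nat.le_refl _)). rewrite Rabs_pos_eq in hN by (apply pow_le; lra).
  specialize (h N). apply (Rmult_lt_compat_l K) in hN; auto.
  replace (K * (x / K)) with x in hN by (field; lra). lra.
Qed.

Lemma sqfix_exists m Z :
  mnorm m Z <= / 2 -> exists Y, meq m (sqstep m Z Y) Y /\ mnorm m Y <= mnorm m Z.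
Proof.
  intros hZ.
  (* The range conditions sit under the existential so that a limit can be chosen for every pair of
     indices; outside the range it is an arbitrary [C0]. *)
  assert (hl : forall i j, exists l, (i < m)%nat -> (j < m)%nat ->
     forall n, cabs (Csub (sqiter m Z n i j) l) <= 2 * (/ 2) ^ n).
  { intros i j. destruct (Compare_dec.lt_dec i m) as [hi|]; [|exists C0; intros; lia].
    destruct (Compare_dec.lt_dec j m) as [hj|]; [|exists C0; intros; lia].
    assert (hb : forall n p, cabs (Csub (sqiter m Z (n + p) i j) (sqiter m Z n i j)) <= (/ 2) ^ n).
    { intros n p. eapply Rle_trans; [|apply (sqiter_cauchy m Z n p hZ)].
      now apply (mnorm_entry m (msub _ _)). }
    destruct (cauchy_geom_limit (fun n => cre (sqiter m Z n i j))) as [l1 h1].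
    { intros n p. eapply Rle_trans; [|apply (hb n p)]. unfold cabs; simpl.
      match goal with |- _ <= _ + Rabs ?x => pose proof (Rabs_pos x) end. unfold Rminus. lra. }
    destruct (cauchy_geom_limit (fun n => cim (sqiter m Z n i j))) as [l2 h2].
    { intros n p. eapply Rle_trans; [|apply (hb n p)]. unfold cabs; simpl.
      match goal with |- _ <= Rabs ?x + _ => pose proof (Rabs_pos x) end. unfold Rminus. lra. }
    exists (mkCx l1 l2). intros _ _ n. specialize (h1 n). specialize (h2 n).
    unfold cabs; simpl. unfold Rminus in *. lra. }
  set (Y := fun i j => proj1_sig (constructive_indefinite_description _ (hl i j))).
  set (K := INR m * (INR m * 2)).
  assert (hY : forall n, mnorm m (msub (sqiter m Z n) Y) <= K * (/ 2) ^ n).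
  { intros n. unfold K. replace (INR m * (INR m * 2) * (/ 2) ^ n)
      with (INR m * (INR m * (2 * (/ 2) ^ n))) by ring.
    apply mnorm_le_entries. intros i j hi hj. unfold msub, Y.
    destruct (constructive_indefinite_description _ (hl i j)) as [l h]. simpl. now apply h. }
  assert (hn : mnorm m Y <= mnorm m Z).
  { cut (mnorm m Y - mnorm m Z <= 0); [lra|]. apply (geom_le0 _ K). intros n.
    pose proof (sqiter_norm m Z n (mnorm m Z) hZ (Rle_refl _)).
    assert (mnorm m Y <= mnorm m (sqiter m Z n) + mnorm m (msub (sqiter m Z n) Y)).
    { eapply Rle_trans; [|apply mnorm_sub]. right. apply mnorm_meq. intros i j _ _.
      unfold msub. ring. }
    specialize (hY n). lra. }
  (* The defect of Y is compared with the iterates: both |F(Y) - F(Y_n)| and |Y_(n+1) - Y| are of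
     order 2^(-n). *)
  exists Y. split; auto. apply mnorm_eq0. apply (geom_le0 _ (2 * K)). intros n.
  pose proof (mnorm_tri m (sqstep m Z Y) (sqiter m Z (S n)) Y) as h.
  pose proof (hY (S n)) as h1. pose proof (hY n) as h2. simpl in h, h1.
  pose proof (sqstep_lip m Z Y Z (sqiter m Z n)) as h3.
  pose proof (sqiter_norm m Z n (/2) (Rle_refl _) hZ).
  assert (e : mnorm m (msub Z Z) = 0).
  { rewrite <- (mnorm_0 m). apply mnorm_meq. intros i j _ _. unfold msub. ring. }
  rewrite e in h3. rewrite (mnorm_sub_sym m Y) in h3.
  pose proof (mnorm_ge0 m (msub (sqiter m Z n) Y)). nra.
Qed.

Lemma madj_sub m A B : meq m (madj (msub A B)) (msub (madj A) (madj B)).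
Proof. intros i j _ _. unfold madj, msub. apply Cx_eq; simpl; ring. Qed.

Lemma msub_involutive m A B : meq m (msub A (msub A B)) B.
Proof. intros i j _ _. unfold msub. ring. Qed.

Lemma sqfix_iff m X W :
  meq m (mmul m W W) X <-> meq m (sqstep m (msub Imat X) (msub Imat W)) (msub Imat W).
Proof.
  (* The defect of the fixed-point equation at 1 - W is exactly half of W^2 - X. *)
  assert (e : meq m (sqstep m (msub Imat X) (msub Imat W))
    (madd (msub Imat W) (mscal (RtoC (/ 2)) (msub (mmul m W W) X)))).
  { unfold sqstep. rewrite mmul_sub_l, !mmul_sub_r, !mmul_1_l, mmul_1_r.
    intros i j _ _. unfold msub, mscal, madd. apply Cx_eq; simpl; field. }
  rewrite e. split.
  - intros h. rewrite h. intros i j _ _. unfold msub, mscal, madd. ring.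
  - intros h i j hi hj. specialize (h i j hi hj). unfold msub, mscal, madd in h.
    assert (h1 := f_equal cre h). assert (h2 := f_equal cim h). simpl in h1, h2.
    apply Cx_eq; lra.
Qed.

Lemma msqrt_exists m X :
  mnorm m (msub Imat X) <= / 2 ->
  exists W, meq m (mmul m W W) X /\ mnorm m (msub Imat W) <= mnorm m (msub Imat X).
Proof.
  intros h. destruct (sqfix_exists m _ h) as [Y [h1 h2]].
  exists (msub Imat Y). rewrite sqfix_iff, msub_involutive. auto.
Qed.

(** A chosen root, meaningful only when X is within 1/2 of the identity; there it is determined up
    to [meq]. *)
Definition msqrt (m : nat) (X : Mat) : Mat :=
  epsilon (inhabits X) (fun W =>
    meq m (mmul m W W) X /\ mnorm m (msub Imat W) <= mnorm m (msub Imat X)).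

Lemma msqrt_spec m X :
  mnorm m (msub Imat X) <= / 2 ->
  meq m (mmul m (msqrt m X) (msqrt m X)) X /\
  mnorm m (msub Imat (msqrt m X)) <= mnorm m (msub Imat X).
Proof. intros h. unfold msqrt. apply epsilon_spec. now apply msqrt_exists. Qed.

(** Squaring does not shrink distances on the ball of radius 1/2 about the identity: this is
    [sqfix_lip] in the variables 1 - W and 1 - W^2. *)
Lemma msqrt_lip m W W' :
  mnorm m (msub Imat W) <= / 2 -> mnorm m (msub Imat W') <= / 2 ->
  mnorm m (msub W W') <= mnorm m (msub (mmul m W W) (mmul m W' W')).
Proof.
  intros h h'.
  assert (e : forall A B, mnorm m (msub (msub Imat A) (msub Imat B)) = mnorm m (msub A B)).
  { intros A B. rewrite (mnorm_sub_sym m A). apply mnorm_meq. intros i j _ _. unfold msub. ring. }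
  rewrite <- (e W), <- (e (mmul m W W)).
  apply sqfix_lip; auto; now apply sqfix_iff.
Qed.

Lemma msqrt_unique m X W :
  mnorm m (msub Imat X) <= / 2 -> mnorm m (msub Imat W) <= / 2 ->
  meq m (mmul m W W) X -> meq m (msqrt m X) W.
Proof.
  intros hX hW e. destruct (msqrt_spec m X hX) as [h1 h2].
  apply mnorm_eq0. eapply Rle_trans; [apply msqrt_lip; lra|].
  rewrite h1, e. rewrite <- (mnorm_0 m). right. apply mnorm_meq. intros i j _ _.
  unfold msub. ring.
Qed.

(** Multiplication by a unitary on each side can enlarge [mnorm] by [ubound m] each time. This
    radius ensures that the competing roots built below stay within 1/2 of the identity, where
    [msqrt_unique] applies. *)
Definition sqrad (m : nat) : R := / (2 * (ubound m + 1) ^ 2).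

Lemma sqrad_pos m : 0 < sqrad m.
Proof.
  pose proof (ubound_ge0 m). apply Rinv_0_lt_compat. nra.
Qed.
Lemma sqrad_half m x : x <= sqrad m -> (ubound m + 1) ^ 2 * x <= / 2.
Proof.
  intros h. pose proof (ubound_ge0 m).
  apply Rle_trans with ((ubound m + 1) ^ 2 * sqrad m); [apply Rmult_le_compat_l; nra|].
  unfold sqrad. right. field. nra.
Qed.
Lemma sqrad_small m x : 0 <= x -> x <= sqrad m -> x <= / 2.
Proof. intros h0 h. pose proof (sqrad_half m x h). pose proof (ubound_ge0 m). nra. Qed.

(* X W* is again a square root of X near 1, so X W* = W. *)
Lemma msqrt_unitary m X :
  is_unitary m X -> mnorm m (msub Imat X) <= sqrad m -> is_unitary m (msqrt m X).
Proof.
  intros hu hX. pose proof (mnorm_ge0 m (msub Imat X)) as h0.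
  pose proof (sqrad_small m _ h0 hX) as hX2.
  destruct (msqrt_spec m X hX2) as [hW hWn]. set (W := msqrt m X) in *.
  pose proof (unitary_norm m X hu) as hXn. apply unitary_iff in hu. destruct hu as [u1 u2].
  assert (hW' : meq m (mmul m (madj W) (madj W)) (madj X)) by now rewrite <- madj_mul, hW.
  (* [madj W] commutes with its own square [madj X], hence with the inverse X of that square. *)
  assert (c : meq m (mmul m X (madj W)) (mmul m (madj W) X)).
  { assert (c1 : meq m (mmul m (madj W) (madj X)) (mmul m (madj X) (madj W)))
      by now rewrite <- hW', mmul_assoc.
    rewrite <- (mmul_1_r m (mmul m X (madj W))), <- u1, <- !mmul_assoc.
    rewrite (mmul_assoc m X), c1, <- mmul_assoc, u2, mmul_1_l. reflexivity. }
  assert (e : meq m W (mmul m X (madj W))).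
  { apply (msqrt_unique m X); auto.
    - assert (e : meq m (msub Imat (mmul m X (madj W)))
        (madd (msub Imat X) (mmul m X (msub Imat (madj W))))).
      { rewrite mmul_sub_r, mmul_1_r. intros i j _ _. unfold msub, madd. ring. }
      rewrite e. eapply Rle_trans; [apply mnorm_add|].
      assert (hn : mnorm m (msub Imat (madj W)) = mnorm m (msub Imat W)).
      { rewrite <- (mnorm_adj m (msub Imat W)), madj_sub, madj_1. reflexivity. }
      pose proof (mnorm_mul m X (msub Imat (madj W))) as h1. rewrite hn in h1.
      pose proof (sqrad_half m _ hX). pose proof (mnorm_ge0 m X).
      pose proof (mnorm_ge0 m (msub Imat W)). pose proof (ubound_ge0 m).
      assert (mnorm m X * mnorm m (msub Imat W) <= ubound m * mnorm m (msub Imat X)) by nra.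
      nra.
    - rewrite mmul_assoc, <- (mmul_assoc m (madj W) X), <- c, !mmul_assoc, hW', u2, mmul_1_r.
      reflexivity. }
  assert (e' : meq m (madj W) (mmul m (madj X) W)).
  { rewrite e at 2. now rewrite mmul_cancel. }
  apply unitary_iff. split.
  - rewrite e'. now rewrite mmul_assoc, hW.
  - rewrite e at 1. now rewrite mmul_assoc, hW'.
Qed.

(** With W the root of X', the matrix B* W^t B squares to B* X'^t B = X and is close to 1, so by
    uniqueness it is the root of X. *)
Lemma msqrt_intertwine m X X' B :
  is_unitary m B -> mnorm m (msub Imat X) <= sqrad m -> mnorm m (msub Imat X') <= sqrad m ->
  meq m (mmul m (mtr X') B) (mmul m B X) ->
  meq m (mmul m (mtr (msqrt m X')) B) (mmul m B (msqrt m X)).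
Proof.
  intros hB hX hX' e. pose proof (unitary_norm m B hB) as nB.
  pose proof (unitary_norm m _ (unitary_adj m B hB)) as nB'.
  apply unitary_iff in hB. destruct hB as [b1 b2].
  pose proof (sqrad_small m _ (mnorm_ge0 m _) hX) as hX2.
  pose proof (sqrad_small m _ (mnorm_ge0 m _) hX') as hX2'.
  destruct (msqrt_spec m X' hX2') as [hW hWn]. set (W := msqrt m X') in *.
  rewrite (msqrt_unique m X (mmul m (madj B) (mmul m (mtr W) B))); auto.
  - now rewrite <- (mmul_assoc m B (madj B)), b2, mmul_1_l.
  - assert (e1 : meq m (msub Imat (mmul m (madj B) (mmul m (mtr W) B)))
        (mmul m (madj B) (mmul m (mtr (msub Imat W)) B))).
    { change (mtr (msub Imat W)) with (msub (mtr Imat) (mtr W)).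
      now rewrite mtr_1, mmul_sub_l, mmul_sub_r, mmul_1_l, b1. }
    rewrite e1. eapply Rle_trans; [apply mnorm_mul|].
    pose proof (mnorm_mul m (mtr (msub Imat W)) B) as h. rewrite mnorm_tr in h.
    pose proof (sqrad_half m _ hX'). pose proof (ubound_ge0 m).
    pose proof (mnorm_ge0 m B). pose proof (mnorm_ge0 m (madj B)).
    pose proof (mnorm_ge0 m (msub Imat W)).
    assert (mnorm m (mmul m (mtr (msub Imat W)) B) <= ubound m * mnorm m (msub Imat X')) by nra.
    pose proof (mnorm_ge0 m (mmul m (mtr (msub Imat W)) B)).
    assert (mnorm m (madj B) * mnorm m (mmul m (mtr (msub Imat W)) B)
      <= ubound m * (ubound m * mnorm m (msub Imat X'))) by (apply Rmult_le_compat; auto).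
    pose proof (mnorm_ge0 m (msub Imat X')). nra.
  - rewrite !mmul_assoc, (mmul_cancel m B (madj B)), <- (mmul_assoc m (mtr W)), <- mtr_mul, hW, e by auto.
    now apply mmul_cancel.
Qed.

(** * Continuity and compactness *)

Section Continuity.
Context {U : UniformSpace}.

Definition ccont (f : U -> Cx) (p : U) : Prop :=
  continuous (fun q => cre (f q)) p /\ continuous (fun q => cim (f q)) p.
Definition mcont (m : nat) (F : U -> Mat) (p : U) : Prop :=
  forall i j, (i < m)%nat -> (j < m)%nat -> ccont (fun q => F q i j) p.

Lemma continuous_R_iff (f : U -> R) p :
  continuous f p <-> forall eps, 0 < eps -> locally p (fun q => Rabs (f q - f p) < eps).
Proof.
  split.
  - intros h eps he. exact (proj1 (filterlim_locally _ _) h (mkposreal eps he)).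
  - intros h. apply filterlim_locally. intros [eps he]. exact (h eps he).
Qed.

Lemma ccont_iff (f : U -> Cx) p :
  ccont f p <-> forall eps, 0 < eps -> locally p (fun q => cabs (Csub (f q) (f p)) < eps).
Proof.
  unfold ccont. rewrite !continuous_R_iff. split.
  - intros [h1 h2] eps he. specialize (h1 (eps / 2) ltac:(lra)). specialize (h2 (eps / 2) ltac:(lra)).
    generalize (filter_and _ _ h1 h2). apply filter_imp. intros q [e1 e2].
    unfold cabs; simpl. unfold Rminus in *. lra.
  - intros h. split; intros eps he; generalize (h eps he); apply filter_imp;
      intros q e; unfold cabs in e; simpl in e;
      pose proof (Rabs_pos (cre (f q) + - cre (f p)));
      pose proof (Rabs_pos (cim (f q) + - cim (f p))); unfold Rminus; lra.
Qed.

Lemma ccont_const c p : ccont (fun _ => c) p.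
Proof. split; apply continuous_const. Qed.
Lemma ccont_add f g p : ccont f p -> ccont g p -> ccont (fun q => Cadd (f q) (g q)) p.
Proof. intros [h1 h2] [h3 h4]. split; simpl; now apply @continuous_plus. Qed.
Lemma ccont_conj f p : ccont f p -> ccont (fun q => Cconj (f q)) p.
Proof. intros [h1 h2]. split; simpl; auto. now apply @continuous_opp. Qed.
Lemma ccont_mul f g p : ccont f p -> ccont g p -> ccont (fun q => Cmul (f q) (g q)) p.
Proof.
  intros [h1 h2] [h3 h4]. split; simpl.
  - apply @continuous_minus; now apply @continuous_mult.
  - apply @continuous_plus; now apply @continuous_mult.
Qed.
Lemma ccont_sum m (f : nat -> U -> Cx) p :
  (forall i, (i < m)%nat -> ccont (f i) p) -> ccont (fun q => Csum m (fun i => f i q)) p.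
Proof.
  induction m; intros h; simpl; [apply ccont_const|].
  apply ccont_add; [apply IHm|]; auto.
Qed.

Lemma mcont_const m A p : mcont m (fun _ => A) p.
Proof. intros i j _ _. apply ccont_const. Qed.
Lemma mcont_mul m F G p : mcont m F p -> mcont m G p -> mcont m (fun q => mmul m (F q) (G q)) p.
Proof.
  intros hF hG i j hi hj. unfold mmul.
  apply (ccont_sum m (fun k q => Cmul (F q i k) (G q k j))). intros k hk.
  apply ccont_mul; [now apply hF|now apply hG].
Qed.
Lemma mcont_tr m F p : mcont m F p -> mcont m (fun q => mtr (F q)) p.
Proof. intros h i j hi hj. now apply h. Qed.
Lemma mcont_adj m F p : mcont m F p -> mcont m (fun q => madj (F q)) p.
Proof. intros h i j hi hj. apply ccont_conj. now apply h. Qed.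
Lemma mcont_sub m F G p : mcont m F p -> mcont m G p -> mcont m (fun q => msub (F q) (G q)) p.
Proof.
  intros hF hG i j hi hj. specialize (hF i j hi hj). specialize (hG i j hi hj).
  destruct hF, hG. split; simpl; apply @continuous_plus; auto; now apply @continuous_opp.
Qed.

Lemma continuous_rsum m (f : nat -> U -> R) p :
  (forall i, (i < m)%nat -> continuous (f i) p) -> continuous (fun q => rsum m (fun i => f i q)) p.
Proof.
  induction m; intros h; simpl; [apply continuous_const|].
  apply @continuous_plus; [apply IHm|]; auto.
Qed.

Lemma mcont_norm m F p eps :
  0 < eps -> mcont m F p -> locally p (fun q => mnorm m (msub (F q) (F p)) < eps).
Proof.
  intros he h.
  assert (hc : continuous (fun q => mnorm m (msub (F q) (F p))) p).
  { assert (hs := mcont_sub m F (fun _ => F p) p h (mcont_const m (F p) p)).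
    unfold mnorm.
    apply (continuous_rsum m (fun i q => rsum m (fun j => cabs (msub (F q) (F p) i j)))). intros i hi.
    apply (continuous_rsum m (fun j q => cabs (msub (F q) (F p) i j))). intros j hj.
    destruct (hs i j hi hj) as [h1 h2].
    apply @continuous_plus; (apply (continuous_comp _ Rabs); [assumption|apply continuous_Rabs]). }
  generalize (proj1 (continuous_R_iff _ _) hc eps he). apply filter_imp. intros q.
  assert (e : mnorm m (msub (F p) (F p)) = 0).
  { rewrite <- (mnorm_0 m). apply mnorm_meq. intros i j _ _. unfold msub. ring. }
  rewrite e, Rminus_0_r. intros hq. eapply Rle_lt_trans; [apply Rle_abs|exact hq].
Qed.

Lemma mcont_of_norm m F p :
  (forall eps, 0 < eps -> locally p (fun q => mnorm m (msub (F q) (F p)) < eps)) -> mcont m F p.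
Proof.
  intros h i j hi hj. apply ccont_iff. intros eps he. generalize (h eps he).
  apply filter_imp. intros q hq. eapply Rle_lt_trans; [|exact hq].
  now apply (mnorm_entry m (msub (F q) (F p))).
Qed.

(** The roots are chosen independently at each point; the Lipschitz bound [msqrt_lip] forces them to
    vary continuously. *)
Lemma mcont_sqrt m (F : U -> Mat) p :
  (forall q, mnorm m (msub Imat (F q)) <= / 2) -> mcont m F p ->
  mcont m (fun q => msqrt m (F q)) p.
Proof.
  intros hF h. apply mcont_of_norm. intros eps he. generalize (mcont_norm m F p eps he h).
  apply filter_imp. intros q hq. eapply Rle_lt_trans; [|exact hq].
  destruct (msqrt_spec m _ (hF q)) as [h1 h2]. destruct (msqrt_spec m _ (hF p)) as [h3 h4].
  rewrite <- h1 at 2. rewrite <- h3 at 2. pose proof (hF p). pose proof (hF q).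
  apply msqrt_lip; lra.
Qed.

End Continuity.

Lemma Cnorm_le_cabs z : Cnorm z <= cabs z.
Proof.
  unfold Cnorm, cabs. pose proof (Rabs_pos (cre z)). pose proof (Rabs_pos (cim z)).
  rewrite <- (sqrt_Rsqr (Rabs (cre z) + Rabs (cim z))) by lra.
  apply sqrt_le_1_alt. unfold Rsqr. rewrite <- (pow2_abs (cre z)), <- (pow2_abs (cim z)). nra.
Qed.
Lemma cabs_le_Cnorm z : cabs z <= 2 * Cnorm z.
Proof.
  assert (h : forall x y, Rabs x <= sqrt (x ^ 2 + y ^ 2)).
  { intros x y. rewrite <- sqrt_Rsqr_abs. apply sqrt_le_1_alt. unfold Rsqr. nra. }
  unfold cabs, Cnorm. pose proof (h (cre z) (cim z)). pose proof (h (cim z) (cre z)) as h2.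
  rewrite Rplus_comm in h2. lra.
Qed.
Lemma mcont_Cnorm {U : UniformSpace} m (F : U -> Mat) p :
  mcont m F p <-> forall eps, 0 < eps -> locally p (fun q => forall i j, (i < m)%nat -> (j < m)%nat ->
    Cnorm (Csub (F q i j) (F p i j)) < eps).
Proof.
  split.
  - intros h eps he. generalize (mcont_norm m F p eps he h). apply filter_imp.
    intros q hq i j hi hj. eapply Rle_lt_trans; [apply Cnorm_le_cabs|].
    eapply Rle_lt_trans; [|exact hq]. now apply (mnorm_entry m (msub (F q) (F p))).
  - intros h i j hi hj. apply ccont_iff. intros eps he. assert (he2 : 0 < eps / 2) by lra.
    generalize (h _ he2). apply filter_imp. intros q hq.
    eapply Rle_lt_trans; [apply cabs_le_Cnorm|]. specialize (hq i j hi hj). lra.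
Qed.

Lemma mcont_comp {U V : UniformSpace} m (g : U -> V) (F : V -> Mat) p :
  continuous g p -> mcont m F (g p) -> mcont m (fun q => F (g q)) p.
Proof.
  intros hg hF i j hi hj. destruct (hF i j hi hj) as [h1 h2].
  split; [apply (continuous_comp g (fun v => cre (F v i j)))
         |apply (continuous_comp g (fun v => cim (F v i j)))]; auto.
Qed.

(** * Joint continuity in time and momentum, and its uniformity under periodicity *)

Definition PT (d : nat) : UniformSpace :=
  prod_UniformSpace R_UniformSpace (fct_UniformSpace (Idx d) R_UniformSpace).

(** Balls of [fct_UniformSpace] are taken coordinatewise, so they are literally the conditions
    [close] of the epsilon-delta definitions. *)
Lemma locally_PT {d} (t : R) (k : Rvec d) (Q : PT d -> Prop) :
  locally ((t, k) : PT d) Q <->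
  exists delta, 0 < delta /\ forall t' k', Rabs (t' - t) < delta -> close k k' delta -> Q (t', k').
Proof.
  split.
  - intros [[e he] h]. exists e. split; [exact he|]. intros t' k' h1 h2. apply h.
    split; [exact h1|exact h2].
  - intros [e [he h]]. exists (mkposreal e he). intros [t' k'] [h1 h2]. now apply h.
Qed.

Lemma PT_lipschitz {d} L (g : PT d -> PT d) :
  0 < L -> (forall p q : PT d, forall e, ball p e q -> ball (g p) (L * e) (g q)) ->
  forall p, continuous g p.
Proof.
  intros hL h p. apply filterlim_locally. intros [e he].
  assert (he' : 0 < e / L) by now apply Rdiv_lt_0_compat.
  exists (mkposreal _ he'). intros q hq. apply h in hq. simpl in hq.
  replace (L * (e / L)) with e in hq by (field; lra). exact hq.
Qed.

Lemma continuous_reparam {d} L (phi : R -> R) (p : PT d) :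
  0 < L -> (forall s t, Rabs (phi s - phi t) <= L * Rabs (s - t)) ->
  continuous ((fun q => (phi (fst q), snd q)) : PT d -> PT d) p.
Proof.
  (* L + 1 serves both coordinates: L for the time, 1 for k. *)
  intros hL h. apply (PT_lipschitz (L + 1)); [lra|].
  intros [t k] [t' k'] e [h1 h2]. simpl in h1, h2. assert (he : 0 < e).
  { pose proof (Rabs_pos (t' - t)). unfold ball in h1; simpl in h1.
    unfold AbsRing_ball, abs, minus, plus, opp in h1; simpl in h1. unfold Rminus in *. lra. }
  split; simpl.
  - unfold ball in *; simpl in *. unfold AbsRing_ball, abs, minus, plus, opp in *; simpl in *.
    specialize (h t' t). unfold Rminus in h.
    assert (L * Rabs (t' + - t) < L * e) by (now apply Rmult_lt_compat_l). lra.
  - intros i. apply ball_le with e; [nra|]. apply h2.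
Qed.

Lemma continuous_neg_k {d} (p : PT d) :
  continuous ((fun q => (fst q, vneg (snd q))) : PT d -> PT d) p.
Proof.
  apply (PT_lipschitz 1); [lra|]. intros [t k] [t' k'] e [h1 h2]. rewrite Rmult_1_l.
  split; [exact h1|]. intros i. specialize (h2 i). simpl in *.
  unfold ball in *; simpl in *. unfold AbsRing_ball, abs, minus, plus, opp in *; simpl in *.
  unfold vneg. rewrite <- Rabs_Ropp. replace (- (- k' i + - - k i)) with (k' i + - k i) by ring.
  exact h2.
Qed.

(** The compactness theorem for boxes speaks of nested tuples [Tn]; [nthT] and [mkT] translate to
    and from coordinate functions. *)
Fixpoint nthT (n : nat) : Tn n R -> nat -> R :=
  match n return Tn n R -> nat -> R with
  | O => fun _ _ => 0
  | S n' => fun x i => match i with O => fst x | S i' => nthT n' (snd x) i' end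
  end.
Fixpoint mkT (n : nat) (f : nat -> R) : Tn n R :=
  match n return Tn n R with
  | O => tt
  | S n' => (f O, mkT n' (fun i => f (S i)))
  end.
Lemma nthT_mkT n f i : (i < n)%nat -> nthT n (mkT n f) i = f i.
Proof.
  revert f i; induction n; intros f i hi; [lia|]. destruct i; simpl; [reflexivity|].
  rewrite IHn; [reflexivity|lia].
Qed.
Lemma close_n_nth n e x y :
  close_n n e x y -> forall i, (i < n)%nat -> Rabs (nthT n x i - nthT n y i) < e.
Proof.
  induction n; intros h i hi; [lia|]. destruct x as [x1 x2], y as [y1 y2]. destruct h as [h1 h2].
  destruct i; simpl; [exact h1|]. apply IHn; [exact h2|lia].
Qed.
Lemma bounded_n_mkT n f :
  (forall i, (i < n)%nat -> 0 <= f i <= 1) -> bounded_n n (mkT n (fun _ => 0)) (mkT n (fun _ => 1)) (mkT n f).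
Proof.
  revert f. induction n; intros f h; simpl; [exact I|]. split; [apply h; lia|].
  apply IHn. intros; apply h; lia.
Qed.

Definition ext0 {d} (k : Rvec d) (i : nat) : R :=
  match Compare_dec.lt_dec i d with left h => k (exist _ i h) | right _ => 0 end.
Lemma ext0_val {d} (k : Rvec d) (i : Idx d) : ext0 k (proj1_sig i) = k i.
Proof.
  destruct i as [i hi]. unfold ext0. simpl. destruct (Compare_dec.lt_dec i d) as [h|h]; [|lia].
  f_equal. f_equal. apply proof_irrelevance.
Qed.

Lemma vshift_frac {d} (k : Rvec d) :
  k = vshift (fun i => frac_part (k i)) (fun i => Int_part (k i)).
Proof. apply functional_extensionality. intros i. unfold vshift, frac_part. ring. Qed.

(** Fractional parts move k into the unit cube, where compactness supplies a uniform radius. Only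
    the times differ, so a single covering point close to (s, k) controls both values. *)
Lemma periodic_uniform_continuity {d} m (F : R -> Rvec d -> Mat) :
  (forall p : PT d, mcont m (fun q => F (fst q) (snd q)) p) ->
  (forall (t : R) (k : Rvec d) n, meq m (F t (vshift k n)) (F t k)) ->
  forall rho, 0 < rho -> exists delta, 0 < delta /\
    forall (s t : R) (k : Rvec d), 0 <= s <= 1 -> 0 <= t <= 1 -> Rabs (s - t) < delta ->
      mnorm m (msub (F s k) (F t k)) < rho.
Proof.
  intros hc hper rho hrho.
  (* Control on the ball of radius 2e leaves room for t: the point (s, k) lies within e of the
     centre, and t within e of s. *)
  assert (hd : forall p : PT d, exists e : posreal, forall q, ball p (2 * e) q ->
      mnorm m (msub (F (fst q) (snd q)) (F (fst p) (snd p))) < rho / 2).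
  { intros p. destruct (mcont_norm m (fun q => F (fst q) (snd q)) p (rho / 2) ltac:(lra) (hc p)) as [e h].
    exists (pos_div_2 e). intros q hq. apply h. simpl in hq.
    replace (2 * (e / 2)) with (pos e) in hq by field. exact hq. }
  set (del := fun p => proj1_sig (constructive_indefinite_description _ (hd p))).
  assert (hdel : forall p q, ball p (2 * del p) q -> mnorm m (msub (F (fst q) (snd q)) (F (fst p) (snd p))) < rho / 2).
  { intros p. unfold del. now destruct (constructive_indefinite_description _ (hd p)). }
  set (toP := fun x : Tn (S d) R => (fst x, fun i : Idx d => nthT d (snd x) (proj1_sig i)) : PT d).
  destruct (compactness_value (S d) (mkT (S d) (fun _ => 0)) (mkT (S d) (fun _ => 1))
    (fun x => del (toP x))) as [e he].
  exists e. split; [apply cond_pos|]. intros s t k hs ht hst.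
  rewrite (vshift_frac k), !hper. set (k0 := fun i => frac_part (k i) : R).
  set (x := mkT (S d) (fun i => match i with O => s | S i' => ext0 k0 i' end)).
  (* [compactness_value] gives its covering point only under a double negation, so the estimate is
     proved by contradiction. *)
  apply Rnot_le_lt. intros hno.
  apply (he x).
  { apply bounded_n_mkT. intros i hi. destruct i as [|i]; [exact hs|]. unfold ext0.
    destruct (Compare_dec.lt_dec i d) as [h|h]; [|lra]. unfold k0.
    destruct (base_fp (k (exist _ i h))). lra. }
  intros [y [_ [hy hey]]].
  set (p := toP y) in *.
  pose proof (close_n_nth _ _ _ _ hy) as hcl. pose proof (cond_pos (del p)).
  assert (hk : forall i : Idx d, Rabs (k0 i - snd p i) < del p).
  { intros [i hi]. specialize (hcl (S i) ltac:(lia)). unfold x in hcl.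
    rewrite nthT_mkT in hcl by lia. simpl in hcl.
    rewrite <- (ext0_val k0). exact hcl. }
  assert (h0 : Rabs (s - fst p) < del p) by exact (hcl O ltac:(lia)).
  assert (hb : forall u, Rabs (u - fst p) < 2 * del p -> ball p (2 * del p) ((u, k0) : PT d)).
  { intros u hu. split; [exact hu|]. intros i. specialize (hk i).
    change (Rabs (k0 i - snd p i) < 2 * del p). lra. }
  assert (hs2 : Rabs (s - fst p) < 2 * del p) by lra.
  assert (ht2 : Rabs (t - fst p) < 2 * del p).
  { replace (t - fst p) with ((s - fst p) + - (s - t)) by ring.
    eapply Rle_lt_trans; [apply Rabs_triang|]. rewrite Rabs_Ropp. lra. }
  pose proof (hdel p (s, k0) (hb s hs2)) as e1.
  pose proof (hdel p (t, k0) (hb t ht2)) as e2.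
  pose proof (mnorm_tri m (F s k0) (F (fst p) (snd p)) (F t k0)) as h3.
  rewrite (mnorm_sub_sym m (F (fst p) (snd p))) in h3.
  apply (Rlt_irrefl rho). eapply Rle_lt_trans; [exact hno|]. eapply Rle_lt_trans; [exact h3|].
  replace rho with (rho / 2 + rho / 2) by field.
  apply Rplus_lt_compat; [exact e1|exact e2].
Qed.

(** * Lifting equivariant homotopies *)

Lemma msqrt_meq m X Y :
  mnorm m (msub Imat X) <= / 2 -> meq m X Y -> meq m (msqrt m X) (msqrt m Y).
Proof.
  intros hX h. assert (hY := hX). rewrite h in hY. destruct (msqrt_spec m Y hY) as [h1 h2].
  apply msqrt_unique; auto; [lra|]. now rewrite h1, h.
Qed.
Lemma msub_self_norm m X : mnorm m (msub X X) = 0.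
Proof. rewrite <- (mnorm_0 m). apply mnorm_meq. intros i j _ _. unfold msub. ring. Qed.
Lemma msqrt_1 m X : meq m X Imat -> meq m (msqrt m X) Imat.
Proof.
  intros h. assert (h0 := msub_self_norm m Imat). apply msqrt_unique; rewrite ?h, ?h0; try lra.
  apply mmul_1_l.
Qed.

(** [A (clampR c t)] is the homotopy frozen at its initial value for t <= 0 and stopped at time c;
    the lift is built by induction on c. *)
Definition clampR (c t : R) : R := Rmax 0 (Rmin t c).
Lemma clampR_lip c s t : Rabs (clampR c s - clampR c t) <= Rabs (s - t).
Proof.
  unfold clampR, Rmax, Rmin. repeat destruct Rle_dec; unfold Rabs; repeat destruct Rcase_abs; lra.
Qed.
Lemma clampR_le c t : 0 <= c -> 0 <= clampR c t <= c.
Proof. intros h. unfold clampR, Rmax, Rmin. repeat destruct Rle_dec; lra. Qed.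
Lemma clampR_step c e t : 0 <= c -> 0 <= e -> Rabs (clampR c t - clampR (c + e) t) <= e.
Proof.
  intros hc he. unfold clampR, Rmax, Rmin.
  repeat destruct Rle_dec; unfold Rabs; repeat destruct Rcase_abs; lra.
Qed.
Lemma clampR_neg c t : t <= 0 -> clampR c t = 0.
Proof. intros h. unfold clampR, Rmax, Rmin. repeat destruct Rle_dec; lra. Qed.
Lemma clampR_id c t : 0 <= t <= c -> clampR c t = t.
Proof. intros h. unfold clampR, Rmax, Rmin. repeat destruct Rle_dec; lra. Qed.

Section Lift.
Context {d : nat} (m : nat) (E : Mat) (A : R -> Rvec d -> Mat).
Hypothesis HE : is_unitary m E.
Hypothesis HAu : forall t k, is_unitary m (A t k).
Hypothesis HAc : forall p : PT d, mcont m (fun q => A (fst q) (snd q)) p.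
Hypothesis HAper : forall (t : R) (k : Rvec d) n, meq m (A t (vshift k n)) (A t k).
Hypothesis HAE : forall (t : R) (k : Rvec d), meq m (mmul m E (A t k)) (mmul m (mtr (A t (vneg k))) E).
Hypothesis HA0 : forall k : Rvec d, meq m (A 0 k) Imat.

(** The lift is defined for all real times, and the triviality of V at t <= 0 is carried along
    because the gluing relies on it. *)
Definition lifts_upto (c : R) (V : R -> Rvec d -> Mat) : Prop :=
  (forall p : PT d, mcont m (fun q => V (fst q) (snd q)) p) /\ (forall t k, is_unitary m (V t k)) /\
  (forall (t : R) (k : Rvec d) n, meq m (V t (vshift k n)) (V t k)) /\
  (forall (t : R) (k : Rvec d), t <= 0 -> meq m (V t k) Imat) /\
  (forall (t : R) (k : Rvec d), meq m (mmul m E (A (clampR c t) k))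
                     (mmul m (mtr (V t (vneg k))) (mmul m E (V t k)))).

Lemma lift_0 : lifts_upto 0 (fun _ _ => Imat).
Proof.
  repeat apply conj.
  - intros p. apply (mcont_const m Imat).
  - intros _ _. apply unitary_1.
  - reflexivity.
  - reflexivity.
  - intros t k.
    replace (clampR 0 t) with 0 by (pose proof (clampR_le 0 t (Rle_refl _)); lra).
    now rewrite HA0, mtr_1, mmul_1_l.
Qed.

(* The increment X of two nearby families satisfies X(-k)^T (E A) = (E A) X(k), and so does
   sqrt X; hence E A X = sqrt X(-k)^T (E A) sqrt X(k). *)
Lemma lift_step c e V :
  0 <= c -> 0 <= e -> c + e <= 1 ->
  (forall (s t : R) (k : Rvec d), 0 <= s <= 1 -> 0 <= t <= 1 -> Rabs (s - t) <= e ->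
     ubound m * mnorm m (msub (A s k) (A t k)) <= sqrad m) ->
  lifts_upto c V -> exists V', lifts_upto (c + e) V'.
Proof.
  intros hc he hce hclose [hVc [hVu [hVp [hV0 hVE]]]].
  set (A1 := fun t k => A (clampR c t) k).
  set (A2 := fun t k => A (clampR (c + e) t) k).
  set (X := fun t k => mmul m (madj (A1 t k)) (A2 t k)).
  assert (hX : forall t k, mnorm m (msub Imat (X t k)) <= sqrad m).
  { intros t k. unfold X.
    (* 1 - A1* A2 = A1* (A1 - A2), so X is near 1 as soon as the two stopped families are close. *)
    assert (h1 : meq m (msub Imat (mmul m (madj (A1 t k)) (A2 t k)))
      (mmul m (madj (A1 t k)) (msub (A1 t k) (A2 t k)))).
    { rewrite mmul_sub_r, (proj1 (proj1 (unitary_iff m (A1 t k)) (HAu _ _))). reflexivity. }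
    rewrite h1. eapply Rle_trans; [apply mnorm_mul|].
    eapply Rle_trans; [apply Rmult_le_compat_r; [apply mnorm_ge0|]|].
    - apply (unitary_norm m (madj (A1 t k))), unitary_adj, HAu.
    - apply (hclose (clampR c t) (clampR (c + e) t) k).
      + pose proof (clampR_le c t hc). lra.
      + pose proof (clampR_le (c + e) t ltac:(lra)). lra.
      + now apply clampR_step. }
  assert (hX2 : forall t k, mnorm m (msub Imat (X t k)) <= / 2).
  { intros t k. apply (sqrad_small m); [apply mnorm_ge0|apply hX]. }
  assert (hXu : forall t k, is_unitary m (X t k)).
  { intros t k. apply unitary_mul; [apply unitary_adj|]; apply HAu. }
  assert (hA12 : forall c (p : PT d), mcont m (fun q => A (clampR c (fst q)) (snd q)) p).
  { intros c' p. apply (mcont_comp m (fun q : PT d => ((clampR c' (fst q), snd q) : PT d)) (fun q => A (fst q) (snd q))).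
    - apply (continuous_reparam 1); [lra|]. intros. rewrite Rmult_1_l. apply clampR_lip.
    - apply HAc. }
  assert (hXc : forall p : PT d, mcont m (fun q => X (fst q) (snd q)) p).
  { intros p. unfold X, A1, A2.
    apply (mcont_mul m (fun q => madj (A (clampR c (fst q)) (snd q))));
      [apply mcont_adj|]; apply hA12. }
  exists (fun t k => mmul m (V t k) (msqrt m (X t k))). repeat apply conj.
  - intros p. apply (mcont_mul m (fun q => V (fst q) (snd q))); [apply hVc|].
    apply (mcont_sqrt m (fun q => X (fst q) (snd q))); auto.
  - intros t k. apply unitary_mul; [apply hVu|apply msqrt_unitary; auto].
  - intros t k n. rewrite hVp, (msqrt_meq m (X t (vshift k n)) (X t k)); [reflexivity|auto|].
    unfold X, A1, A2; simpl. now rewrite !HAper.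
  - intros t k ht. rewrite (hV0 t k ht), msqrt_1; [apply mmul_1_l|].
    unfold X, A1, A2; simpl. rewrite !clampR_neg by auto. rewrite HA0, madj_1. apply mmul_1_l.
  - intros t k.
    assert (hu : forall t k, meq m (mmul m (A t k) (madj (A t k))) Imat).
    { intros t' k'. pose proof (HAu t' k') as h. now apply unitary_iff in h. }
    assert (hBX : meq m (mmul m (mmul m E (A1 t k)) (X t k)) (mmul m E (A2 t k))).
    { unfold X. rewrite mmul_assoc. unfold A1. now rewrite (mmul_cancel m (A (clampR c t) k)). }
    (* X(-k)^t = A2(-k)^t conj(A1(-k)), and [HAE] rewrites E A1(k) as A1(-k)^t E: the two inner
       factors cancel, leaving A2(-k)^t E = E A2(k). *)
    assert (hrel : meq m (mmul m (mtr (X t (vneg k))) (mmul m E (A1 t k)))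
                         (mmul m (mmul m E (A1 t k)) (X t k))).
    { rewrite hBX. unfold X, A1, A2; simpl. rewrite mtr_mul, mtr_adj, !HAE, mmul_assoc.
      rewrite (mmul_cancel m (mconj (A (clampR c t) (vneg k)))); [reflexivity|].
      apply (proj1 (unitary_iff m (mtr _))), unitary_tr, HAu. }
    pose proof (msqrt_intertwine m (X t k) (X t (vneg k)) (mmul m E (A1 t k))
      ltac:(apply unitary_mul; [exact HE|apply HAu]) (hX _ _) (hX _ _) hrel) as hS.
    change (A (clampR (c + e) t) k) with (A2 t k). rewrite <- hBX.
    destruct (msqrt_spec m (X t k) (hX2 _ _)) as [hW _].
    rewrite <- hW at 1. rewrite <- (mmul_assoc m (mmul m E _)), <- hS.
    unfold A1 at 1; simpl. rewrite hVE, mtr_mul, !mmul_assoc. reflexivity.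
Qed.

Lemma lift_exists : exists V, lifts_upto 1 V.
Proof.
  pose proof (ubound_ge0 m) as hub. pose proof (sqrad_pos m) as hsq.
  (* The + 1 keeps the quotient defined when m = 0, where [ubound m] vanishes. *)
  destruct (periodic_uniform_continuity m A HAc HAper (sqrad m / (ubound m + 1)))
    as [delta [hdelta hunif]]; [apply Rdiv_lt_0_compat; lra|].
  destruct (archimed_cor1 delta hdelta) as [N [hN hN0]].
  assert (hNpos : 0 < INR N) by (apply lt_0_INR; lia).
  assert (hNi : 0 < / INR N) by now apply Rinv_0_lt_compat.
  assert (hj : forall j, (j <= N)%nat -> exists V, lifts_upto (INR j / INR N) V).
  { induction j; intros hjN.
    - exists (fun _ _ => Imat). simpl. replace (0 / INR N) with 0 by (field; lra). apply lift_0.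
    - destruct IHj as [V hV]; [lia|].
      replace (INR (S j) / INR N) with (INR j / INR N + / INR N) by (rewrite S_INR; field; lra).
      apply (lift_step _ _ V); auto.
      + apply Rmult_le_pos; [apply pos_INR|lra].
      + lra.
      + apply le_INR in hjN. rewrite S_INR in hjN.
        replace (INR j / INR N + / INR N) with ((INR j + 1) * / INR N) by (field; lra).
        apply (Rmult_le_reg_r (INR N)); auto. rewrite Rmult_assoc, Rinv_l; lra.
      + intros s t k hs ht hst.
        pose proof (hunif s t k hs ht ltac:(lra)) as h.
        pose proof (mnorm_ge0 m (msub (A s k) (A t k))) as h0.
        apply Rle_trans with ((ubound m + 1) * mnorm m (msub (A s k) (A t k))); [nra|].
        apply Rlt_le, (Rmult_le_compat_l (ubound m + 1)) in h; [|lra].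
        replace ((ubound m + 1) * (sqrad m / (ubound m + 1))) with (sqrad m) in h by (field; lra).
        exact h. }
  destruct (hj N (Nat.le_refl _)) as [V hV]. exists V.
  replace (INR N / INR N) with 1 in hV by (field; lra). exact hV.
Qed.
End Lift.

(** * Skew evolution equations *)

Section RealInner.
Context {H : HilbertSpace}.
Implicit Types x y z v : H.

(** The real inner product determines norms and vectors, and unitary and antiunitary maps preserve
    it alike. *)
Definition rin x y : R := cre (hinner x y).

Lemma hinner_sym x y : hinner x y = Cconj (hinner y x).
Proof. apply hinner_conj. Qed.
Lemma rin_sym x y : rin x y = rin y x.
Proof. unfold rin. now rewrite hinner_sym. Qed.
Lemma hinner_scall a x y : hinner (hscal a x) y = Cmul (Cconj a) (hinner x y).
Proof. now rewrite hinner_sym, hinner_scal, Cconj_mul, <- hinner_sym. Qed.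

Lemma rin_addr x y z : rin x (hadd y z) = rin x y + rin x z.
Proof. unfold rin. now rewrite hinner_add. Qed.
Lemma rin_addl x y z : rin (hadd y z) x = rin y x + rin z x.
Proof. now rewrite rin_sym, rin_addr, !(rin_sym x). Qed.
Lemma rin_zeror x : rin x hzero = 0.
Proof.
  assert (h : rin x (hadd hzero hzero) = rin x hzero) by now rewrite hadd_0.
  rewrite rin_addr in h. lra.
Qed.
Lemma rin_zerol x : rin hzero x = 0.
Proof. rewrite rin_sym. apply rin_zeror. Qed.
Lemma rin_oppr x y : rin x (hopp y) = - rin x y.
Proof.
  assert (h : rin x (hadd (hopp y) y) = 0) by (rewrite hadd_opp; apply rin_zeror).
  rewrite rin_addr in h. lra.
Qed.
Lemma rin_oppl x y : rin (hopp y) x = - rin y x.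
Proof. now rewrite rin_sym, rin_oppr, rin_sym. Qed.
Lemma rin_subr x y z : rin x (hsub y z) = rin x y - rin x z.
Proof. unfold hsub. rewrite rin_addr, rin_oppr. ring. Qed.
Lemma rin_subl x y z : rin (hsub y z) x = rin y x - rin z x.
Proof. unfold hsub. rewrite rin_addl, rin_oppl. ring. Qed.
Lemma rin_scalr r x y : rin x (hscal (RtoC r) y) = r * rin x y.
Proof. unfold rin. rewrite hinner_scal. simpl. ring. Qed.
Lemma rin_scall r x y : rin (hscal (RtoC r) y) x = r * rin y x.
Proof. now rewrite rin_sym, rin_scalr, rin_sym. Qed.

Lemma rin_ge0 x : 0 <= rin x x.
Proof. apply hinner_pos. Qed.
Lemma rin_eq0 x : rin x x = 0 -> x = hzero.
Proof.
  intros h. apply hinner_def. apply Cx_eq; [exact h|]. simpl.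
  pose proof (f_equal cim (hinner_sym x x)) as e. simpl in e. lra.
Qed.
Lemma hsub_eq0 x y : hsub x y = hzero -> x = y.
Proof.
  intros h. unfold hsub in h.
  assert (e : hadd (hadd x (hopp y)) y = y) by now rewrite h, hadd_0.
  rewrite <- e. now rewrite <- hadd_assoc, hadd_opp, hadd_comm, hadd_0.
Qed.
(** Testing against an arbitrary [z] turns identities between vectors into [ring] goals; this is the
    standard way of proving them below. *)
Lemma rin_ext x y : (forall z, rin x z = rin y z) -> x = y.
Proof. intros h. apply hsub_eq0, rin_eq0. rewrite rin_subl, h. ring. Qed.

Lemma cauchy_schwarz_sq x y : rin x y * rin x y <= rin x x * rin y y.
Proof.
  destruct (Req_dec (rin y y) 0) as [e|e].
  - rewrite (rin_eq0 _ e), !rin_zeror. lra.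
  - pose proof (rin_ge0 y) as hy.
    (* The squared length of <y,y> x - <x,y> y: the usual projection residue, scaled to avoid a
       division. *)
    pose proof (rin_ge0 (hsub (hscal (RtoC (rin y y)) x) (hscal (RtoC (rin x y)) y))) as h.
    rewrite !rin_subl, !rin_subr, !rin_scall, !rin_scalr, (rin_sym y x) in h. nra.
Qed.
Lemma hnorm_ge0 x : 0 <= hnorm x.
Proof. apply sqrt_pos. Qed.
Lemma hnorm_sq x : hnorm x * hnorm x = rin x x.
Proof. apply sqrt_sqrt, rin_ge0. Qed.
Lemma hnorm_le_sq x c : 0 <= c -> rin x x <= c * c -> hnorm x <= c.
Proof. intros hc h. pose proof (hnorm_ge0 x). pose proof (hnorm_sq x). nra. Qed.
Lemma cauchy_schwarz x y : Rabs (rin x y) <= hnorm x * hnorm y.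
Proof.
  pose proof (cauchy_schwarz_sq x y). pose proof (hnorm_ge0 x). pose proof (hnorm_ge0 y).
  pose proof (hnorm_sq x) as hx. pose proof (hnorm_sq y) as hy.
  apply Rsqr_incr_0_var; [|nra]. rewrite <- Rsqr_abs. unfold Rsqr.
  replace (hnorm x * hnorm y * (hnorm x * hnorm y)) with (hnorm x * hnorm x * (hnorm y * hnorm y)) by ring.
  now rewrite hx, hy.
Qed.
Lemma hnorm_add x y : hnorm (hadd x y) <= hnorm x + hnorm y.
Proof.
  pose proof (hnorm_ge0 x). pose proof (hnorm_ge0 y).
  apply hnorm_le_sq; [lra|]. rewrite !rin_addl, !rin_addr, (rin_sym y x), <- !hnorm_sq.
  pose proof (cauchy_schwarz x y). pose proof (Rle_abs (rin x y)). nra.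
Qed.
Lemma hnorm_eq x y : rin x x = rin y y -> hnorm x = hnorm y.
Proof. intros h. unfold hnorm. fold (rin x x) (rin y y). now rewrite h. Qed.
Lemma hnorm_opp x : hnorm (hopp x) = hnorm x.
Proof. apply hnorm_eq. rewrite rin_oppl, rin_oppr. ring. Qed.
Lemma hnorm_sub_sym x y : hnorm (hsub x y) = hnorm (hsub y x).
Proof. apply hnorm_eq. rewrite !rin_subl, !rin_subr. ring. Qed.
Lemma hnorm_sub_tri x y z : hnorm (hsub x z) <= hnorm (hsub x y) + hnorm (hsub y z).
Proof.
  eapply Rle_trans; [|apply hnorm_add]. right. f_equal. apply rin_ext. intros w.
  rewrite !rin_addl, !rin_subl. ring.
Qed.
Lemma hnorm_scalR r x : hnorm (hscal (RtoC r) x) = Rabs r * hnorm x.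
Proof.
  unfold hnorm at 1. fold (rin (hscal (RtoC r) x) (hscal (RtoC r) x)).
  rewrite rin_scall, rin_scalr, <- hnorm_sq.
  replace (r * (r * (hnorm x * hnorm x))) with (Rsqr (r * hnorm x)) by (unfold Rsqr; ring).
  rewrite sqrt_Rsqr_abs, Rabs_mult, (Rabs_pos_eq (hnorm x)); auto using hnorm_ge0.
Qed.
Lemma hnorm_zero : hnorm (@hzero H) = 0.
Proof. unfold hnorm. fold (rin (@hzero H) hzero). rewrite rin_zerol. apply sqrt_0. Qed.

Definition Ci : Cx := mkCx 0 1.
(** A map that preserves [rin] and commutes with i therefore preserves the complex inner product. *)
Lemma hinner_rin x y : hinner x y = mkCx (rin x y) (rin (hscal Ci x) y).
Proof. apply Cx_eq; simpl; [reflexivity|]. unfold rin. rewrite hinner_scall. simpl. ring. Qed.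
Lemma hscal_split a x : hscal a x = hadd (hscal (RtoC (cre a)) x) (hscal (RtoC (cim a)) (hscal Ci x)).
Proof.
  rewrite hscal_assoc, <- hscal_distr_r. f_equal. apply Cx_eq; simpl; ring.
Qed.
Lemma rin_ii x y : rin (hscal Ci x) (hscal Ci y) = rin x y.
Proof. unfold rin. rewrite hinner_scall, hinner_scal. simpl. ring. Qed.
Lemma rin_i_swap x y : rin (hscal Ci x) y = - rin x (hscal Ci y).
Proof. unfold rin. rewrite hinner_scall, hinner_scal. simpl. ring. Qed.

(** * Derivatives of curves in the Hilbert space, and skew equations *)

Definition hderiv (u : R -> H) (t : R) (v : H) : Prop :=
  forall eps, 0 < eps -> exists delta, 0 < delta /\ forall h, h <> 0 -> Rabs h < delta ->
    hnorm (hsub (hsub (u (t + h)) (u t)) (hscal (RtoC h) v)) <= eps * Rabs h.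

Lemma hderiv_opderiv (F : R -> Op) t (G : Op) x :
  is_opderiv F t G -> hderiv (fun s => F s x) t (G x).
Proof.
  intros h eps he. pose proof (hnorm_ge0 x) as hx.
  destruct (h (eps / (hnorm x + 1))) as [dl [hd h1]]; [apply Rdiv_lt_0_compat; lra|].
  exists dl. split; auto. intros s hs1 hs2. eapply Rle_trans; [now apply h1|].
  pose proof (Rabs_pos s).
  replace (eps / (hnorm x + 1) * Rabs s * hnorm x)
    with (eps * Rabs s * (hnorm x / (hnorm x + 1))) by (field; lra).
  rewrite <- (Rmult_1_r (eps * Rabs s)) at 2. apply Rmult_le_compat_l; [nra|].
  apply (Rmult_le_reg_r (hnorm x + 1)); [lra|]. unfold Rdiv. rewrite Rmult_assoc, Rinv_l; lra.
Qed.

Lemma hderiv_const x t : hderiv (fun _ => x) t hzero.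
Proof.
  intros eps he. exists 1. split; [lra|]. intros h _ _.
  replace (hsub (hsub x x) (hscal (RtoC h) hzero)) with (@hzero H).
  - rewrite hnorm_zero. pose proof (Rabs_pos h). nra.
  - apply rin_ext. intros z. rewrite !rin_subl, rin_scall, rin_zerol. ring.
Qed.

Lemma hderiv_step u t v e :
  0 < e -> hderiv u t v -> exists dl, 0 < dl /\ forall h, Rabs h < dl ->
    hnorm (hsub (hsub (u (t + h)) (u t)) (hscal (RtoC h) v)) <= e * Rabs h.
Proof.
  intros he hu. destruct (hu e he) as [dl [hd h1]]. exists dl. split; auto. intros h hh.
  destruct (Req_dec h 0) as [->|hn]; [|now apply h1].
  rewrite Rplus_0_r, Rabs_R0, Rmult_0_r.
  replace (hsub (hsub (u t) (u t)) (hscal (RtoC 0) v)) with (@hzero H).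
  - rewrite hnorm_zero. lra.
  - apply rin_ext. intros z. rewrite !rin_subl, rin_scall, rin_zerol. ring.
Qed.

Lemma hderiv_lip u t v :
  hderiv u t v -> exists dl, 0 < dl /\ forall h, Rabs h < dl ->
    hnorm (hsub (u (t + h)) (u t)) <= (hnorm v + 1) * Rabs h.
Proof.
  intros hu. destruct (hderiv_step u t v 1 ltac:(lra) hu) as [dl [hd h1]].
  exists dl. split; auto. intros h hh. specialize (h1 h hh).
  replace (hsub (u (t + h)) (u t)) with
    (hadd (hsub (hsub (u (t + h)) (u t)) (hscal (RtoC h) v)) (hscal (RtoC h) v)).
  - eapply Rle_trans; [apply hnorm_add|]. rewrite hnorm_scalR. lra.
  - apply rin_ext. intros z. rewrite !rin_addl, !rin_subl, rin_scall. ring.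
Qed.

Lemma hderiv_rin u w t u' w' :
  hderiv u t u' -> hderiv w t w' ->
  is_derive (fun s => rin (u s) (w s)) t (rin u' (w t) + rin (u t) w').
Proof.
  intros hu hw. apply is_derive_Reals. intros eps he.
  pose proof (hnorm_ge0 (u t)). pose proof (hnorm_ge0 (w t)).
  pose proof (hnorm_ge0 u') as nu'. pose proof (hnorm_ge0 w') as nw'.
  (* The error is [rin ru (w t) + rin (u t) rw + rin du dw], remainders [r] and increments [d]. K is
     chosen so that the first two terms cost eps/2, and L below so that the quadratic one costs
     eps/4. *)
  set (K := hnorm (u t) + hnorm (w t) + 1).
  assert (hK : 0 < eps / (2 * K)) by (apply Rdiv_lt_0_compat; unfold K; lra).
  destruct (hderiv_step u t u' _ hK hu) as [d1 [hd1 h1]].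
  destruct (hderiv_step w t w' _ hK hw) as [d2 [hd2 h2]].
  destruct (hderiv_lip u t u' hu) as [d3 [hd3 h3]].
  destruct (hderiv_lip w t w' hw) as [d4 [hd4 h4]].
  set (L := (hnorm u' + 1) * (hnorm w' + 1)).
  assert (hL : 0 < L) by (unfold L; nra).
  assert (hd5 : 0 < eps / (4 * L)) by (apply Rdiv_lt_0_compat; lra).
  assert (hdl : 0 < Rmin (Rmin d1 d2) (Rmin (Rmin d3 d4) (eps / (4 * L)))).
  { repeat apply Rmin_pos; auto. }
  exists (mkposreal _ hdl). simpl. intros h hn hh.
  assert (hh' : Rabs h < d1 /\ Rabs h < d2 /\ Rabs h < d3 /\ Rabs h < d4 /\ Rabs h < eps / (4 * L)).
  { revert hh. unfold Rmin. repeat destruct Rle_dec; lra. }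
  destruct hh' as (g1 & g2 & g3 & g4 & g5).
  specialize (h1 h g1). specialize (h2 h g2). specialize (h3 h g3). specialize (h4 h g4).
  set (ru := hsub (hsub (u (t + h)) (u t)) (hscal (RtoC h) u')) in *.
  set (rw := hsub (hsub (w (t + h)) (w t)) (hscal (RtoC h) w')) in *.
  set (du := hsub (u (t + h)) (u t)) in *. set (dw := hsub (w (t + h)) (w t)) in *.
  assert (ha : 0 < Rabs h) by now apply Rabs_pos_lt.
  apply (Rmult_lt_reg_r (Rabs h)); auto. rewrite <- Rabs_mult.
  replace (((rin (u (t + h)) (w (t + h)) - rin (u t) (w t)) / h - (rin u' (w t) + rin (u t) w')) * h)
    with (rin ru (w t) + rin (u t) rw + rin du dw).
  2:{ unfold ru, rw, du, dw. rewrite !rin_subl, !rin_subr, rin_scall, rin_scalr. field. auto. }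
  eapply Rle_lt_trans; [apply Rabs_triang|].
  pose proof (Rabs_triang (rin ru (w t)) (rin (u t) rw)).
  pose proof (cauchy_schwarz ru (w t)). pose proof (cauchy_schwarz (u t) rw).
  pose proof (cauchy_schwarz du dw).
  pose proof (hnorm_ge0 ru). pose proof (hnorm_ge0 rw). pose proof (hnorm_ge0 du).
  pose proof (hnorm_ge0 dw).
  assert (b1 : hnorm ru * hnorm (w t) <= eps / (2 * K) * Rabs h * hnorm (w t))
    by now apply Rmult_le_compat_r.
  assert (b2 : hnorm (u t) * hnorm rw <= hnorm (u t) * (eps / (2 * K) * Rabs h))
    by now apply Rmult_le_compat_l.
  assert (b3 : hnorm du * hnorm dw <= (hnorm u' + 1) * Rabs h * ((hnorm w' + 1) * Rabs h))
    by now apply Rmult_le_compat.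
  assert (b4 : eps / (2 * K) * (hnorm (w t) + hnorm (u t)) <= eps / 2).
  { apply Rle_trans with (eps / (2 * K) * K); [apply Rmult_le_compat_l; [lra|unfold K; lra]|].
    right. field. unfold K. lra. }
  assert (b5 : L * Rabs h <= eps / 4).
  { apply Rle_trans with (L * (eps / (4 * L))); [apply Rmult_le_compat_l; lra|].
    right. field. lra. }
  assert (b6 : eps / (2 * K) * Rabs h * hnorm (w t) + hnorm (u t) * (eps / (2 * K) * Rabs h)
     <= eps / 2 * Rabs h).
  { replace (eps / (2 * K) * Rabs h * hnorm (w t) + hnorm (u t) * (eps / (2 * K) * Rabs h))
      with (eps / (2 * K) * (hnorm (w t) + hnorm (u t)) * Rabs h) by ring.
    apply Rmult_le_compat_r; lra. }
  assert (b7 : (hnorm u' + 1) * Rabs h * ((hnorm w' + 1) * Rabs h) <= eps / 4 * Rabs h).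
  { replace ((hnorm u' + 1) * Rabs h * ((hnorm w' + 1) * Rabs h)) with (L * Rabs h * Rabs h)
      by (unfold L; ring). apply Rmult_le_compat_r; lra. }
  assert (0 < eps * Rabs h) by nra. lra.
Qed.

Lemma const_of_deriv0 (f : R -> R) : (forall t, is_derive f t 0) -> forall t, f t = f 0.
Proof.
  intros h t. destruct (MVT_gen f 0 t (fun _ => 0)) as [c [_ hc]].
  - intros; apply h.
  - intros x _. apply continuity_pt_filterlim. apply (ex_derive_continuous f). eexists; apply h.
  - lra.
Qed.

Definition solves (A : R -> Op) (u : R -> H) : Prop := forall t, hderiv u t (A t (u t)).
Definition skew (A : R -> Op) : Prop := forall t x y, rin (A t x) y = - rin x (A t y).

Lemma skew_const A u w :
  skew A -> solves A u -> solves A w -> forall t, rin (u t) (w t) = rin (u 0) (w 0).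
Proof.
  intros hA hu hw. apply (const_of_deriv0 (fun t => rin (u t) (w t))). intros t.
  assert (e : rin (A t (u t)) (w t) + rin (u t) (A t (w t)) = 0) by (rewrite hA; ring).
  rewrite <- e. now apply hderiv_rin.
Qed.

(** All pairings among u and w are conserved, hence so is |u - w|^2. Complex homogeneity,
    periodicity, the shift law and time reversal of the transport are all instances of this
    uniqueness. *)
Lemma skew_unique A u w :
  skew A -> solves A u -> solves A w -> u 0 = w 0 -> forall t, u t = w t.
Proof.
  intros hA hu hw h0 t. apply hsub_eq0, rin_eq0. rewrite rin_subl, !rin_subr.
  rewrite (skew_const A u u), (skew_const A u w), (skew_const A w u), (skew_const A w w) by auto.
  rewrite h0. ring.
Qed.

(** Stated for real-linear isometries so that it covers both multiplication by i and the antiunitary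
    theta. *)
Lemma hderiv_R_linear (L : Op) u t v :
  (forall x y, L (hsub x y) = hsub (L x) (L y)) ->
  (forall r x, L (hscal (RtoC r) x) = hscal (RtoC r) (L x)) ->
  (forall x, hnorm (L x) = hnorm x) ->
  hderiv u t v -> hderiv (fun s => L (u s)) t (L v).
Proof.
  intros h1 h2 h3 hu eps he. destruct (hu eps he) as [dl [hd h]]. exists dl. split; auto.
  intros s hs1 hs2. rewrite <- h2, <- !h1, h3. now apply h.
Qed.

Lemma hderiv_neg u t v : hderiv u (- t) v -> hderiv (fun s => u (- s)) t (hopp v).
Proof.
  intros hu eps he. destruct (hu eps he) as [dl [hd h]]. exists dl. split; auto.
  intros s hs1 hs2. specialize (h (- s) ltac:(lra) ltac:(now rewrite Rabs_Ropp)).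
  rewrite Rabs_Ropp in h. replace (- (t + s)) with (- t + - s) by ring.
  replace (hscal (RtoC s) (hopp v)) with (hscal (RtoC (- s)) v); [exact h|].
  apply rin_ext. intros z. rewrite !rin_scall, rin_oppl. ring.
Qed.

Lemma hderiv_shift u t c v : hderiv u (t + c) v -> hderiv (fun s => u (s + c)) t v.
Proof.
  intros hu eps he. destruct (hu eps he) as [dl [hd h]]. exists dl. split; auto.
  intros s hs1 hs2. replace (t + s + c) with (t + c + s) by ring. now apply h.
Qed.

Lemma solves_cont A u t e :
  solves A u -> 0 < e -> exists dl, 0 < dl /\ forall s, Rabs (s - t) < dl ->
    hnorm (hsub (u s) (u t)) < e.
Proof.
  intros hu he. destruct (hderiv_lip u t _ (hu t)) as [dl [hd h]].
  set (K := hnorm (A t (u t)) + 1). assert (hK : 0 < K)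
    by (unfold K; pose proof (hnorm_ge0 (A t (u t))); lra).
  exists (Rmin dl (e / K)). split; [apply Rmin_pos; auto; now apply Rdiv_lt_0_compat|].
  intros s hs. pose proof (Rmin_l dl (e / K)). pose proof (Rmin_r dl (e / K)).
  specialize (h (s - t) ltac:(lra)). replace (t + (s - t)) with s in h by ring.
  eapply Rle_lt_trans; [apply h|]. fold K.
  assert (h2 : K * Rabs (s - t) < K * (e / K)) by (apply Rmult_lt_compat_l; lra).
  replace (K * (e / K)) with e in h2 by (field; lra). exact h2.
Qed.

(* d/dt <u,w> = <u,(B-A)w>. *)
Lemma skew_compare A B u w c e :
  skew A -> skew B -> solves A u -> solves B w -> u 0 = w 0 -> 0 <= e -> 0 <= c ->
  (forall t x, Rabs t <= c -> hnorm (hsub (A t x) (B t x)) <= e * hnorm x) ->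
  forall t, Rabs t <= c ->
  rin (hsub (u t) (w t)) (hsub (u t) (w t)) <= 2 * c * e * rin (u 0) (u 0).
Proof.
  intros hA hB hu hw h0 he hc hAB t ht.
  assert (hd : forall s, is_derive (fun s => rin (u s) (w s)) s
    (rin (hsub (A s (u s)) (B s (u s))) (w s))).
  { intros s. replace (rin (hsub (A s (u s)) (B s (u s))) (w s))
      with (rin (A s (u s)) (w s) + rin (u s) (B s (w s))).
    - now apply hderiv_rin.
    - rewrite rin_subl, (hB s (u s)). ring. }
  destruct (MVT_gen (fun s => rin (u s) (w s)) 0 t
    (fun s => rin (hsub (A s (u s)) (B s (u s))) (w s))) as [x [hx e1]].
  - intros; apply hd.
  - intros x _. apply continuity_pt_filterlim.
    apply (ex_derive_continuous (fun s => rin (u s) (w s))). eexists; apply hd.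
  - assert (hxc : Rabs x <= c).
    { revert hx ht. unfold Rmin, Rmax. destruct (Rle_dec 0 t); unfold Rabs;
        repeat destruct Rcase_abs; lra. }
    pose proof (hAB x (u x) hxc) as h1.
    pose proof (cauchy_schwarz (hsub (A x (u x)) (B x (u x))) (w x)) as h2.
    assert (nu : hnorm (u x) = hnorm (u 0)) by (apply hnorm_eq, (skew_const A); auto).
    assert (nw : hnorm (w x) = hnorm (u 0)).
    { rewrite h0. apply hnorm_eq, (skew_const B); auto. }
    rewrite nu in h1. rewrite nw in h2. pose proof (hnorm_ge0 (u 0)).
    assert (h3 : Rabs (rin (hsub (A x (u x)) (B x (u x))) (w x)) <= e * rin (u 0) (u 0)).
    { rewrite <- hnorm_sq. eapply Rle_trans; [apply h2|]. rewrite <- Rmult_assoc.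
      now apply Rmult_le_compat_r. }
    (* Both norms are conserved, so |u - w|^2 = 2 |u(0)|^2 - 2 <u(t), w(t)>, and only the drift of
       the pairing matters. *)
    rewrite rin_subl, !rin_subr, (rin_sym (w t) (u t)).
    rewrite (skew_const A u u hA hu hu), (skew_const B w w hB hw hw), <- h0 in *.
    rewrite Rminus_0_r in e1.
    assert (h4 : Rabs (rin (u t) (w t) - rin (u 0) (u 0)) <= c * (e * rin (u 0) (u 0))).
    { rewrite e1, Rabs_mult, Rmult_comm. apply Rmult_le_compat; auto using Rabs_pos. }
    apply Rabs_le_between in h4. lra.
Qed.
End RealInner.

(** * Frames *)

Definition mtrace (m : nat) (A : Mat) : Cx := Csum m (fun i => A i i).

Lemma mtrace_mul m A B : mtrace m (mmul m A B) = mtrace m (mmul m B A).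
Proof.
  unfold mtrace, mmul. rewrite Csum_swap. apply Csum_ext; intros; apply Csum_ext; intros; ring.
Qed.
Lemma mtrace_meq m A B : meq m A B -> mtrace m A = mtrace m B.
Proof. intros h. apply Csum_ext; intros; now apply h. Qed.
Lemma mtrace_sub m A B : mtrace m (msub A B) = Csub (mtrace m A) (mtrace m B).
Proof.
  unfold mtrace, msub. induction m; simpl; [ring|]. rewrite IHm. ring.
Qed.
Lemma mtrace_adj_mul_eq0 m M : mtrace m (mmul m (madj M) M) = C0 -> meq m M (fun _ _ => C0).
Proof.
  intros h i j hi hj. apply (f_equal cre) in h. unfold mtrace in h. rewrite Csum_cre in h.
  rewrite (rsum_ext m _ (fun j => rsum m (fun i => cre (M i j) ^ 2 + cim (M i j) ^ 2))) in h.
  2:{ intros l _. unfold mmul, madj. rewrite Csum_cre. apply rsum_ext; intros; simpl; ring. }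
  assert (h0 : forall l, (l < m)%nat -> 0 <= rsum m (fun i => cre (M i l) ^ 2 + cim (M i l) ^ 2)).
  { intros; apply rsum_ge0; intros; nra. }
  pose proof (rsum_term m _ j h0 hj) as h1. simpl in h. rewrite <- h in *.
  pose proof (rsum_term m (fun i => cre (M i j) ^ 2 + cim (M i j) ^ 2) i
    ltac:(intros; nra) hi) as h2. simpl in *.
  apply Cx_eq; simpl; nra.
Qed.

(* The defect M = 1 - U U* is a projection of trace 0. *)
Lemma left_unitary m U : meq m (mmul m (madj U) U) Imat -> is_unitary m U.
Proof.
  intros h. apply unitary_iff. split; auto.
  set (M := msub Imat (mmul m U (madj U))).
  assert (hM : meq m (mmul m (madj M) M) M).
  { unfold M. rewrite madj_sub, madj_1, madj_mul, madj_adj, mmul_sub_l, !mmul_sub_r.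
    rewrite !mmul_1_l, mmul_1_r, mmul_assoc, (mmul_cancel m (madj U) U) by auto.
    intros i j _ _. unfold msub. ring. }
  assert (h0 : meq m M (fun _ _ => C0)).
  { apply mtrace_adj_mul_eq0. rewrite (mtrace_meq m _ _ hM). unfold M.
    rewrite mtrace_sub, mtrace_mul, (mtrace_meq m _ _ h). ring. }
  intros i j hi hj. specialize (h0 i j hi hj). unfold M, msub in h0.
  replace (mmul m U (madj U) i j) with (Csub (Imat i j) (Csub (Imat i j) (mmul m U (madj U) i j)))
    by ring. rewrite h0. ring.
Qed.

Section Frames.
Context {H : HilbertSpace}.
Implicit Types v w e : nat -> H.

Definition gram v w : Mat := fun a c => hinner (v a) (w c).
(** Right action of matrices on tuples of vectors: column c of M holds the coordinates of the new
    c-th vector. Statements about frames thereby become identities of Gram matrices. *)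
Definition fmul (m : nat) v (M : Mat) : nat -> H := fun c => hsum m (fun a => hscal (M a c) (v a)).

Lemma hinner_0r (x : H) : hinner x hzero = C0.
Proof.
  assert (h : hinner x (hadd hzero hzero) = hinner x hzero) by now rewrite hadd_0.
  rewrite hinner_add in h.
  replace (hinner x hzero) with (Csub (Cadd (hinner x hzero) (hinner x hzero)) (hinner x hzero)) at 1 by ring.
  rewrite h. ring.
Qed.
Lemma hinner_sumr (x : H) m f : hinner x (hsum m f) = Csum m (fun a => hinner x (f a)).
Proof. induction m; simpl; [apply hinner_0r|]. now rewrite hinner_add, IHm. Qed.
Lemma hinner_ext (x y : H) : (forall z, hinner z x = hinner z y) -> x = y.
Proof. intros h. apply rin_ext. intros z. rewrite !(rin_sym _ z). unfold rin. now rewrite h. Qed.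
Lemma hinner_fmul m v M c z :
  hinner z (fmul m v M c) = Csum m (fun a => Cmul (M a c) (hinner z (v a))).
Proof. unfold fmul. rewrite hinner_sumr. apply Csum_ext; intros; now rewrite hinner_scal. Qed.

Lemma fmul_meq m v M N c : meq m M N -> (c < m)%nat -> fmul m v M c = fmul m v N c.
Proof.
  intros h hc. apply hinner_ext. intros z. rewrite !hinner_fmul.
  apply Csum_ext; intros; now rewrite h.
Qed.
Lemma fmul_ext m v w M c : (forall a, (a < m)%nat -> v a = w a) -> fmul m v M c = fmul m w M c.
Proof.
  intros h. apply hinner_ext. intros z. rewrite !hinner_fmul.
  apply Csum_ext; intros; now rewrite h.
Qed.
Lemma fmul_1 m v c : (c < m)%nat -> fmul m v Imat c = v c.
Proof.
  intros hc. apply hinner_ext. intros z. rewrite hinner_fmul, (Csum_single m _ c hc).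
  - unfold Imat. destruct (Nat.eq_dec c c); [ring|congruence].
  - intros j hj hne. unfold Imat. destruct (Nat.eq_dec j c); [congruence|ring].
Qed.
Lemma fmul_fmul m v M N c : fmul m (fmul m v M) N c = fmul m v (mmul m M N) c.
Proof.
  apply hinner_ext. intros z. rewrite !hinner_fmul.
  rewrite (Csum_ext m _ (fun a => Csum m (fun k => Cmul (N a c) (Cmul (M k a) (hinner z (v k)))))).
  2:{ intros. now rewrite hinner_fmul, Csum_mul_l. }
  rewrite Csum_swap. apply Csum_ext; intros a _. unfold mmul.
  rewrite <- Csum_mul_r. apply Csum_ext; intros; ring.
Qed.
Lemma gram_fmul_r m v w N : meq m (gram v (fmul m w N)) (mmul m (gram v w) N).
Proof.
  intros i j _ _. unfold gram at 1. rewrite hinner_fmul. apply Csum_ext; intros.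
  unfold gram. ring.
Qed.
Lemma gram_adj m v w : meq m (madj (gram v w)) (gram w v).
Proof. intros i j _ _. unfold madj, gram. now rewrite <- hinner_sym. Qed.
Lemma gram_fmul_l m v w M : meq m (gram (fmul m v M) w) (mmul m (madj M) (gram v w)).
Proof. now rewrite <- gram_adj, gram_fmul_r, madj_mul, gram_adj. Qed.
Lemma gram_ext m v v' w w' :
  (forall a, (a < m)%nat -> v a = v' a) -> (forall a, (a < m)%nat -> w a = w' a) ->
  meq m (gram v w) (gram v' w').
Proof. intros h1 h2 i j hi hj. unfold gram. now rewrite h1, h2. Qed.

Lemma onb_gram P m v : is_onb_ran P m v -> meq m (gram v v) Imat.
Proof. intros [h _] i j hi hj. now apply h. Qed.
Lemma onb_expand P m v w :
  is_onb_ran P m v -> (forall a, (a < m)%nat -> P (w a) = w a) ->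
  forall a, (a < m)%nat -> w a = fmul m v (gram v w) a.
Proof. intros [_ [_ h]] hw a ha. apply h. now apply hw. Qed.
(** Expanding w in v gives 1 = [gram w w] = (gram v w)* (gram v w), and for square matrices a left
    inverse suffices. *)
Lemma gram_unitary P m v w : is_onb_ran P m v -> is_onb_ran P m w -> is_unitary m (gram v w).
Proof.
  intros hv hw. apply left_unitary. rewrite gram_adj, <- gram_fmul_r.
  rewrite (gram_ext m w w (fmul m v (gram v w)) w); [now apply (onb_gram P)|auto|].
  intros a ha. symmetry. apply (onb_expand P); auto. apply hw.
Qed.

(** A dimension count: the coordinates of e in some basis f form a square isometric matrix, which is
    therefore unitary, so f can be expanded in e and e spans the range. *)
Lemma orthonormal_onb P m e :
  has_rank P m -> meq m (gram e e) Imat -> (forall a, (a < m)%nat -> P (e a) = e a) ->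
  is_onb_ran P m e.
Proof.
  intros [f hf] he hP.
  assert (hU : is_unitary m (gram f e)).
  { apply left_unitary. rewrite gram_adj, <- gram_fmul_r.
    rewrite (gram_ext m e e (fmul m f (gram f e)) e); auto.
    intros a ha. symmetry. now apply (onb_expand P). }
  apply unitary_iff in hU. destruct hU as [_ hU].
  split; [intros a c ha hc; now apply he|]. split; auto. intros x hx.
  destruct hf as [hf1 [hf2 hf3]]. apply hinner_ext. intros z.
  rewrite (hf3 x hx) at 1. rewrite !hinner_sumr.
  assert (hfe : forall c, (c < m)%nat -> f c = fmul m e (madj (gram f e)) c).
  { intros c hc. rewrite <- (fmul_1 m f c hc), <- (fmul_meq m f _ _ c hU hc), <- fmul_fmul.
    apply fmul_ext. intros a ha. symmetry. apply (onb_expand P); auto. now repeat split. }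
  (* f is replaced by its expansion in e only inside the coefficients <f_c, x>; after exchanging the
     sums, the remaining vectors f_c recombine to e_a. *)
  rewrite (Csum_ext m _ (fun c => Csum m (fun a =>
     Cmul (hinner (e a) x) (Cmul (gram f e c a) (hinner z (f c)))))).
  2:{ intros c hc. rewrite hinner_scal. rewrite (hfe c hc) at 1.
      rewrite (hinner_sym _ x), hinner_fmul, Csum_conj, <- Csum_mul_r.
      apply Csum_ext; intros a _. unfold madj. rewrite Cconj_mul, Cconj_conj, <- hinner_sym. ring. }
  rewrite Csum_swap. apply Csum_ext; intros a ha. rewrite Csum_mul_l, hinner_scal. f_equal.
  rewrite <- hinner_fmul. f_equal. symmetry. apply (onb_expand P); auto. now repeat split.
Qed.

Lemma proj_fmul (P : @Op H) m v M c :
  is_orth_proj P -> (forall a, (a < m)%nat -> P (v a) = v a) -> P (fmul m v M c) = fmul m v M c.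
Proof.
  intros [_ [_ hs]] h. apply hinner_ext. intros z. rewrite <- hs, !hinner_fmul.
  apply Csum_ext; intros. now rewrite hs, h.
Qed.

Lemma fmul_onb (P : @Op H) m v M :
  is_orth_proj P -> is_onb_ran P m v -> is_unitary m M -> is_onb_ran P m (fmul m v M).
Proof.
  intros hP hv hM. apply unitary_iff in hM. apply orthonormal_onb.
  - now exists v.
  - rewrite gram_fmul_r, gram_fmul_l, (onb_gram P m v hv), mmul_1_r. apply hM.
  - intros a _. apply proj_fmul; auto. apply hv.
Qed.

Lemma hscal_0 (x : H) : hscal C0 x = hzero.
Proof. apply rin_eq0. unfold rin. rewrite hinner_scal. simpl. ring. Qed.

Lemma map_fmul (L : @Op H) m v M c :
  (forall x y, L (hadd x y) = hadd (L x) (L y)) -> (forall a x, L (hscal a x) = hscal a (L x)) ->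
  L (fmul m v M c) = fmul m (fun a => L (v a)) M c.
Proof.
  intros h1 h2. unfold fmul. induction m; simpl.
  - now rewrite <- (hscal_0 hzero), h2, !hscal_0.
  - now rewrite h1, h2, IHm.
Qed.
Lemma antimap_fmul (L : @Op H) m v M c :
  (forall x y, L (hadd x y) = hadd (L x) (L y)) ->
  (forall a x, L (hscal a x) = hscal (Cconj a) (L x)) ->
  L (fmul m v M c) = fmul m (fun a => L (v a)) (mconj M) c.
Proof.
  intros h1 h2. unfold fmul. induction m; simpl.
  - rewrite <- (hscal_0 hzero), h2.
    replace (Cconj C0) with C0 by (apply Cx_eq; simpl; ring). now rewrite !hscal_0.
  - now rewrite h1, h2, IHm.
Qed.

(** * Continuity of vector-valued maps *)

Context {U : UniformSpace}.
Definition hcont (F : U -> H) (p : U) : Prop :=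
  forall eps, 0 < eps -> locally p (fun q => hnorm (hsub (F q) (F p)) < eps).

Lemma hnorm_scal a (x : H) : hnorm (hscal a x) <= cabs a * hnorm x.
Proof.
  rewrite hscal_split. eapply Rle_trans; [apply hnorm_add|]. rewrite !hnorm_scalR.
  rewrite (hnorm_eq (hscal Ci x) x) by apply rin_ii. unfold cabs. lra.
Qed.
Lemma hinner_bound (x y : H) : cabs (hinner x y) <= 2 * (hnorm x * hnorm y).
Proof.
  rewrite hinner_rin. unfold cabs; simpl. pose proof (cauchy_schwarz x y).
  pose proof (cauchy_schwarz (hscal Ci x) y) as h.
  rewrite (hnorm_eq (hscal Ci x) x) in h by apply rin_ii. lra.
Qed.

Lemma hcont_const x p : hcont (fun _ => x) p.
Proof.
  intros eps he. apply filter_forall. intros _.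
  replace (hsub x x) with (@hzero H); [now rewrite hnorm_zero|].
  apply rin_ext. intros z. rewrite rin_subl, rin_zerol. ring.
Qed.
Lemma hcont_add F G p : hcont F p -> hcont G p -> hcont (fun q => hadd (F q) (G q)) p.
Proof.
  intros hF hG eps he. assert (he2 : 0 < eps / 2) by lra.
  generalize (filter_and _ _ (hF _ he2) (hG _ he2)).
  apply filter_imp. intros q [h1 h2].
  replace (hsub (hadd (F q) (G q)) (hadd (F p) (G p)))
    with (hadd (hsub (F q) (F p)) (hsub (G q) (G p))).
  - eapply Rle_lt_trans; [apply hnorm_add|]. lra.
  - apply rin_ext. intros z. rewrite !rin_addl, !rin_subl, !rin_addl. ring.
Qed.
Lemma hcont_scal c F p : ccont c p -> hcont F p -> hcont (fun q => hscal (c q) (F q)) p.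
Proof.
  intros hc hF eps he. rewrite ccont_iff in hc.
  pose proof (cabs_ge0 (c p)) as h0. pose proof (hnorm_ge0 (F p)) as h0'.
  set (K := cabs (c p) + 1 + hnorm (F p)).
  assert (hK : 0 < K) by (unfold K; lra).
  (* The cap 1 bounds |c q| by |c p| + 1, which makes the total error at most r K. *)
  set (r := Rmin 1 (eps / (2 * K))).
  assert (hr : 0 < r) by (apply Rmin_pos; [lra|apply Rdiv_lt_0_compat; lra]).
  assert (hrK : r * K <= eps / 2).
  { apply Rle_trans with (eps / (2 * K) * K); [apply Rmult_le_compat_r; [lra|apply Rmin_r]|].
    right. field. lra. }
  assert (hr1 : r <= 1) by apply Rmin_l.
  generalize (filter_and _ _ (hc r hr) (hF r hr)). apply filter_imp. intros q [h1 h2].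
  replace (hsub (hscal (c q) (F q)) (hscal (c p) (F p)))
    with (hadd (hscal (c q) (hsub (F q) (F p))) (hscal (Csub (c q) (c p)) (F p))).
  - eapply Rle_lt_trans; [apply hnorm_add|].
    pose proof (hnorm_scal (c q) (hsub (F q) (F p))).
    pose proof (hnorm_scal (Csub (c q) (c p)) (F p)).
    pose proof (cabs_add (Csub (c q) (c p)) (c p)) as h3.
    replace (Cadd (Csub (c q) (c p)) (c p)) with (c q) in h3 by ring.
    assert (cabs (c q) * hnorm (hsub (F q) (F p)) <= (cabs (c p) + 1) * r).
    { apply Rmult_le_compat; auto using cabs_ge0, hnorm_ge0; lra. }
    assert (cabs (Csub (c q) (c p)) * hnorm (F p) <= r * hnorm (F p))
      by (apply Rmult_le_compat_r; lra).
    unfold K in hrK. nra.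
  - apply hinner_ext. intros z. unfold hsub.
    rewrite !hinner_add, !hinner_scal, !hinner_add.
    assert (ho : forall x, hinner z (hopp x) = Copp (hinner z x)).
    { intros x. rewrite !hinner_rin, rin_oppr, rin_oppr. reflexivity. }
    rewrite !ho, hinner_scal. ring.
Qed.
Lemma hcont_fmul m (v : U -> nat -> H) M p c :
  (forall a, (a < m)%nat -> hcont (fun q => v q a) p) -> mcont m M p -> (c < m)%nat ->
  hcont (fun q => fmul m (v q) (M q) c) p.
Proof.
  intros hv hM hc. unfold fmul.
  assert (h : forall n, (n <= m)%nat ->
    hcont (fun q => hsum n (fun a => hscal (M q a c) (v q a))) p).
  { induction n; intros hn; simpl; [apply hcont_const|].
    apply hcont_add; [apply IHn; lia|].
    apply (hcont_scal (fun q => M q n c) (fun q => v q n)); auto. }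
  now apply h.
Qed.
Lemma ccont_hinner F G p : hcont F p -> hcont G p -> ccont (fun q => hinner (F q) (G q)) p.
Proof.
  intros hF hG. apply ccont_iff. intros eps he.
  pose proof (hnorm_ge0 (F p)) as h0. pose proof (hnorm_ge0 (G p)) as h0'.
  set (K := hnorm (G p) + 1 + hnorm (F p)).
  assert (hK : 0 < K) by (unfold K; lra).
  (* 4 K because [hinner_bound] loses a factor 2. *)
  set (r := Rmin 1 (eps / (4 * K))).
  assert (hr : 0 < r) by (apply Rmin_pos; [lra|apply Rdiv_lt_0_compat; lra]).
  assert (hrK : r * K <= eps / 4).
  { apply Rle_trans with (eps / (4 * K) * K); [apply Rmult_le_compat_r; [lra|apply Rmin_r]|].
    right. field. lra. }
  assert (hr1 : r <= 1) by apply Rmin_l.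
  generalize (filter_and _ _ (hF r hr) (hG r hr)). apply filter_imp. intros q [h1 h2].
  replace (Csub (hinner (F q) (G q)) (hinner (F p) (G p)))
    with (Cadd (hinner (hsub (F q) (F p)) (G q)) (hinner (F p) (hsub (G q) (G p)))).
  2:{ rewrite !hinner_rin. apply Cx_eq; simpl.
      - rewrite !rin_subl, !rin_subr. ring.
      - rewrite rin_subr, !rin_i_swap, rin_subl. ring. }
  eapply Rle_lt_trans; [apply cabs_add|].
  pose proof (hinner_bound (hsub (F q) (F p)) (G q)).
  pose proof (hinner_bound (F p) (hsub (G q) (G p))).
  assert (hg : hnorm (G q) <= hnorm (G p) + 1).
  { replace (G q) with (hadd (hsub (G q) (G p)) (G p)).
    - eapply Rle_trans; [apply hnorm_add|]. lra.
    - apply rin_ext. intros z. rewrite rin_addl, rin_subl. ring. }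
  assert (hnorm (hsub (F q) (F p)) * hnorm (G q) <= r * (hnorm (G p) + 1)).
  { apply Rmult_le_compat; auto using hnorm_ge0; lra. }
  assert (hnorm (F p) * hnorm (hsub (G q) (G p)) <= hnorm (F p) * r)
    by (apply Rmult_le_compat_l; lra).
  unfold K in hrK. nra.
Qed.
Lemma mcont_gram m (v w : U -> nat -> H) p :
  (forall a, (a < m)%nat -> hcont (fun q => v q a) p) ->
  (forall a, (a < m)%nat -> hcont (fun q => w q a) p) ->
  mcont m (fun q => gram (v q) (w q)) p.
Proof. intros hv hw i j hi hj. apply (ccont_hinner (fun q => v q i) (fun q => w q j)); auto. Qed.
End Frames.

(** * Parallel transport *)

Section OperatorDerivatives.
Context {H : HilbertSpace}.

Lemma hderiv_unique (u : R -> H) t v v' : hderiv u t v -> hderiv u t v' -> v = v'.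
Proof.
  intros h h'. apply rin_ext. intros z.
  assert (e : forall v, hderiv u t v -> is_derive (fun s => rin (u s) z) t (rin v z)).
  { intros w hw. rewrite <- (Rplus_0_r (rin w z)), <- (rin_zeror (u t)).
    apply (hderiv_rin u (fun _ => z)); auto. apply hderiv_const. }
  apply e in h, h'. apply is_derive_unique in h, h'. congruence.
Qed.

Lemma hderiv_ext (u w : R -> H) t v : (forall s, u s = w s) -> hderiv u t v -> hderiv w t v.
Proof.
  intros e h eps he. destruct (h eps he) as [dl [hd h1]]. exists dl. split; auto.
  intros s hs1 hs2. rewrite <- !e. auto.
Qed.

Lemma hderiv_app (F : R -> Op) (G : Op) (u : R -> H) t v :
  (forall s x y, F s (hsub x y) = hsub (F s x) (F s y)) ->
  (forall s r x, F s (hscal (RtoC r) x) = hscal (RtoC r) (F s x)) ->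
  (forall s x, hnorm (F s x) <= hnorm x) ->
  is_opderiv F t G -> hderiv u t v ->
  hderiv (fun s => F s (u s)) t (hadd (G (u t)) (F t v)).
Proof.
  intros hsb hsc hn hF hu eps he.
  destruct (hderiv_step u t v (eps / 3) ltac:(lra) hu) as [d1 [hd1 h1]].
  destruct (hderiv_step _ t _ (eps / 3) ltac:(lra) (hderiv_opderiv F t G (u t) hF)) as [d2 [hd2 h2]].
  destruct (hderiv_lip _ t _ (hderiv_opderiv F t G v hF)) as [d3 [hd3 h3]].
  set (K := hnorm (G v) + 1) in *.
  assert (hK : 0 < K) by (unfold K; pose proof (hnorm_ge0 (G v)); lra).
  assert (hd4 : 0 < eps / (3 * K)) by (apply Rdiv_lt_0_compat; lra).
  exists (Rmin (Rmin d1 d2) (Rmin d3 (eps / (3 * K)))). split; [repeat apply Rmin_pos; auto|].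
  intros h hn0 hh.
  assert (hh' : Rabs h < d1 /\ Rabs h < d2 /\ Rabs h < d3 /\ Rabs h < eps / (3 * K)).
  { revert hh. unfold Rmin. repeat destruct Rle_dec; lra. }
  destruct hh' as (g1 & g2 & g3 & g4).
  specialize (h1 h g1). specialize (h2 h g2). specialize (h3 h g3).
  set (r1 := hsub (hsub (u (t + h)) (u t)) (hscal (RtoC h) v)) in *.
  set (r2 := hsub (hsub (F (t + h) (u t)) (F t (u t))) (hscal (RtoC h) (G (u t)))) in *.
  set (r3 := hsub (F (t + h) v) (F t v)) in *.
  (* Three errors: the remainder of u pushed through the contraction F(t+h), the remainder of F at
     the fixed vector u(t), and the variation of F on v, which carries an extra factor h. *)
  replace (hsub (hsub (F (t + h) (u (t + h))) (F t (u t)))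
            (hscal (RtoC h) (hadd (G (u t)) (F t v))))
    with (hadd (hadd (F (t + h) r1) r2) (hscal (RtoC h) r3)).
  2:{ apply rin_ext. intros z. unfold r1, r2, r3. rewrite !hsb, hsc.
      rewrite !rin_addl, !rin_subl, !rin_scall, !rin_addl, !rin_subl. ring. }
  eapply Rle_trans; [apply hnorm_add|]. rewrite hnorm_scalR.
  pose proof (hnorm_add (F (t + h) r1) r2). pose proof (hn (t + h) r1).
  pose proof (Rabs_pos h). pose proof (hnorm_ge0 r3).
  assert (hb : K * Rabs h <= eps / 3).
  { apply Rle_trans with (K * (eps / (3 * K))); [apply Rmult_le_compat_l; lra|].
    right. field. lra. }
  assert (Rabs h * hnorm r3 <= Rabs h * (eps / 3)) by (apply Rmult_le_compat_l; lra).
  lra.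
Qed.
End OperatorDerivatives.

Section Transport.
Context {d : nat} {H : HilbertSpace} (P G : R -> Rvec d -> @Op H) (T : Rvec d -> R -> @Op H).
Hypothesis HP : forall t k, is_orth_proj (P t k).
Hypothesis HG : forall t k, is_opderiv (fun s => P s k) t (G t k).
Hypothesis HPper : forall t k (n1 : Z) (n : Idx d -> Z), P (t + IZR n1) (vshift k n) = P t k.
Hypothesis HT0 : forall k x, T k 0 x = x.
(** The commutator [P', P], Kato's generator of adiabatic transport; it is skew because P and P' are
    symmetric. *)
Definition gen (k : Rvec d) (t : R) : Op := comm (G t k) (P t k).
Hypothesis HTs : forall k x, solves (gen k) (fun t => T k t x).

Lemma P_idem t k x : P t k (P t k x) = P t k x.
Proof. apply HP. Qed.
Lemma P_hsym t k x y : hinner (P t k x) y = hinner x (P t k y).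
Proof. apply HP. Qed.
Lemma P_sym t k x y : rin (P t k x) y = rin x (P t k y).
Proof. unfold rin. now rewrite P_hsym. Qed.
Lemma P_scal t k a x : P t k (hscal a x) = hscal a (P t k x).
Proof. apply HP. Qed.
Lemma P_sub t k x y : P t k (hsub x y) = hsub (P t k x) (P t k y).
Proof. apply rin_ext. intros z. now rewrite P_sym, !rin_subl, !P_sym. Qed.
Lemma P_norm t k x : hnorm (P t k x) <= hnorm x.
Proof.
  apply hnorm_le_sq; [apply hnorm_ge0|]. rewrite hnorm_sq.
  assert (e : rin (P t k x) (P t k x) = rin x (P t k x)) by now rewrite P_sym, P_idem.
  pose proof (rin_ge0 (hsub x (P t k x))) as h. rewrite !rin_subl, !rin_subr in h.
  rewrite (rin_sym (P t k x) x) in h. lra.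
Qed.

Lemma G_hderiv t k x : hderiv (fun s => P s k x) t (G t k x).
Proof. now apply (hderiv_opderiv (fun s => P s k)). Qed.
Lemma G_rin t k x y : is_derive (fun s => rin (P s k x) y) t (rin (G t k x) y).
Proof.
  rewrite <- (Rplus_0_r (rin (G t k x) y)), <- (rin_zeror (P t k x)).
  apply (hderiv_rin (fun s => P s k x) (fun _ => y)); [apply G_hderiv|apply hderiv_const].
Qed.
(** The identity holds for P and passes to the derivative by uniqueness of derivatives; [G_i] and
    [G_product] are obtained in the same way. *)
Lemma G_sym t k x y : rin (G t k x) y = rin x (G t k y).
Proof.
  pose proof (G_rin t k x y) as h1. pose proof (G_rin t k y x) as h2.
  apply (is_derive_ext _ (fun s => rin (P s k x) y)) in h2.
  - apply is_derive_unique in h1, h2. rewrite (rin_sym x). congruence.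
  - intros s. now rewrite P_sym, rin_sym.
Qed.
Lemma G_sub t k x y : G t k (hsub x y) = hsub (G t k x) (G t k y).
Proof. apply rin_ext. intros z. now rewrite G_sym, !rin_subl, !G_sym. Qed.
Lemma G_i t k x : G t k (hscal Ci x) = hscal Ci (G t k x).
Proof.
  apply rin_ext. intros z.
  pose proof (G_rin t k (hscal Ci x) z) as h1. pose proof (G_rin t k x (hscal (Copp Ci) z)) as h2.
  assert (e : forall y, rin y (hscal (Copp Ci) z) = rin (hscal Ci y) z).
  { intros y. unfold rin. rewrite hinner_scal, hinner_scall. simpl. ring. }
  rewrite e in h2.
  apply (is_derive_ext _ (fun s => rin (P s k (hscal Ci x)) z)) in h2.
  - apply is_derive_unique in h1, h2. congruence.
  - intros s. now rewrite e, P_scal.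
Qed.
Lemma G_product t k x y : rin (G t k x) y = rin (G t k x) (P t k y) + rin (P t k x) (G t k y).
Proof.
  pose proof (G_rin t k x y) as h1.
  pose proof (hderiv_rin _ _ t _ _ (G_hderiv t k x) (G_hderiv t k y)) as h2.
  apply (is_derive_ext _ (fun s => rin (P s k x) y)) in h2.
  - apply is_derive_unique in h1, h2. congruence.
  - intros s. now rewrite P_sym, P_idem, P_sym.
Qed.

Lemma gen_rin k t x y :
  rin (gen k t x) y = rin (P t k x) (G t k y) - rin (G t k x) (P t k y).
Proof. unfold gen, comm, opsub, opcomp. now rewrite rin_subl, P_sym, G_sym. Qed.
Lemma gen_skew k : skew (gen k).
Proof.
  intros t x y. rewrite (rin_sym x), !gen_rin.
  rewrite (rin_sym (P t k y)), (rin_sym (G t k y)). ring.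
Qed.
Lemma gen_i k t x : gen k t (hscal Ci x) = hscal Ci (gen k t x).
Proof.
  unfold gen, comm, opsub, opcomp. rewrite P_scal, !G_i, P_scal.
  apply rin_ext. intros z. rewrite rin_i_swap, !rin_subl, !rin_i_swap. ring.
Qed.

Lemma T_rin k t x y : rin (T k t x) (T k t y) = rin x y.
Proof.
  rewrite (skew_const (gen k) (fun s => T k s x) (fun s => T k s y));
    rewrite ?HT0; auto using gen_skew.
Qed.
Lemma T_norm k t x : hnorm (T k t x) = hnorm x.
Proof. apply hnorm_eq, T_rin. Qed.
(* A map preserving the real inner product is additive. *)
Lemma T_add k t x y : T k t (hadd x y) = hadd (T k t x) (T k t y).
Proof.
  apply hsub_eq0, rin_eq0.
  rewrite !rin_subl, !rin_subr, !rin_addl, !rin_addr, !T_rin, !rin_addl, !rin_addr. ring.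
Qed.
Lemma T_scalR k t r x : T k t (hscal (RtoC r) x) = hscal (RtoC r) (T k t x).
Proof.
  apply hsub_eq0, rin_eq0.
  rewrite !rin_subl, !rin_subr, !rin_scall, !rin_scalr, !T_rin, !rin_scall, !rin_scalr. ring.
Qed.
Lemma i_isometry_hderiv (u : R -> H) t v :
  hderiv u t v -> hderiv (fun s => hscal Ci (u s)) t (hscal Ci v).
Proof.
  apply (hderiv_R_linear (hscal Ci)).
  - intros x y. apply rin_ext. intros z. rewrite rin_i_swap, !rin_subl, !rin_i_swap. ring.
  - intros r x. rewrite !hscal_assoc. f_equal. apply Cx_eq; simpl; ring.
  - intros x. apply hnorm_eq, rin_ii.
Qed.
Lemma T_i k t x : T k t (hscal Ci x) = hscal Ci (T k t x).
Proof.
  apply (skew_unique (gen k) (fun s => T k s (hscal Ci x)) (fun s => hscal Ci (T k s x))).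
  - apply gen_skew.
  - apply HTs.
  - intros s. rewrite gen_i. apply i_isometry_hderiv, HTs.
  - now rewrite !HT0.
Qed.
Lemma T_scal k t a x : T k t (hscal a x) = hscal a (T k t x).
Proof. now rewrite hscal_split, T_add, !T_scalR, T_i, <- hscal_split. Qed.
Lemma T_sub k t x y : T k t (hsub x y) = hsub (T k t x) (T k t y).
Proof.
  apply hsub_eq0, rin_eq0.
  rewrite !rin_subl, !rin_subr, !T_rin, !rin_subl, !rin_subr. ring.
Qed.
Lemma T_hinner k t x y : hinner (T k t x) (T k t y) = hinner x y.
Proof. now rewrite !hinner_rin, <- T_i, !T_rin. Qed.

(* The time derivative of <P T x, T x> vanishes since P' = P'P + PP', hence PP'P = 0. *)
Lemma T_P_const k t x : rin (P t k (T k t x)) (T k t x) = rin (P 0 k x) x.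
Proof.
  rewrite (const_of_deriv0 (fun s => rin (P s k (T k s x)) (T k s x))); [now rewrite !HT0|].
  intros s. set (u := T k s x).
  assert (e : rin (hadd (G s k u) (P s k (gen k s u))) u + rin (P s k u) (gen k s u) = 0).
  { rewrite rin_addl, P_sym, (rin_sym (P s k u)), !gen_rin, !P_idem.
    pose proof (G_product s k u u) as e1. pose proof (G_product s k (P s k u) (P s k u)) as e2.
    rewrite !P_idem, (rin_sym (P s k u) (G s k (P s k u))) in e2.
    rewrite (rin_sym (P s k u) (G s k u)) in e1.
    rewrite (rin_sym (P s k u) (G s k (P s k u))). lra. }
  rewrite <- e. apply (hderiv_rin (fun s => P s k (T k s x)) (fun s => T k s x)); [|apply HTs].
  apply (hderiv_app (fun s => P s k)).
  - intros; apply P_sub.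
  - intros; apply P_scal.
  - intros; apply P_norm.
  - apply HG.
  - apply HTs.
Qed.
(** Pythagoras: |(1 - P) T x|^2 = |T x|^2 - <P T x, T x>, and both terms keep their values at time
    0, where they cancel. *)
Lemma T_ran k t x : P 0 k x = x -> P t k (T k t x) = T k t x.
Proof.
  intros hx. apply hsub_eq0, rin_eq0. rewrite !rin_subl, !rin_subr.
  rewrite (rin_sym (T k t x) (P t k (T k t x))), (P_sym t k _ (P t k _)), P_idem.
  rewrite (rin_sym (T k t x) (P t k _)), T_P_const, T_rin, hx. ring.
Qed.

Lemma vshift_0 (k : Rvec d) : vshift k (fun _ => 0%Z) = k.
Proof. apply functional_extensionality. intros i. unfold vshift. simpl. ring. Qed.
Lemma G_periodic t k (n1 : Z) n x : G (t + IZR n1) (vshift k n) x = G t k x.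
Proof.
  apply (hderiv_unique (fun s => P s k x) t); [|apply G_hderiv].
  apply (hderiv_ext (fun s => P (s + IZR n1) (vshift k n) x)); [intros; now rewrite HPper|].
  apply (hderiv_shift (fun s => P s (vshift k n) x)), G_hderiv.
Qed.
Lemma gen_periodic t k (n1 : Z) n x : gen (vshift k n) (t + IZR n1) x = gen k t x.
Proof. unfold gen, comm, opsub, opcomp. now rewrite HPper, !G_periodic. Qed.
Lemma T_periodic k n t x : T (vshift k n) t x = T k t x.
Proof.
  apply (skew_unique (gen k) (fun s => T (vshift k n) s x) (fun s => T k s x)).
  - apply gen_skew.
  - intros s. rewrite <- (gen_periodic s k 0 n), Rplus_0_r. apply HTs.
  - apply HTs.
  - now rewrite !HT0.
Qed.
Lemma T_shift k t x : T k (t + 1) x = T k t (T k 1 x).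
Proof.
  apply (skew_unique (gen k) (fun s => T k (s + 1) x) (fun s => T k s (T k 1 x))).
  - apply gen_skew.
  - intros s. apply (hderiv_shift (fun s => T k s x)).
    rewrite <- (gen_periodic s k 1 (fun _ => 0%Z)), vshift_0. apply HTs.
  - apply HTs.
  - now rewrite Rplus_0_l, HT0.
Qed.

(** * Time reversal of the transport *)

Section TimeReversal.
Variable th : @Op H.
Hypothesis Hth : is_antiunitary th.
Hypothesis HPtrs : trs_family th P.

Lemma th_scal a x : th (hscal a x) = hscal (Cconj a) (th x).
Proof. apply Hth. Qed.
Lemma th_hinner x y : hinner (th x) (th y) = Cconj (hinner x y).
Proof. apply Hth. Qed.
Lemma th_rin x y : rin (th x) (th y) = rin x y.
Proof. unfold rin. now rewrite th_hinner. Qed.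
Lemma th_sub x y : th (hsub x y) = hsub (th x) (th y).
Proof.
  apply hsub_eq0, rin_eq0. rewrite !rin_subl, !rin_subr, !th_rin, !rin_subl, !rin_subr. ring.
Qed.
Lemma th_scalR r x : th (hscal (RtoC r) x) = hscal (RtoC r) (th x).
Proof. rewrite th_scal. f_equal. apply Cx_eq; simpl; ring. Qed.
Lemma th_hderiv (u : R -> H) t v : hderiv u t v -> hderiv (fun s => th (u s)) t (th v).
Proof.
  apply (hderiv_R_linear th); auto using th_sub, th_scalR. intros. apply hnorm_eq, th_rin.
Qed.
Lemma th_opp x : th (hopp x) = hopp (th x).
Proof.
  apply hsub_eq0, rin_eq0.
  rewrite !rin_subl, !rin_subr, !rin_oppl, !rin_oppr, !th_rin, !rin_oppl, !rin_oppr. ring.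
Qed.

Lemma P_th t k x : P t (vneg k) (th x) = th (P (- t) k x).
Proof. now rewrite HPtrs, Ropp_involutive. Qed.
(** The sign comes from differentiating P at -s. It persists in [gen_th], where it matches the sign
    produced by differentiating T(-s) in [T_th]. *)
Lemma G_th t k x : G t (vneg k) (th x) = hopp (th (G (- t) k x)).
Proof.
  apply (hderiv_unique (fun s => P s (vneg k) (th x)) t); [apply G_hderiv|].
  apply (hderiv_ext (fun s => th (P (- s) k x))); [intros; now rewrite P_th|].
  rewrite <- th_opp. apply th_hderiv, (hderiv_neg (fun s => P s k x)), G_hderiv.
Qed.
Lemma gen_th t k x : gen (vneg k) t (th x) = hopp (th (gen k (- t) x)).
Proof.
  unfold gen, comm, opsub, opcomp. rewrite P_th, !G_th, <- !th_opp, P_th, <- th_sub.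
  f_equal. apply rin_ext. intros z. rewrite rin_subl, P_sym, !rin_oppl, rin_subl, P_sym. ring.
Qed.
Lemma T_th k t x : T (vneg k) t (th x) = th (T k (- t) x).
Proof.
  apply (skew_unique (gen (vneg k)) (fun s => T (vneg k) s (th x)) (fun s => th (T k (- s) x))).
  - apply gen_skew.
  - apply HTs.
  - intros s. rewrite gen_th, <- th_opp.
    apply th_hderiv, (hderiv_neg (fun s => T k s x)), HTs.
  - now rewrite Ropp_0, !HT0.
Qed.
End TimeReversal.

(** * Joint continuity of the transport *)

Section TransportContinuity.
Hypothesis HPc : op_cont2 P.
Hypothesis HGc : op_cont2 G.

(** The derivative is taken in operator norm, so one difference quotient already bounds it: two
    contractions divided by s, plus an error of norm at most 1. *)
Lemma G_bound t k : exists c, 0 <= c /\ forall x, hnorm (G t k x) <= c * hnorm x.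
Proof.
  destruct (HG t k 1 ltac:(lra)) as [dl [hd h]]. set (s := dl / 2).
  assert (hs : 0 < s) by (unfold s; lra).
  exists (1 + 2 / s). split.
  { assert (0 < 2 / s) by (apply Rdiv_lt_0_compat; lra). lra. }
  intros x. specialize (h s ltac:(lra) ltac:(rewrite Rabs_pos_eq; unfold s in *; lra) x).
  rewrite Rabs_pos_eq in h by lra.
  set (y := hscal (RtoC s) (G t k x)) in *.
  assert (hy : hnorm y <= s * hnorm x + 2 * hnorm x).
  { replace y with (hadd (hopp (hsub (hsub (P (t + s) k x) (P t k x)) y))
      (hadd (P (t + s) k x) (hopp (P t k x)))).
    - eapply Rle_trans; [apply hnorm_add|]. rewrite hnorm_opp.
      pose proof (hnorm_add (P (t + s) k x) (hopp (P t k x))) as h1. rewrite hnorm_opp in h1.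
      pose proof (P_norm (t + s) k x). pose proof (P_norm t k x). lra.
    - apply rin_ext. intros z. rewrite !rin_addl, !rin_oppl, !rin_subl. ring. }
  unfold y in hy. rewrite hnorm_scalR, Rabs_pos_eq in hy by lra.
  apply (Rmult_le_reg_l s); auto.
  replace (s * ((1 + 2 / s) * hnorm x)) with (s * hnorm x + 2 * hnorm x) by (field; lra).
  exact hy.
Qed.

Lemma gen_cont t k e : 0 < e -> exists dl, 0 < dl /\ forall t' k',
  Rabs (t' - t) < dl -> close k k' dl ->
  forall x, hnorm (hsub (gen k' t' x) (gen k t x)) <= e * hnorm x.
Proof.
  intros he. destruct (G_bound t k) as [c [hc hGb]].
  (* The commutator difference splits into four terms q1, ..., q4; two of them cost r and two cost r
     c, with c bounding G at the base point. *)
  set (r := e / (2 + 2 * c)). assert (hr : 0 < r) by (apply Rdiv_lt_0_compat; lra).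
  assert (hrc : r * (2 + 2 * c) = e) by (unfold r; field; lra).
  destruct (HPc t k r hr) as [d1 [hd1 h1]]. destruct (HGc t k r hr) as [d2 [hd2 h2]].
  exists (Rmin d1 d2). split; [now apply Rmin_pos|]. intros t' k' ht hk x.
  pose proof (Rmin_l d1 d2). pose proof (Rmin_r d1 d2).
  assert (hk1 : close k k' d1) by (intros i; specialize (hk i); lra).
  assert (hk2 : close k k' d2) by (intros i; specialize (hk i); lra).
  pose proof (h1 t' k' ltac:(lra) hk1) as p1. pose proof (h2 t' k' ltac:(lra) hk2) as p2.
  pose proof (hnorm_ge0 x) as hx.
  set (q1 := hsub (G t' k' (P t' k' x)) (G t k (P t' k' x))).
  set (q2 := G t k (hsub (P t' k' x) (P t k x))).
  set (q3 := P t' k' (hsub (G t' k' x) (G t k x))).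
  set (q4 := hsub (P t' k' (G t k x)) (P t k (G t k x))).
  replace (hsub (gen k' t' x) (gen k t x)) with (hadd (hadd q1 q2) (hopp (hadd q3 q4))).
  2:{ unfold q1, q2, q3, q4, gen, comm, opsub, opcomp. rewrite G_sub, P_sub.
      apply rin_ext. intros z. rewrite rin_addl, rin_oppl, !rin_addl, !rin_subl. ring. }
  eapply Rle_trans; [apply hnorm_add|]. rewrite hnorm_opp.
  pose proof (hnorm_add q1 q2). pose proof (hnorm_add q3 q4).
  assert (b1 : hnorm q1 <= r * hnorm x).
  { eapply Rle_trans; [apply p2|]. apply Rmult_le_compat_l; [lra|apply P_norm]. }
  assert (b2 : hnorm q2 <= c * (r * hnorm x)).
  { eapply Rle_trans; [apply hGb|]. apply Rmult_le_compat_l; [lra|apply p1]. }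
  assert (b3 : hnorm q3 <= r * hnorm x).
  { eapply Rle_trans; [apply P_norm|]. apply p2. }
  assert (b4 : hnorm q4 <= r * (c * hnorm x)).
  { eapply Rle_trans; [apply p1|]. apply Rmult_le_compat_l; [lra|apply hGb]. }
  rewrite <- hrc. lra.
Qed.

(** Compactness of [-c, c] makes the modulus in k uniform in time; k and k' at time t are both
    compared with k at a nearby covering time. *)
Lemma gen_cont_uniform k c e : 0 < e -> exists dl, 0 < dl /\ forall t k',
  Rabs t <= c -> close k k' dl ->
  forall x, hnorm (hsub (gen k t x) (gen k' t x)) <= e * hnorm x.
Proof.
  intros he.
  assert (hd : forall t, exists dl : posreal, forall t' k', Rabs (t' - t) < dl -> close k k' dl ->
    forall x, hnorm (hsub (gen k' t' x) (gen k t x)) <= e / 2 * hnorm x).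
  { intros t. destruct (gen_cont t k (e / 2) ltac:(lra)) as [dl [h0 h]].
    now exists (mkposreal dl h0). }
  set (del := fun t => proj1_sig (constructive_indefinite_description _ (hd t))).
  assert (hdel : forall t t' k', Rabs (t' - t) < del t -> close k k' (del t) ->
    forall x, hnorm (hsub (gen k' t' x) (gen k t x)) <= e / 2 * hnorm x).
  { intros t. unfold del. now destruct (constructive_indefinite_description _ (hd t)). }
  destruct (compactness_value_1d (- c) c del) as [dl hdl].
  exists dl. split; [apply cond_pos|]. intros t k' ht hk x.
  apply Rnot_lt_le. intros hno. apply (hdl t); [now apply Rabs_le_between|].
  intros [s [_ [hs1 hs2]]].
  assert (hk1 : close k k' (del s)) by (intros i; specialize (hk i); lra).
  assert (hk0 : close k k (del s)).
  { intros i. rewrite Rminus_diag, Rabs_R0. apply cond_pos. }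
  pose proof (hdel s t k' hs1 hk1 x). pose proof (hdel s t k hs1 hk0 x).
  pose proof (hnorm_sub_tri (gen k t x) (gen k s x) (gen k' t x)) as h3.
  rewrite (hnorm_sub_sym (gen k s x)) in h3. lra.
Qed.

Lemma T_cont t k x e : 0 < e -> exists dl, 0 < dl /\ forall t' k',
  Rabs (t' - t) < dl -> close k k' dl -> hnorm (hsub (T k' t' x) (T k t x)) < e.
Proof.
  intros he. set (c := Rabs t + 1). assert (hc : 0 < c) by (unfold c; pose proof (Rabs_pos t); lra).
  pose proof (rin_ge0 x) as hx.
  (* Makes the bound 2 c r |x|^2 of [skew_compare] at most (e/4)^2; the + 1 covers x = 0. *)
  set (r := e * e / 16 / (2 * c * (rin x x + 1))).
  assert (hr : 0 < r) by (unfold r; apply Rdiv_lt_0_compat; nra).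
  destruct (gen_cont_uniform k c r hr) as [d1 [hd1 h1]].
  destruct (solves_cont (gen k) (fun s => T k s x) t (e / 2) (HTs k x) ltac:(lra)) as [d2 [hd2 h2]].
  exists (Rmin (Rmin d1 d2) 1). split; [repeat apply Rmin_pos; lra|].
  intros t' k' ht hk.
  assert (hmin : Rmin (Rmin d1 d2) 1 <= d1 /\ Rmin (Rmin d1 d2) 1 <= d2 /\ Rmin (Rmin d1 d2) 1 <= 1).
  { unfold Rmin. repeat destruct Rle_dec; lra. }
  assert (hk1 : close k k' d1) by (intros i; specialize (hk i); lra).
  assert (ht' : Rabs t' <= c).
  { replace t' with ((t' - t) + t) by ring. eapply Rle_trans; [apply Rabs_triang|]. unfold c. lra. }
  pose proof (skew_compare (gen k) (gen k') (fun s => T k s x) (fun s => T k' s x) c r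
    (gen_skew k) (gen_skew k') (HTs k x) (HTs k' x) ltac:(cbv beta; now rewrite !HT0) ltac:(lra) ltac:(lra)
    (fun s y hs => h1 s k' hs hk1 y) t' ht') as h3. simpl in h3. rewrite HT0 in h3.
  specialize (h2 t' ltac:(lra)). simpl in h2.
  assert (h4 : hnorm (hsub (T k t' x) (T k' t' x)) <= e / 4).
  { apply hnorm_le_sq; [lra|]. eapply Rle_trans; [apply h3|].
    apply Rle_trans with (r * (2 * c * (rin x x + 1))); [nra|].
    unfold r. right. field. nra. }
  rewrite hnorm_sub_sym in h4.
  pose proof (hnorm_sub_tri (T k' t' x) (T k t' x) (T k t x)). lra.
Qed.

Lemma T_hcont (v : PT d -> H) (p : PT d) :
  hcont v p -> hcont (fun q : PT d => T (snd q) (fst q) (v q)) p.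
Proof.
  intros hv e he. destruct p as [t k].
  destruct (T_cont t k (v (t, k)) (e / 2) ltac:(lra)) as [dl [hd h]].
  assert (hl : locally ((t, k) : PT d) (fun q : PT d =>
    hnorm (hsub (T (snd q) (fst q) (v (t, k))) (T k t (v (t, k)))) < e / 2)).
  { apply locally_PT. exists dl. split; auto. }
  assert (he2 : 0 < e / 2) by lra.
  generalize (filter_and _ _ hl (hv _ he2)). apply filter_imp. intros [t' k'] [h1 h2]. simpl in *.
  (* Transport is isometric, so the error of the moving argument v is not amplified. *)
  pose proof (hnorm_sub_tri (T k' t' (v (t', k'))) (T k' t' (v (t, k))) (T k t (v (t, k)))) as h3.
  rewrite <- T_sub, T_norm in h3. lra.
Qed.

End TransportContinuity.

(** * Bloch frames and matching matrices *)

Lemma vneg_vneg (k : Rvec d) : vneg (vneg k) = k.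
Proof. apply functional_extensionality. intros i. unfold vneg. ring. Qed.

Section BlochFrames.
Context (m : nat) (b : bool) (th : @Op H) (xi0 : nat -> Rvec d -> H).
Hypothesis Hrank : forall t k, has_rank (P t k) m.
Hypothesis HPc : op_cont2 P.
Hypothesis HGc : op_cont2 G.
Hypothesis Hth : is_antiunitary th.
Hypothesis Hth2 : theta_sq th b.
Hypothesis HPtrs : trs_family th P.
Hypothesis Hxi0 : restricted_frame P th b m xi0.

Let E : Mat := epsm b m.
Let sgn : Cx := if b then Copp C1 else C1.
Definition xi (k : Rvec d) : nat -> H := fun a => xi0 a k.
Definition Tx (k : Rvec d) (s : R) : nat -> H := fun a => T k s (xi0 a k).

Lemma E_real : mconj E = E.
Proof.
  apply functional_extensionality; intros i. apply functional_extensionality; intros j.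
  unfold mconj, E, epsm, Jmat, Imat. destruct b; cbv zeta;
  repeat match goal with |- context [if ?c then _ else _] => destruct c end;
  apply Cx_eq; simpl; ring.
Qed.
Lemma E_adj : madj E = mtr E.
Proof. rewrite <- mconj_tr. change (mconj (mtr E)) with (mtr (mconj E)). now rewrite E_real. Qed.

Lemma xi_onb k : is_onb_ran (P 0 k) m (xi k).
Proof. apply Hxi0. Qed.
Lemma xi_neg k c : (c < m)%nat -> xi (vneg k) c = fmul m (fun a => th (xi k a)) E c.
Proof. intros hc. now apply Hxi0. Qed.
Lemma xi_periodic k n a : (a < m)%nat -> xi (vshift k n) a = xi k a.
Proof. intros ha. now apply Hxi0. Qed.
Lemma gram_th v w : meq m (gram (fun a => th (v a)) (fun a => th (w a))) (mconj (gram v w)).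
Proof. intros i j _ _. unfold gram, mconj. now apply th_hinner. Qed.
Lemma th_fmul v M c : th (fmul m v M c) = fmul m (fun a => th (v a)) (mconj M) c.
Proof. apply antimap_fmul; apply Hth. Qed.
Lemma T_fmul k s v M c : T k s (fmul m v M c) = fmul m (fun a => T k s (v a)) M c.
Proof. apply map_fmul; intros; [apply T_add|apply T_scal]. Qed.
Lemma gram_T k s v w : meq m (gram (fun a => T k s (v a)) (fun a => T k s (w a))) (gram v w).
Proof. intros i j _ _. unfold gram. apply T_hinner. Qed.

(** Read off from the frame, since xi(-k) and theta xi(k) are both orthonormal and differ by E. The
    formula for J would involve the parity of m. *)
Lemma E_unitary : is_unitary m E.
Proof.
  apply left_unitary. set (k := fun _ : Idx d => 0).
  rewrite <- (onb_gram _ m _ (xi_onb (vneg k))).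
  rewrite (gram_ext m _ _ _ _ (xi_neg k) (xi_neg k)), gram_fmul_r, gram_fmul_l, gram_th.
  now rewrite (onb_gram _ m _ (xi_onb k)), mconj_1, mmul_1_r.
Qed.
Lemma th_th x : th (th x) = hscal sgn x.
Proof.
  rewrite Hth2. unfold sgn. destruct b; [|now rewrite hscal_1].
  apply rin_ext. intros z. rewrite rin_oppl. unfold rin. rewrite hinner_scall. simpl. ring.
Qed.
(** Applying the symmetry of the frame twice returns to k, so theta^2 = [sgn] forces the
    relation. *)
Lemma E_sq : meq m (mscal sgn (mmul m E E)) Imat.
Proof.
  set (k := fun _ : Idx d => 0).
  assert (h : forall c, (c < m)%nat -> xi k c = fmul m (fun a => th (th (xi k a))) (mmul m E E) c).
  { intros c hc. rewrite <- (vneg_vneg k) at 1. rewrite (xi_neg (vneg k) c hc).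
    rewrite <- E_real at 2. rewrite <- fmul_fmul. apply fmul_ext. intros a ha.
    now rewrite (xi_neg k a ha), th_fmul. }
  assert (hs : meq m (gram (xi k) (fun a => th (th (xi k a)))) (mscal sgn (gram (xi k) (xi k)))).
  { intros i j _ _. unfold gram, mscal. now rewrite th_th, hinner_scal. }
  pose proof (onb_gram _ m _ (xi_onb k)) as h1.
  rewrite (gram_ext m (xi k) (xi k) (xi k) _ (fun _ _ => eq_refl) h), gram_fmul_r, hs in h1.
  rewrite <- h1 at 1. rewrite (onb_gram _ m _ (xi_onb k)), mmul_scal_l, mmul_1_l. reflexivity.
Qed.
Lemma E_tr : meq m (mtr E) (mscal sgn E).
Proof.
  pose proof E_unitary as h. apply unitary_iff in h. destruct h as [h _].
  rewrite <- E_adj, <- (mmul_1_r m (madj E)), <- E_sq, mmul_scal_r, mmul_cancel by exact h.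
  reflexivity.
Qed.
(** The sign in E^t = sgn E cancels against sgn E^2 = 1, which lets the bosonic and fermionic cases
    share one computation. *)
Lemma E_sandwich X : meq m (mmul m (mtr E) (mmul m X (mmul m E E))) (mmul m E X).
Proof.
  rewrite E_tr, mmul_scal_l, <- mmul_scal_r, <- mmul_scal_r, E_sq, mmul_1_r. reflexivity.
Qed.
(** Gram matrices naturally give A(-k) = E* A(k)^t E; this converts that form into the matching
    condition. *)
Lemma matching_of_twist A A' :
  meq m A' (mmul m (madj E) (mmul m (mtr A) E)) -> meq m (mmul m E A) (mmul m (mtr A') E).
Proof.
  intros h. rewrite h, !mtr_mul, mtr_tr, mtr_adj, E_real, !mmul_assoc. symmetry. apply E_sandwich.
Qed.

Lemma Tx_onb k s : is_onb_ran (P s k) m (Tx k s).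
Proof.
  pose proof (xi_onb k) as h. apply orthonormal_onb; auto.
  - unfold Tx. rewrite gram_T. now apply (onb_gram _ m (xi k) h).
  - intros a ha. apply T_ran. now apply h.
Qed.
Lemma P_shift t k n1 : P (t + IZR n1) k = P t k.
Proof. rewrite <- (vshift_0 k) at 1. apply HPper. Qed.
Lemma Tx_onb1 k : is_onb_ran (P 0 k) m (Tx k 1).
Proof. rewrite <- (P_shift 0 k 1), Rplus_0_l. apply Tx_onb. Qed.
Lemma Tx_neg k s c : (c < m)%nat ->
  Tx (vneg k) (- s) c = fmul m (fun a => th (Tx k s a)) E c.
Proof.
  intros hc. unfold Tx. change (xi0 c (vneg k)) with (xi (vneg k) c).
  rewrite (xi_neg k c hc), T_fmul. apply fmul_ext. intros a _.
  rewrite (T_th th Hth HPtrs k (- s)). now rewrite Ropp_involutive.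
Qed.
Lemma Tx_periodic k n s a : (a < m)%nat -> Tx (vshift k n) s a = Tx k s a.
Proof.
  intros ha. unfold Tx. change (xi0 a (vshift k n)) with (xi (vshift k n) a).
  now rewrite xi_periodic, T_periodic.
Qed.

Definition alpha (k : Rvec d) : Mat := gram (xi k) (Tx k 1).

Lemma Tx_shift k s c : (c < m)%nat -> Tx k (s + 1) c = fmul m (Tx k s) (alpha k) c.
Proof.
  intros hc. unfold Tx. rewrite T_shift. change (T k 1 (xi0 c k)) with (Tx k 1 c).
  rewrite (onb_expand _ m (xi k) (Tx k 1) (xi_onb k)); auto; [apply T_fmul|].
  apply Tx_onb1.
Qed.

(** Common source of [alpha_neg], where w is the frame at time 0, and of [rot_neg], where w is the
    global frame at time s. *)
Lemma gram_Tx_neg w w' k s :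
  (forall c, (c < m)%nat -> w' c = fmul m (fun a => th (w a)) E c) ->
  meq m (gram w' (Tx (vneg k) (- s)))
        (mmul m (madj E) (mmul m (mconj (gram w (Tx k s))) E)).
Proof.
  intros h. rewrite (gram_ext m _ _ _ _ h (Tx_neg k s)), gram_fmul_r, gram_fmul_l, gram_th.
  apply mmul_assoc.
Qed.

Lemma alpha_neg k : meq m (alpha (vneg k)) (mmul m (madj E) (mmul m (mtr (alpha k)) E)).
Proof.
  unfold alpha at 1. replace 1 with (- -1) by ring. rewrite (gram_Tx_neg (xi k)) by apply xi_neg.
  (* T(-1) inverts T(1): applying it to the expansion of xi in T(1) xi shows that T(-1) xi has
     coordinates alpha*. *)
  assert (e : meq m (gram (xi k) (Tx k (-1))) (madj (alpha k))).
  { unfold alpha. rewrite gram_adj.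
    assert (h : forall c, (c < m)%nat -> Tx k (-1) c = fmul m (xi k) (gram (Tx k 1) (xi k)) c).
    { intros c hc. unfold Tx at 1. change (xi0 c k) with (xi k c).
      rewrite (onb_expand _ m (Tx k 1) (xi k) (Tx_onb1 k)); auto; [|apply xi_onb].
      rewrite T_fmul. apply fmul_ext. intros a _. unfold Tx.
      rewrite <- T_shift. replace (-1 + 1) with 0 by ring. apply HT0. }
    rewrite (gram_ext m _ _ _ _ (fun _ _ => eq_refl) h), gram_fmul_r.
    now rewrite (onb_gram _ m _ (xi_onb k)), mmul_1_l. }
  rewrite e, mconj_adj. reflexivity.
Qed.
Lemma alpha_unitary k : is_unitary m (alpha k).
Proof. apply (gram_unitary (P 0 k)); [apply xi_onb|apply Tx_onb1]. Qed.
Lemma alpha_periodic k n : meq m (alpha (vshift k n)) (alpha k).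
Proof. apply gram_ext; intros; [now apply xi_periodic|now apply Tx_periodic]. Qed.

Lemma xi_hcont a (p : PT d) : (a < m)%nat -> hcont (fun q : PT d => xi (snd q) a) p.
Proof.
  intros ha e he. destruct p as [t k]. destruct Hxi0 as [_ [hs _]].
  destruct (hs a ha O) as [hc _]. destruct (hc k e he) as [dl [hd h]].
  apply locally_PT. exists dl. split; auto. intros t' k' _ hk. now apply h.
Qed.
Lemma Tx_hcont a (p : PT d) : (a < m)%nat -> hcont (fun q : PT d => Tx (snd q) (fst q) a) p.
Proof. intros ha. apply (T_hcont HPc HGc (fun q : PT d => xi (snd q) a)). now apply xi_hcont. Qed.

Lemma matching_intro (A : R -> Rvec d -> Mat) t :
  (forall p : PT d, mcont m (fun q : PT d => A (fst q) (snd q)) p) ->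
  (forall k n, meq m (A t (vshift k n)) (A t k)) -> (forall k, is_unitary m (A t k)) ->
  (forall k, meq m (A t (vneg k)) (mmul m (madj E) (mmul m (mtr (A t k)) E))) ->
  matching b m (A t).
Proof.
  intros hc hp hu hn. repeat apply conj.
  - intros k eps he.
    pose proof (proj1 (mcont_Cnorm m (fun q : PT d => A (fst q) (snd q)) (t, k)) (hc (t, k)) eps he) as h.
    apply locally_PT in h. destruct h as [dl [hd h]]. exists dl. split; auto.
    intros k' hk i j hi hj. apply (h t k'); auto. now rewrite Rminus_diag, Rabs_R0.
  - intros k n i j hi hj. now apply hp.
  - auto.
  - intros k. exact (matching_of_twist _ _ (hn k)).
Qed.

Lemma alpha_matching : matching b m alpha.
Proof.
  (* alpha is the slice at time 1 of a jointly continuous family, which is the form that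
     [matching_intro] expects. *)
  apply (matching_intro (fun t k => gram (xi k) (Tx k t)) 1).
  - intros p. apply mcont_gram; intros; [now apply xi_hcont|now apply Tx_hcont].
  - apply alpha_periodic.
  - apply alpha_unitary.
  - apply alpha_neg.
Qed.

(** * From a global frame to a null-homotopy *)

Section FrameToHomotopy.
Variable Xi : nat -> R -> Rvec d -> H.
Hypothesis HXi : full_frame P th b m Xi.

Definition rot (s : R) (k : Rvec d) : Mat := gram (fun a => Xi a s k) (Tx k s).

Lemma rot_unitary s k : is_unitary m (rot s k).
Proof. apply (gram_unitary (P s k)); [apply HXi|apply Tx_onb]. Qed.
Lemma Xi_periodic a s k n1 n : (a < m)%nat -> Xi a (s + IZR n1) (vshift k n) = Xi a s k.
Proof. intros ha. now apply HXi. Qed.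
Lemma rot_periodic s k n : meq m (rot s (vshift k n)) (rot s k).
Proof.
  apply gram_ext; intros; [|now apply Tx_periodic].
  rewrite <- (Rplus_0_r s) at 1. now apply (Xi_periodic a s k 0 n).
Qed.
Lemma rot_shift s k : meq m (rot (s + 1) k) (mmul m (rot s k) (alpha k)).
Proof.
  unfold rot. rewrite (gram_ext m _ (fun a => Xi a s k) _ _) with (2 := Tx_shift k s).
  - apply gram_fmul_r.
  - intros a ha. rewrite <- (vshift_0 k) at 1. now apply (Xi_periodic a s k 1).
Qed.
Lemma rot_neg s k : meq m (rot (- s) (vneg k)) (mmul m (madj E) (mmul m (mconj (rot s k)) E)).
Proof. apply gram_Tx_neg. intros c hc. now apply HXi. Qed.
Lemma rot_mcont p : mcont m (fun q : PT d => rot (fst q) (snd q)) p.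
Proof.
  apply mcont_gram; intros a ha; [|now apply Tx_hcont]. intros e he. destruct p as [t k].
  destruct HXi as [_ [hc _]]. destruct (hc a ha t k e he) as [dl [hd h]].
  apply locally_PT. exists dl. auto.
Qed.

Definition rot_homotopy (t : R) (k : Rvec d) : Mat :=
  mmul m (madj (rot (- ((1 - t) / 2)) k)) (rot ((1 - t) / 2) k).

Lemma rot_homotopy_mcont p : mcont m (fun q : PT d => rot_homotopy (fst q) (snd q)) p.
Proof.
  assert (h : forall phi : R -> R, (forall s t, Rabs (phi s - phi t) <= 1 * Rabs (s - t)) ->
    mcont m (fun q : PT d => rot (phi (fst q)) (snd q)) p).
  { intros phi hphi.
    apply (mcont_comp m (fun q : PT d => ((phi (fst q), snd q) : PT d))
      (fun q : PT d => rot (fst q) (snd q))).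
    - apply (continuous_reparam 1); [lra|auto].
    - apply rot_mcont. }
  apply (mcont_mul m (fun q : PT d => madj (rot (- ((1 - fst q) / 2)) (snd q)))); [apply mcont_adj|].
  - apply (h (fun t => - ((1 - t) / 2))). intros s t. unfold Rabs; repeat destruct Rcase_abs; lra.
  - apply (h (fun t => (1 - t) / 2)). intros s t. unfold Rabs; repeat destruct Rcase_abs; lra.
Qed.

(** Reversal exchanges the times -s and s, hence swaps the two factors of the product, which amounts
    to a transpose framed by E. *)
Lemma rot_homotopy_neg t k :
  meq m (rot_homotopy t (vneg k)) (mmul m (madj E) (mmul m (mtr (rot_homotopy t k)) E)).
Proof.
  unfold rot_homotopy. set (s := (1 - t) / 2).
  pose proof E_unitary as hE. apply unitary_iff in hE. destruct hE as [_ hE].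
  rewrite rot_neg. replace s with (- - s) at 2 by ring. rewrite rot_neg.
  rewrite !madj_mul, madj_conj, madj_adj, mtr_mul, mtr_adj, !mmul_assoc.
  rewrite (mmul_cancel m E (madj E)) by exact hE. reflexivity.
Qed.

Lemma homotopy_of_frame : equiv_null_homotopic b m alpha.
Proof.
  exists rot_homotopy. repeat apply conj.
  - intros k. change (meq m (rot_homotopy 0 k) (alpha k)). unfold rot_homotopy.
    (* U(1/2) = U(-1/2) alpha by [rot_shift], so the product starts at alpha. *)
    replace ((1 - 0) / 2) with (/ 2) by field. replace (rot (/ 2) k) with (rot (- / 2 + 1) k)
      by (f_equal; field).
    rewrite rot_shift. apply mmul_cancel. apply (unitary_iff m (rot (- / 2) k)), rot_unitary.
  - intros k. change (meq m (rot_homotopy 1 k) Imat). unfold rot_homotopy.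
    replace ((1 - 1) / 2) with 0 by field. rewrite Ropp_0.
    apply (unitary_iff m (rot 0 k)), rot_unitary.
  - intros t _. apply matching_intro.
    + apply rot_homotopy_mcont.
    + intros k n. unfold rot_homotopy. now rewrite !rot_periodic.
    + intros k. apply unitary_mul; [apply unitary_adj|]; apply rot_unitary.
    + apply rot_homotopy_neg.
  - intros t k eps _ he.
    pose proof (proj1 (mcont_Cnorm m (fun q : PT d => rot_homotopy (fst q) (snd q)) (t, k))
      (rot_homotopy_mcont (t, k)) eps he) as h.
    apply locally_PT in h. destruct h as [dl [hd h]]. exists dl. split; auto.
    intros t' k' _ ht hk. now apply (h t' k').
Qed.
End FrameToHomotopy.

(** * From a null-homotopy to a global frame *)

Section HomotopyToFrame.
Variable A : R -> Rvec d -> Mat.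
Hypothesis HA0 : forall k, meq m (A 0 k) (alpha k).
Hypothesis HA1 : forall k, meq m (A 1 k) Imat.
Hypothesis HAm : forall t, 0 <= t <= 1 -> matching b m (A t).
Hypothesis HAc : forall t k eps, 0 <= t <= 1 -> 0 < eps -> exists delta, 0 < delta /\
  forall t' k', 0 <= t' <= 1 -> Rabs (t' - t) < delta -> close k k' delta ->
  forall i j, (i < m)%nat -> (j < m)%nat -> Cnorm (Csub (A t' k' i j) (A t k i j)) < eps.

(** The lift starts at the identity, so the homotopy is run backwards; clamping keeps every real
    time inside [0, 1], where A is controlled. *)
Definition rev_homotopy (t : R) : Rvec d -> Mat := A (1 - clampR 1 t).

Lemma rev_matching t : matching b m (rev_homotopy t).
Proof. apply HAm. pose proof (clampR_le 1 t Rle_0_1). lra. Qed.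

Lemma homotopy_lift : exists V : R -> Rvec d -> Mat,
  (forall p : PT d, mcont m (fun q : PT d => V (fst q) (snd q)) p) /\
  (forall t k, is_unitary m (V t k)) /\
  (forall t k n, meq m (V t (vshift k n)) (V t k)) /\
  (forall t k, t <= 0 -> meq m (V t k) Imat) /\
  (forall k, meq m (mmul m E (alpha k)) (mmul m (mtr (V 1 (vneg k))) (mmul m E (V 1 k)))).
Proof.
  destruct (lift_exists m E rev_homotopy E_unitary) as [V (h1 & h2 & h3 & h4 & h6)].
  - intros t k. apply (rev_matching t).
  - intros [t k]. apply mcont_Cnorm. intros eps he.
    assert (h01 : 0 <= 1 - clampR 1 t <= 1) by (pose proof (clampR_le 1 t Rle_0_1); lra).
    destruct (HAc (1 - clampR 1 t) k eps h01 he) as [dl [hd h]].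
    apply locally_PT. exists dl. split; auto. intros t' k' ht hk i j hi hj.
    apply (h (1 - clampR 1 t') k'); auto.
    + pose proof (clampR_le 1 t' Rle_0_1). lra.
    + pose proof (clampR_lip 1 t t') as hl. rewrite (Rabs_minus_sym t t') in hl.
      replace (1 - clampR 1 t' - (1 - clampR 1 t)) with (clampR 1 t - clampR 1 t') by ring. lra.
  - intros t k n i j hi hj. now apply (rev_matching t).
  - intros t k i j hi hj. now apply (rev_matching t).
  - intros k. unfold rev_homotopy. rewrite clampR_neg, Rminus_0_r by lra. apply HA1.
  - exists V. repeat apply conj; auto. intros k. rewrite <- h6. unfold rev_homotopy.
    (* Two nested clamps are removed: that of [lifts_upto] and that of [rev_homotopy]. *)
    rewrite (clampR_id 1 1), (clampR_id 1 1), Rminus_diag, HA0 by lra. reflexivity.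
Qed.

(** * Correction of the transported frame and gluing of period cells *)

Section Gluing.
Variable V : R -> Rvec d -> Mat.
Hypothesis HVc : forall p : PT d, mcont m (fun q : PT d => V (fst q) (snd q)) p.
Hypothesis HVu : forall t k, is_unitary m (V t k).
Hypothesis HVp : forall t k n, meq m (V t (vshift k n)) (V t k).
Hypothesis HV0 : forall t k, t <= 0 -> meq m (V t k) Imat.
Hypothesis HVE : forall k,
  meq m (mmul m E (alpha k)) (mmul m (mtr (V 1 (vneg k))) (mmul m E (V 1 k))).

(** What time reversal makes of the correction V*: complex conjugation turns the adjoint into a
    transpose, framed by E. *)
Definition corr_neg (s : R) (k : Rvec d) : Mat :=
  mmul m (madj E) (mmul m (mtr (V (2 * - s) (vneg k))) E).
(* For every s one of the two factors is the identity. *)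
Definition corr (s : R) (k : Rvec d) : Mat := mmul m (corr_neg s k) (madj (V (2 * s) k)).

Lemma E_left : meq m (mmul m (madj E) E) Imat.
Proof. apply (unitary_iff m E), E_unitary. Qed.
Lemma E_right : meq m (mmul m E (madj E)) Imat.
Proof. apply (unitary_iff m E), E_unitary. Qed.

Lemma corr_neg_1 s k : 0 <= s -> meq m (corr_neg s k) Imat.
Proof. intros hs. unfold corr_neg. rewrite HV0, mtr_1, mmul_1_l by lra. apply E_left. Qed.
Lemma corr_unitary s k : is_unitary m (corr s k).
Proof.
  repeat apply unitary_mul; try apply unitary_adj; auto using E_unitary. apply unitary_tr, HVu.
Qed.
Lemma vneg_vshift (k : Rvec d) n : vneg (vshift k n) = vshift (vneg k) (fun i => (- n i)%Z).
Proof.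
  apply functional_extensionality. intros i. unfold vneg, vshift. rewrite opp_IZR. ring.
Qed.
Lemma corr_periodic s k n : meq m (corr s (vshift k n)) (corr s k).
Proof. unfold corr, corr_neg. now rewrite vneg_vshift, !HVp. Qed.
Lemma corr_mcont p : mcont m (fun q : PT d => corr (fst q) (snd q)) p.
Proof.
  assert (h : forall (phi : R -> R) (p : PT d), (forall s t, Rabs (phi s - phi t) <= 2 * Rabs (s - t)) ->
    mcont m (fun q : PT d => V (phi (fst q)) (snd q)) p).
  { intros phi p' hphi.
    apply (mcont_comp m (fun q : PT d => ((phi (fst q), snd q) : PT d))
      (fun q : PT d => V (fst q) (snd q))).
    - apply (continuous_reparam 2); [lra|auto].
    - apply HVc. }
  apply (mcont_mul m (fun q : PT d => corr_neg (fst q) (snd q)));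
    [|apply (mcont_adj m (fun q : PT d => V (2 * fst q) (snd q)))].
  - apply (mcont_mul m (fun _ => madj E)); [apply mcont_const|].
    apply (mcont_mul m (fun q : PT d => mtr (V (2 * - fst q) (vneg (snd q))))); [|apply mcont_const].
    apply (mcont_tr m (fun q : PT d => V (2 * - fst q) (vneg (snd q)))).
    apply (mcont_comp m (fun q : PT d => ((fst q, vneg (snd q)) : PT d))
      (fun q : PT d => V (2 * - fst q) (snd q))); [apply continuous_neg_k|].
    apply (h (fun s => 2 * - s)). intros s t. unfold Rabs; repeat destruct Rcase_abs; lra.
  - apply (h (fun s => 2 * s)). intros s t. unfold Rabs; repeat destruct Rcase_abs; lra.
Qed.
Lemma mconj_corr_neg s k :
  meq m (mconj (corr_neg s k)) (mmul m (mtr E) (mmul m (madj (V (2 * - s) (vneg k))) E)).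
Proof. unfold corr_neg. now rewrite !mconj_mul, mconj_adj, mconj_tr, E_real. Qed.
Lemma corr_neg_neg s k :
  meq m (corr_neg (- s) (vneg k)) (mmul m (madj E) (mmul m (mtr (V (2 * s) k)) E)).
Proof. unfold corr_neg. now rewrite Ropp_involutive, vneg_vneg. Qed.
(** This is the time-reversal symmetry of [cell_frame] expressed through its coordinates. The sign
    of s decides which factor survives on each side. *)
Lemma corr_neg_k s k :
  meq m (mmul m E (corr (- s) (vneg k))) (mmul m (mconj (corr s k)) E).
Proof.
  unfold corr. rewrite mconj_mul, mconj_adj, corr_neg_neg.
  destruct (Rle_dec 0 s) as [hs|hs].
  - rewrite (corr_neg_1 s k hs), (HV0 (2 * - s)), madj_1, mmul_1_r, mconj_1, mmul_1_l by lra.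
    rewrite <- mmul_assoc, E_right, mmul_1_l. reflexivity.
  - rewrite (HV0 (2 * s)), mtr_1, !mmul_1_l, mmul_1_r, E_left, mmul_1_l by lra.
    rewrite mconj_corr_neg, !mmul_assoc, E_sandwich. reflexivity.
Qed.
(** Both sides are evaluated with V at time 1: alpha V_1(k)* = E* V_1(-k)^t E is [HVE] multiplied by
    E* on the left and V_1(k)* on the right. *)
Lemma corr_glue k : meq m (mmul m (alpha k) (corr (/ 2) k)) (corr (- / 2) k).
Proof.
  unfold corr. rewrite (corr_neg_1 (/ 2) k), mmul_1_l by lra. rewrite (HV0 (2 * - / 2)), madj_1, mmul_1_r by lra.
  unfold corr_neg. replace (2 * - - / 2) with 1 by field. replace (2 * / 2) with 1 by field.
  rewrite <- (mmul_cancel m (madj E) E (alpha k)) by apply E_left.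
  rewrite HVE, !mmul_assoc.
  rewrite (proj2 (proj1 (unitary_iff m (V 1 k)) (HVu 1 k))), mmul_1_r. reflexivity.
Qed.

Definition cell_frame (s : R) (k : Rvec d) : nat -> H := fmul m (Tx k s) (corr s k).

Lemma cell_onb s k : is_onb_ran (P s k) m (cell_frame s k).
Proof. apply fmul_onb; [apply HP|apply Tx_onb|apply corr_unitary]. Qed.
Lemma cell_periodic s k n c : (c < m)%nat -> cell_frame s (vshift k n) c = cell_frame s k c.
Proof.
  intros hc. unfold cell_frame. rewrite (fmul_meq m _ _ _ c (corr_periodic s k n) hc).
  apply fmul_ext. intros a ha. now apply Tx_periodic.
Qed.
Lemma cell_neg s k c : (c < m)%nat ->
  cell_frame (- s) (vneg k) c = trs_image th b m (cell_frame s k) c.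
Proof.
  intros hc. change (trs_image th b m (cell_frame s k) c)
    with (fmul m (fun a => th (cell_frame s k a)) E c).
  unfold cell_frame. rewrite (fmul_ext m _ (fmul m (fun a => th (Tx k s a)) E)) by apply Tx_neg.
  rewrite fmul_fmul, (fmul_meq m _ _ _ c (corr_neg_k s k) hc), <- fmul_fmul.
  apply fmul_ext. intros a _. symmetry. apply th_fmul.
Qed.
Lemma cell_glue k c : (c < m)%nat -> cell_frame (/ 2) k c = cell_frame (- / 2) k c.
Proof.
  intros hc. unfold cell_frame at 1. replace (Tx k (/ 2)) with (Tx k (- / 2 + 1)) by (f_equal; field).
  rewrite (fmul_ext m _ (fmul m (Tx k (- / 2)) (alpha k))) by apply Tx_shift.
  rewrite fmul_fmul. exact (fmul_meq m _ _ _ c (corr_glue k) hc).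
Qed.
Lemma cell_hcont c p : (c < m)%nat -> hcont (fun q : PT d => cell_frame (fst q) (snd q) c) p.
Proof.
  intros hc. apply (hcont_fmul m (fun q : PT d => Tx (snd q) (fst q))); auto.
  - intros a ha. now apply Tx_hcont.
  - apply corr_mcont.
Qed.

(** The shift by 1/2 centres the cell: [cellR] takes values in [-1/2, 1/2), which negation preserves
    except at the endpoint -1/2. *)
Definition cellZ (t : R) : Z := Int_part (t + / 2).
Definition cellR (t : R) : R := t - IZR (cellZ t).

Lemma cellR_bounds t : - / 2 <= cellR t < / 2.
Proof. unfold cellR, cellZ. destruct (base_Int_part (t + / 2)). lra. Qed.
Lemma cellR_unique t y n : - / 2 <= y < / 2 -> t = y + IZR n -> cellR t = y.
Proof.
  intros hy ->. unfold cellR, cellZ.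
  rewrite <- (Int_part_spec (y + IZR n + / 2) n) by lra. lra.
Qed.
Lemma cellR_eq t : t = cellR t + IZR (cellZ t).
Proof. unfold cellR. ring. Qed.
Lemma cellR_periodic t n : cellR (t + IZR n) = cellR t.
Proof.
  apply (cellR_unique _ _ (cellZ t + n)); [apply cellR_bounds|].
  rewrite plus_IZR, (cellR_eq t) at 1. ring.
Qed.
Lemma cellR_neg t :
  cellR (- t) = - cellR t \/ (cellR (- t) = - / 2 /\ cellR t = - / 2).
Proof.
  pose proof (cellR_bounds t) as h. pose proof (cellR_eq t) as e.
  destruct (Req_dec (cellR t) (- / 2)) as [e1|n1].
  - right. split; auto. apply (cellR_unique _ _ (1 - cellZ t)); [lra|].
    rewrite minus_IZR. lra.
  - left. apply (cellR_unique _ _ (- cellZ t)); [lra|]. rewrite opp_IZR. lra.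
Qed.
(** Locally a translation, except to the left of a half-integer, where [cellR] tends to 1/2 although
    its value at the point is -1/2. *)
Lemma cellR_near t0 : exists dl, 0 < dl /\ forall t, Rabs (t - t0) < dl ->
  cellR t - cellR t0 = t - t0 \/ (cellR t0 = - / 2 /\ cellR t - / 2 = t - t0).
Proof.
  pose proof (cellR_bounds t0) as h. pose proof (cellR_eq t0) as e.
  destruct (Req_dec (cellR t0) (- / 2)) as [e1|n1].
  - exists (/ 2). split; [lra|]. intros t ht. apply Rabs_lt_between in ht.
    destruct (Rle_dec 0 (t - t0)) as [hp|hn].
    + left. rewrite (cellR_unique t (cellR t0 + (t - t0)) (cellZ t0)); lra.
    + right. split; auto. rewrite (cellR_unique t (/ 2 + (t - t0)) (cellZ t0 - 1)); [lra|lra|].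
      rewrite minus_IZR. lra.
  - exists (Rmin (cellR t0 + / 2) (/ 2 - cellR t0)). split; [apply Rmin_pos; lra|].
    intros t ht. pose proof (Rmin_l (cellR t0 + / 2) (/ 2 - cellR t0)).
    pose proof (Rmin_r (cellR t0 + / 2) (/ 2 - cellR t0)). apply Rabs_lt_between in ht.
    left. rewrite (cellR_unique t (cellR t0 + (t - t0)) (cellZ t0)); lra.
Qed.

Definition glued_frame (c : nat) (t : R) (k : Rvec d) : H := cell_frame (cellR t) k c.

Lemma glued_cont c t k eps : (c < m)%nat -> 0 < eps -> exists delta, 0 < delta /\ forall t' k',
  Rabs (t' - t) < delta -> close k k' delta ->
  hnorm (hsub (glued_frame c t' k') (glued_frame c t k)) < eps.
Proof.
  intros hc he.
  destruct (proj1 (locally_PT _ _ _) (cell_hcont c (cellR t, k) hc eps he)) as [d1 [hd1 h1]].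
  destruct (proj1 (locally_PT _ _ _) (cell_hcont c (/ 2, k) hc eps he)) as [d2 [hd2 h2]].
  destruct (cellR_near t) as [d3 [hd3 h3]].
  exists (Rmin d3 (Rmin d1 d2)). split; [repeat apply Rmin_pos; auto|].
  intros t' k' ht hk.
  assert (hmin : Rmin d3 (Rmin d1 d2) <= d1 /\ Rmin d3 (Rmin d1 d2) <= d2 /\ Rmin d3 (Rmin d1 d2) <= d3).
  { unfold Rmin. repeat destruct Rle_dec; lra. }
  unfold glued_frame. destruct (h3 t') as [e|[e0 e]]; [lra| |].
  - apply (h1 (cellR t') k'); [rewrite e; lra|]. intros i. specialize (hk i). lra.
  - rewrite e0, <- cell_glue by auto. apply (h2 (cellR t') k'); [rewrite e; lra|].
    intros i. specialize (hk i). lra.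
Qed.

Lemma glued_full_frame : full_frame P th b m glued_frame.
Proof.
  repeat apply conj.
  - intros t k. rewrite (cellR_eq t) at 1. rewrite P_shift. apply cell_onb.
  - intros c hc t k eps he. now apply glued_cont.
  - intros c t k n1 n hc. unfold glued_frame. rewrite cellR_periodic. now apply cell_periodic.
  - intros c t k hc. unfold glued_frame.
    destruct (cellR_neg t) as [e|[e1 e2]].
    + rewrite e. now apply cell_neg.
    + rewrite e1, <- cell_glue, e2 by auto. replace (/ 2) with (- - / 2) at 1 by ring. now apply cell_neg.
Qed.
End Gluing.

Lemma frame_of_homotopy : exists Xi, full_frame P th b m Xi.
Proof.
  destruct homotopy_lift as [V (h1 & h2 & h3 & h4 & h5)].
  exists (glued_frame V). now apply glued_full_frame.
Qed.
End HomotopyToFrame.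
End BlochFrames.
End Transport.

Theorem theorem2p6
  (d m : nat) (Hd : (1 <= d)%nat) (H : HilbertSpace)
  (P : R -> Rvec d -> (H -> H)) (th : H -> H) (b : bool)
  (HPproj : forall t k, is_orth_proj (P t k) /\ has_rank (P t k) m)
  (HPC1 : C1_family P)
  (HPper : forall t k (n1 : Z) (n : Idx d -> Z), P (t + IZR n1) (vshift k n) = P t k)
  (Hth : is_antiunitary th) (Hth2 : theta_sq th b)
  (HPtrs : trs_family th P)
  (xi0 : nat -> Rvec d -> H) (Hxi0 : restricted_frame P th b m xi0)
  (T : Rvec d -> R -> (H -> H))
  (HT0 : forall k x, T k 0 x = x)
  (HTode : forall k t G, is_opderiv (fun s => P s k) t G ->
             is_opderiv (T k) t (opcomp (comm G (P t k)) (T k t))) :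
  let alpha : Rvec d -> Mat := fun k a c => hinner (xi0 a k) (T k 1 (xi0 c k)) in
  matching b m alpha /\
  (equiv_null_homotopic b m alpha <-> exists Xi, full_frame P th b m Xi).
Proof.
  destruct HPC1 as [G [_ [HG [_ [HPc [HGc _]]]]]].
  assert (HP : forall t k, is_orth_proj (P t k)) by (intros; apply HPproj).
  assert (Hr : forall t k, has_rank (P t k) m) by (intros; apply HPproj).
  (* The equation is given for any derivative of P in k_1; it is used with the norm-continuous one
     from [C1_family], and only along the orbits of single vectors. *)
  assert (HTs : forall k x, solves (gen P G k) (fun t => T k t x)).
  { intros k x t. apply (hderiv_opderiv (T k) t (opcomp (gen P G k t) (T k t))).
    apply HTode, HG. }
  intros al. change al with (alpha T xi0). split.
  - eapply alpha_matching; eauto.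
  - split.
    + intros [A (h0 & h1 & h2 & h3)]. eapply (frame_of_homotopy P G T); eauto.
    + intros [Xi hXi]. eapply (homotopy_of_frame P G T); eauto.
Qed.
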